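(* There exist universal constants $c,C>0$ such that the following holds. Let $d\in\mathbb{N}$, $t>0$ and $s\in\mathbb{N}$ with $s\le C d^2t^2/\log^2 d$, and let $\rho$ be a random state on $\mathbb{C}^d\otimes\mathbb{C}^d$ induced by $\mathbb{C}^s$. Then \[ \mathbb{P}\Big(\Big|E_F(\rho)-\Big[\log d-\frac{1}{2\ln 2}\Big]\Big|\le t\Big)\ \ge\ 1-e^{-cd^2t^2/\log^2 d}. \]
   Context: Logarithms are base 2. A random state $\rho$ on $\mathbb{C}^n$ induced by $\mathbb{C}^s$ is $\rho=\operatorname{tr}_{\mathbb{C}^s}|\psi\rangle\langle\psi|$ with $|\psi\rangle$ uniformly distributed on the unit sphere of $\mathbb{C}^n\otimes\mathbb{C}^s$ (here $n=d^2$). $E_F(\rho)=\inf\{\sum_ip_iS(\operatorname{tr}_B|\varphi_i\rangle\langle\varphi_i|):\rho=\sum_ip_i|\varphi_i\rangle\langle\varphi_i|\}$, where $S$ is the von Neumann entropy and the cut is $\mathbb{C}^d:\mathbb{C}^d$. *)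

(* Defs.v *)
From HB Require Import structures.
From mathcomp Require Import all_boot all_order all_algebra.
From mathcomp Require Import all_classical all_reals all_analysis.
From mathcomp Require Import complex spectral.
Set Implicit Arguments.
Unset Strict Implicit.
Unset Printing Implicit Defensive.
Import Order.TTheory GRing.Theory Num.Theory.
Local Open Scope ring_scope.

Section QDefs.
Variable R : realType.
Local Notation C := R[i].

Definition log2 (x : R) : R := ln x / ln 2.

Definition ctr m n (A : 'M[C]_(m, n)) : 'M[C]_(n, m) := map_mx Num.conj (A^T).

Definition proj n (phi : 'cV[C]_n) : 'M[C]_n := phi *m ctr phi.

(* partial trace over the second tensor factor of C^m (x) C^k;
   the basis vector |a> (x) |b> of C^m (x) C^k is indexed by mxvec_index a b *)
Definition ptrace2 m k (M : 'M[C]_(m * k)) : 'M[C]_m :=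
  \matrix_(a < m, a' < m) \sum_(b < k) M (mxvec_index a b) (mxvec_index a' b).

(* von Neumann entropy (base 2) of a density matrix, computed from its
   eigenvalues (spectral_diag gives the diagonal of the unitary
   diagonalization of the normal matrix A); convention 0 log 0 = 0. *)
Definition vN_entropy n (A : 'M[C]_n) : R :=
  - \sum_(i < n) (complex.Re (spectral_diag A 0 i) * log2 (complex.Re (spectral_diag A 0 i))).

Definition EoF d (rho : 'M[C]_(d * d)) : R :=
  inf [set e : R | exists (m : nat) (p : 'I_m -> R) (phi : 'I_m -> 'cV[C]_(d * d)),
      [/\ (forall i, 0 <= p i),
          (forall i, ctr (phi i) *m phi i = 1),
          rho = \sum_(i < m) Complex (p i) 0 *: proj (phi i)
        & e = \sum_(i < m) p i * vN_entropy (ptrace2 (proj (phi i)))]].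

Fixpoint iter_integral (k : nat) (f : seq R -> \bar R) : \bar R :=
  match k with
  | 0 => f [::]
  | k'.+1 => (\int[@lebesgue_measure R]_x iter_integral k' (fun v => f (x :: v)))%E
  end.

Definition lebesgue_k (k : nat) (A : set (seq R)) : \bar R :=
  iter_integral k (fun v => (\1_A v)%:E).

Definition euclid_norm (v : seq R) : R := Num.sqrt (\sum_(x <- v) x ^+ 2).

Definition cvec_of N (v : seq R) : 'cV[C]_N :=
  \col_(a < N) Complex (nth 0 v (2 * a)) (nth 0 v (2 * a).+1).

(* Uniform (normalized surface) probability on the unit sphere of
   C^N = R^(2N), given by the cone measure:
   P(E) = vol{x : 0 < |x| <= 1, x/|x| in E} / vol{x : |x| <= 1}. *)
Definition sphere_cone N (E : 'cV[C]_N -> Prop) : set (seq R) :=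
  [set v | 0 < euclid_norm v <= 1 /\
           E (cvec_of N (map (fun x => x / euclid_norm v) v))].

Definition unit_ball : set (seq R) := [set v | euclid_norm v <= 1].

Definition unif_sphere_prob N (E : 'cV[C]_N -> Prop) : \bar R :=
  (lebesgue_k (2 * N) (sphere_cone E)
   * ((fine (lebesgue_k (2 * N) unit_ball))^-1)%:E)%E.

Definition induced_state_prob d s (P : 'M[C]_(d * d) -> Prop) : \bar R :=
  unif_sphere_prob (fun psi : 'cV[C]_((d * d) * s) => P (ptrace2 (proj psi))).

End QDefs.

Arguments induced_state_prob {R} d s P.
Arguments EoF {R} {d} rho.

(* Main.v *)
(* Every pure state in a decomposition of rho lies in the range of rho, so EoF rho lies between
   the minimum and the maximum of the entanglement entropy over the unit vectors of that range,
   and it suffices to control this entropy uniformly there.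

   For rho induced by C^s, the range is { G x : x in C^s } with G a (d * d) x s matrix which,
   up to normalization, has independent standard complex Gaussian entries.  For a unit vector x,
   reshape G x into a d x d Gaussian matrix X and consider sum_i psi(s_i), with s_i the
   eigenvalues of X X^H and psi concave with bounded slope.  Klein's inequality controls the variation
   of this functional under a rotation of the pair (G x, an independent copy), and splitting a
   rotation by pi/2 into small rotations, each of which preserves the joint Gaussian law, gives
   exponential moments of F(G x) - F(G y) of order |x - y|.  A chaining over nets of the unit
   sphere of C^s then gives a nonnegative W of small mean such that W < 1 forces all deviations
   to be small at once; Markov's inequality finishes the probabilistic part.

   The centre is computed from E det(u + X X^H) = ((1 + D)^d 'X^d)(u), a rescaled Laguerre
   polynomial, whose logarithmic derivative is enclosed by a barrier argument on its differential
   equation.  This handles ln (x + u), and y ln y is recovered from sums of ln (x + j) over j.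
   Finally, the iterated integral is transferred from Gaussian vectors to the unit ball, where
   [induced_state_prob] is defined, by a layer-cake argument and scaling; the event
   itself is never shown measurable, as integrals of nonnegative functions are monotone anyway. *)
Require Import Defs.
From HB Require Import structures.
From mathcomp Require Import all_boot all_order all_algebra.
From mathcomp Require Import all_classical all_reals all_analysis.
From mathcomp Require Import measurable_realfun.
From mathcomp Require Import complex spectral.
From mathcomp Require Import ring lra.
Set Implicit Arguments.
Unset Strict Implicit.
Unset Printing Implicit Defensive.
Import Order.TTheory GRing.Theory Num.Theory.
Import numFieldNormedType.Exports.
Local Open Scope classical_set_scope.
Local Open Scope ring_scope.

(** The logarithms in the exponent come from one obstacle: y ln y has unbounded slope. It is traded
    for [psi1], an average of ln (x + j) with slope in [0, 1]; up to affine terms and small errors,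
    y ln y is - [HN] times [psi1], with [HN] of order ln d. A deviation d^2 kap of the sum of [psi1]
    moves the entropy by about kap ln d, which forces kap of order t / log d and gives the exponent
    d^2 kap^2.

    The only gradient bound at hand grows like |g|, so concentration for Lipschitz functions does
    not apply; the exponential moment of |g|^2 is carried along instead. A rotation by a small angle
    costs a second-order term from the new vector and a squared first-order term; over N steps the
    former totals O(1 / N), the latter stays bounded.

    The mean of the sum of ln (x + u) is replaced by the logarithm of a mean determinant. This loses
    O(d / u), because the functional fluctuates so little; over u = 1, ..., d^3 the loss is O(d ln
    d), small against d^2. *)

HB.instance Definition _ (T : choiceType) := isPointed.Build (seq T) [::].

(** * Measurable structure on finite sequences of reals *)

Section Omega.
Context {R : realType}.

Definition coord_sets : set (set (seq R)) :=
  [set A | exists i (B : set (measurableTypeR R)), measurable B /\ A = [set v | B (nth 0 v i)]].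

(** One space serves all lengths: integrating out a variable passes from [x :: v] to [v] within the
    same type, and a coordinate beyond the end reads as the default 0. *)
Definition Om := g_sigma_algebraType coord_sets.
HB.instance Definition _ := Measurable.on Om.

Lemma measurable_nth i : measurable_fun [set: Om] (fun v : Om => nth 0 v i : measurableTypeR R).
Proof.
move=> _ B mB; rewrite setTI; apply: sub_sigma_algebra.
by exists i, B.
Qed.

Lemma measurable_Om d (T : measurableType d) (f : T -> Om) :
  (forall i, measurable_fun setT (fun t => nth 0 (f t) i : measurableTypeR R)) ->
  measurable_fun setT f.
Proof.
move=> mf; apply: (@measurability _ _ _ Om setT f coord_sets) => //.
move=> _ [_ [i [B [mB ->]]] <-].
exact: mf.
Qed.

Lemma measurable_consO d (T : measurableType d) (f : T -> measurableTypeR R) (g : T -> Om) :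
  measurable_fun setT f -> measurable_fun setT g ->
  measurable_fun setT (fun t => (f t :: g t) : Om).
Proof.
move=> mf mg; apply: measurable_Om => -[|i] //=.
exact: (measurableT_comp (measurable_nth i) mg).
Qed.

End Omega.
Arguments Om : clear implicits.

(** * Iterated integrals of nonnegative functions *)

Section IterInt.
Local Open Scope ereal_scope.
Context {R : realType}.
Variable mu : {sigma_finite_measure set (measurableTypeR R) -> \bar R}.

(** With Lebesgue measure this unfolds to [iter_integral], with [gau] to the Gaussian expectation
    [EG]. *)
Fixpoint itI (k : nat) (f : Om R -> \bar R) : \bar R :=
  match k with
  | 0 => f [::]
  | k'.+1 => \int[mu]_x itI k' (fun v => f (x :: v))
  end.

Lemma itI_ge0 k f : (forall v, 0 <= f v) -> 0 <= itI k f.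
Proof.
elim: k f => [|k IH] f f0 //=.
by apply: integral_ge0 => x _; apply: IH.
Qed.

Lemma eq_itI k f g : (forall v, size v = k -> f v = g v) -> itI k f = itI k g.
Proof.
elim: k f g => [|k IH] f g fg /=; first exact: fg.
apply: eq_integral => x _; apply: IH => v sv; apply: fg; by rewrite /= sv.
Qed.

Lemma itI_cat k l f : itI (k + l) f = itI k (fun v => itI l (fun w => f (v ++ w)%SEQ)).
Proof.
elim: k f => [|k IH] f //=.
by apply: eq_integral => x _; rewrite IH.
Qed.

Section meas.
Context d (S : measurableType d).

Lemma measurable_cons_pair (f : S * Om R -> \bar R) : measurable_fun setT f ->
  measurable_fun setT (fun z : (S * measurableTypeR R) * Om R => f (z.1.1, (z.1.2 :: z.2))).
Proof.
move=> mf; apply: (measurableT_comp mf).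
apply: measurable_fun_pair.
  exact: (measurableT_comp measurable_fst measurable_fst).
apply: measurable_consO; last exact: measurable_snd.
exact: (measurableT_comp measurable_snd measurable_fst).
Qed.
End meas.

(** The parameter space [S] is generalised so that the induction can absorb the outermost variable
    into it and use Tonelli one variable at a time. *)
Lemma measurable_itI k d (S : measurableType d) (f : S * Om R -> \bar R) :
  measurable_fun setT f -> (forall z, 0 <= f z) ->
  measurable_fun setT (fun s => itI k (fun v => f (s, v))).
Proof.
elim: k d S f => [|k IH] d S f mf f0 /=.
  exact: (measurable_fun_pair1 _ mf).
apply: (measurable_fun_fubini_tonelli_F (m2 := mu)
   (fun z : S * measurableTypeR R => itI k (fun v => f (z.1, z.2 :: v)))).
  by apply: (IH _ _ (fun z => f (z.1.1, (z.1.2 :: z.2)))) => //; exact: measurable_cons_pair.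
by move=> z; apply: itI_ge0.
Qed.

Lemma measurable_cons1 (f : Om R -> \bar R) x : measurable_fun setT f ->
  measurable_fun setT (fun v : Om R => f (x :: v)).
Proof.
move=> mf; apply: (measurableT_comp mf).
by apply: measurable_consO.
Qed.

Lemma measurable_itI_cons k (f : Om R -> \bar R) : measurable_fun setT f -> (forall z, 0 <= f z) ->
  measurable_fun setT (fun x : measurableTypeR R => itI k (fun v => f (x :: v))).
Proof.
move=> mf f0.
apply: (@measurable_itI k _ (measurableTypeR R) (fun z => f (z.1 :: z.2))) => //.
apply: (measurableT_comp mf); apply: measurable_consO.
  exact: measurable_fst.
exact: measurable_snd.
Qed.

Lemma itI_fubini k d (S : measurableType d) (nu : {sigma_finite_measure set S -> \bar R})
    (f : S * Om R -> \bar R) :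
  measurable_fun setT f -> (forall z, 0 <= f z) ->
  \int[nu]_s itI k (fun v => f (s, v)) = itI k (fun v => \int[nu]_s f (s, v)).
Proof.
elim: k d S nu f => [|k IH] d S nu f mf f0 //=.
rewrite (fubini_tonelli (m1 := nu) (m2 := mu)
   (fun z : S * measurableTypeR R => itI k (fun v => f (z.1, z.2 :: v)))); last 2 first.
- by apply: (@measurable_itI k _ (S * measurableTypeR R)%type (fun z => f (z.1.1, (z.1.2 :: z.2)))) => //;
    exact: measurable_cons_pair.
- by move=> z; apply: itI_ge0.
apply: eq_integral => x _.
apply: (IH _ _ _ (fun z => f (z.1, x :: z.2))) => //.
apply: (measurableT_comp mf); apply: measurable_fun_pair; first exact: measurable_fst.
by apply: measurable_consO => //; exact: measurable_snd.
Qed.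

(** The integral of a nonnegative function is the supremum over the simple functions below it, and a
    larger function has more of them. *)
Lemma ge0_le_integral_lower (f g : measurableTypeR R -> \bar R) :
  (forall x, 0 <= f x) -> (forall x, f x <= g x) ->
  \int[mu]_x f x <= \int[mu]_x g x.
Proof.
move=> f0 fg.
have g0 x : 0 <= g x by apply: le_trans (fg x).
rewrite !ge0_integralTE //; apply: le_ereal_sup => _ [h hf <-].
by exists h => // x; apply: le_trans (fg x).
Qed.

Lemma le_itI k f g : (forall v, 0 <= f v) -> (forall v, size v = k -> f v <= g v) -> itI k f <= itI k g.
Proof.
elim: k f g => [|k IH] f g f0 fg /=; first exact: fg.
apply: ge0_le_integral_lower => x; first exact: itI_ge0.
by apply: IH => // v sv; apply: fg; rewrite /= sv.
Qed.

Lemma itI_D k f g : measurable_fun setT f -> measurable_fun setT g ->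
  (forall v, 0 <= f v) -> (forall v, 0 <= g v) ->
  itI k (fun v => f v + g v) = itI k f + itI k g.
Proof.
elim: k f g => [|k IH] f g mf mg f0 g0 //=.
rewrite -ge0_integralD //.
- by apply: eq_integral => x _; apply: IH => //; exact: measurable_cons1.
- by move=> x _; exact: itI_ge0.
- exact: measurable_itI_cons.
- by move=> x _; exact: itI_ge0.
- exact: measurable_itI_cons.
Qed.

Lemma itI_Z k f c : measurable_fun setT f -> (forall v, 0 <= f v) -> 0 <= c ->
  itI k (fun v => c * f v) = c * itI k f.
Proof.
move=> + + c0; elim: k f => [|k IH] f mf f0 //=.
rewrite -ge0_integralZl //.
- by apply: eq_integral => x _; apply: IH => //; exact: measurable_cons1.
- exact: measurable_itI_cons.
- by move=> x _; exact: itI_ge0.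
Qed.

Lemma itI_nneseries k (f : (Om R -> \bar R)^nat) : (forall n, measurable_fun setT (f n)) ->
  (forall n v, 0 <= f n v) ->
  itI k (fun v => \sum_(0 <= n <oo) f n v) = \sum_(0 <= n <oo) itI k (f n).
Proof.
elim: k f => [|k IH] f mf f0 //=.
rewrite -integral_nneseries //.
- by apply: eq_integral => x _; apply: IH => // n; exact: measurable_cons1.
- by move=> n; exact: measurable_itI_cons.
- by move=> n x _; exact: itI_ge0.
Qed.

End IterInt.

Lemma itI_cst (R : realType) (P : probability (measurableTypeR R) R) k (c : \bar R) : (0 <= c)%E ->
  itI P k (fun=> c) = c.
Proof.
move=> c0; elim: k => [|k IH] //=.
under eq_integral do rewrite IH.
by rewrite integral_cst //= probability_setT mule1.
Qed.

(** * Lebesgue measure under affine maps, shears and rotations *)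

Section Leb1.
Local Open Scope ereal_scope.
Context {R : realType}.
Notation mu := (@lebesgue_measure R).
Import HBNNSimple.

Lemma measurable_affine (r c : R) :
  measurable_fun [set: measurableTypeR R] (fun x : measurableTypeR R => (r * x + c)%R : measurableTypeR R).
Proof. by apply: measurable_funD => //; apply: measurable_funM. Qed.

Lemma affine_preimage_ocitv (r c a b : R) : (0 < r)%R ->
  (fun x : R => (r * x + c)%R) @^-1` [set` `]a, b]%R] =
  [set` `](a - c) / r, (b - c) / r]%R].
Proof.
move=> r0; apply/seteqP; split => x /=; rewrite !in_itv /=.
  by rewrite ltr_pdivrMr // ler_pdivlMr // ltrBlDr lerBrDr mulrC.
by rewrite ltr_pdivrMr // ler_pdivlMr // ltrBlDr lerBrDr mulrC.
Qed.

(** Both sides are measures that agree on half-open intervals, and Lebesgue measure is determined by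
    its values there. *)
Lemma lebesgue_affine (r c : R) (r0 : (0 < r)%R) (A : set (measurableTypeR R)) : measurable A ->
  mu A = r%:E * pushforward mu (fun x : measurableTypeR R => (r * x + c)%R : measurableTypeR R) A.
Proof.
move=> mA.
have mphi := measurable_affine r c.
pose m' : {measure set (measurableTypeR R) -> \bar R} := mscale (NngNum (ltW r0)) (pushforward mu (fun x : measurableTypeR R => (r * x + c)%R : measurableTypeR R)).
rewrite -[RHS]/(m' mphi A).
apply: lebesgue_measure_unique => //= _ [[a b]] _ <-.
rewrite /m' /mscale /= /pushforward affine_preimage_ocitv //= !lebesgue_measure_itv /= !lte_fin.
rewrite ltr_pM2r ?invr_gt0 // ltrD2r; case: ifPn => ab; last by rewrite mule0.
rewrite -!EFinD -EFinM; congr EFin; field.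
by rewrite gt_eqF.
Qed.

Lemma integral_affine (r c : R) (f : measurableTypeR R -> \bar R) : (0 < r)%R ->
  measurable_fun setT f -> (forall x, 0 <= f x) ->
  \int[mu]_x f x = r%:E * \int[mu]_x f (r * x + c)%R.
Proof.
move=> r0 mf f0.
have mphi := measurable_affine r c.
pose m' : {measure set (measurableTypeR R) -> \bar R} := mscale (NngNum (ltW r0)) (pushforward mu (fun x : measurableTypeR R => (r * x + c)%R : measurableTypeR R)).
rewrite (eq_measure_integral (m' mphi)) => [|A mA _]; last exact: lebesgue_affine.
rewrite ge0_integral_mscale //=; congr (_ * _).
by rewrite (ge0_integral_pushforward mphi).
Qed.

Lemma integral_translate (c : R) (f : measurableTypeR R -> \bar R) :
  measurable_fun setT f -> (forall x, 0 <= f x) ->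
  \int[mu]_x f (x + c)%R = \int[mu]_x f x.
Proof.
move=> mf f0; rewrite (integral_affine c ltr01 mf f0) mul1e.
by under [in RHS]eq_integral do rewrite mul1r.
Qed.

Lemma integral_opp (f : measurableTypeR R -> \bar R) :
  measurable_fun setT f -> (forall x, 0 <= f x) ->
  \int[mu]_x f (- x)%R = \int[mu]_x f x.
Proof.
move=> mf f0.
have mphi : measurable_fun [set: measurableTypeR R] (-%R : _ -> measurableTypeR R) by exact: oppr_measurable.
pose m' : {measure set (measurableTypeR R) -> \bar R} := pushforward mu (-%R : measurableTypeR R -> measurableTypeR R).
rewrite [RHS](eq_measure_integral (m' mphi)); last first.
  by move=> A mA _; symmetry; exact: lebesgue_measureN.
by rewrite (ge0_integral_pushforward mphi).
Qed.

(* Valid for every nonnegative [f]: for such [f] the integral is a supremum over simple functions. *)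
Lemma le_integral_scale_lower (r : R) (f : R -> \bar R) : (0 < r)%R -> (forall x, 0 <= f x) ->
  \int[mu]_x f x <= r%:E * \int[mu]_x f (r * x)%R.
Proof.
move=> r0 f0; rewrite [leLHS]ge0_integralTE //.
apply: ge_ereal_sup => _ [h hf <-].
have mh : measurable_fun setT (fun x : measurableTypeR R => (h x)%:E) by exact/measurable_EFinP.
rewrite -integralT_nnsfun (integral_affine 0 r0 mh); last by move=> x; rewrite lee_fin.
rewrite lee_pmul2l //; apply: ge0_le_integral_lower => x; first by rewrite lee_fin.
by rewrite addr0.
Qed.

(** Once the integrals are exchanged, the shear is a translation of [x] for each fixed [y]. *)
Lemma shear_left (a : R) (f : measurableTypeR R * measurableTypeR R -> \bar R) :
  measurable_fun setT f -> (forall z, 0 <= f z) ->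
  \int[mu]_x \int[mu]_y f (x + a * y, y)%R = \int[mu]_x \int[mu]_y f (x, y).
Proof.
move=> mf f0.
have mg : measurable_fun setT (fun z : measurableTypeR R * measurableTypeR R => (z.1 + a * z.2)%R : measurableTypeR R).
  by apply: measurable_funD; [exact: measurable_fst| apply: measurable_funM => //; exact: measurable_snd].
rewrite (fubini_tonelli (m1:=mu) (m2:=mu) (fun z => f (z.1 + a * z.2, z.2)%R)) //; last first.
  by apply: (measurableT_comp mf); apply: measurable_fun_pair => //; exact: measurable_snd.
rewrite (fubini_tonelli (m1:=mu) (m2:=mu) f) //.
apply: eq_integral => y _ /=.
apply: (integral_translate _ (f := fun x => f (x, y))) => //.
exact: (measurable_fun_pair1 _ mf).
Qed.

Lemma shear_right (a : R) (f : measurableTypeR R * measurableTypeR R -> \bar R) :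
  measurable_fun setT f -> (forall z, 0 <= f z) ->
  \int[mu]_x \int[mu]_y f (x, y + a * x)%R = \int[mu]_x \int[mu]_y f (x, y).
Proof.
move=> mf f0.
apply: eq_integral => x _ /=.
apply: (integral_translate _ (f := fun y => f (x, y))) => //.
exact: (measurable_fun_pair2 _ mf).
Qed.

(* A rotation of angle different from [0] and [pi] is a product of three shears. *)
Lemma leb_rotation (c s : R) (f : measurableTypeR R * measurableTypeR R -> \bar R) :
  (c ^+ 2 + s ^+ 2 = 1)%R -> (s != 0)%R ->
  measurable_fun setT f -> (forall z, 0 <= f z) ->
  \int[mu]_x \int[mu]_y f (c * x + s * y, - s * x + c * y)%R = \int[mu]_x \int[mu]_y f (x, y).
Proof.
move=> cs s0 mf f0.
(* The tangent of half the angle: the shears by [a], [- s] and [a] compose to the rotation. *)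
pose a := ((1 - c) / s)%R.
have m1 : measurable_fun setT (fun z : measurableTypeR R * measurableTypeR R => f ((z.1 + a * z.2)%R : measurableTypeR R, z.2)).
  apply: (measurableT_comp mf); apply: measurable_fun_pair; last exact: measurable_snd.
  by apply: measurable_funD; [exact: measurable_fst| apply: measurable_funM => //; exact: measurable_snd].
have m2 : measurable_fun setT (fun z : measurableTypeR R * measurableTypeR R =>
    f ((z.1 + a * (z.2 + - s * z.1))%R : measurableTypeR R, (z.2 + - s * z.1)%R : measurableTypeR R)).
  have mp : measurable_fun setT (fun z : measurableTypeR R * measurableTypeR R => (z.1, (z.2 + - s * z.1)%R : measurableTypeR R)).
    apply: measurable_fun_pair; first exact: measurable_fst.
    by apply: measurable_funD; [exact: measurable_snd| apply: measurable_funM => //; exact: measurable_fst].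
  exact: (measurableT_comp m1 mp).
etransitivity; last exact: (shear_left a mf f0).
etransitivity; last by apply: (shear_right (- s) m1) => z; exact: f0.
etransitivity; last by apply: (shear_left a m2) => z; exact: f0.
rewrite /=.
apply: eq_integral => x _; apply: eq_integral => y _; congr (f (_, _)).
  rewrite /a; apply/eqP; rewrite -subr_eq0; apply/eqP.
  transitivity (y * ((s ^+ 2 - (1 - c ^+ 2)) / s))%R; last by rewrite (_ : s ^+ 2 - (1 - c^+2) = 0)%R; [ring | lra].
  by field.
by rewrite /a; field.
Qed.

End Leb1.

(** * The one-dimensional Gaussian measure and its symmetries *)

Section Gau1.
Local Open Scope ereal_scope.
Context {R : realType}.
Notation mu := (@lebesgue_measure R).
Import HBNNSimple.

(** Variance 1/2, so that a complex number with independent real and imaginary parts of this law has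
    mean squared modulus 1. *)
Definition gau : probability (measurableTypeR R) R := normal_prob 0 (Num.sqrt 2)^-1%R.

Definition gpdf (x : R) : R := ((Num.sqrt pi)^-1 * expR (- x ^+ 2))%R.

Lemma gpdf_gt0 x : (0 < gpdf x)%R.
Proof. by rewrite mulr_gt0 ?expR_gt0 // invr_gt0 sqrtr_gt0 pi_gt0. Qed.

Lemma sqrt2_neq0 : (Num.sqrt 2 : R)^-1%R != 0%R.
Proof. by rewrite invr_neq0 // gt_eqF // sqrtr_gt0. Qed.

Lemma gpdfE x : normal_pdf 0 (Num.sqrt 2)^-1%R x = gpdf x.
Proof.
have h : ((Num.sqrt 2)^-1 ^+ 2 *+ 2 = 1 :> R)%R.
  by rewrite exprVn sqr_sqrtr // -mulr_natr mulVf // pnatr_eq0.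
transitivity (normal_peak (Num.sqrt 2)^-1 * normal_fun 0 (Num.sqrt 2)^-1 x)%R.
  by rewrite normal_pdfE ?sqrt2_neq0.
rewrite /normal_fun /gpdf /normal_peak.
by rewrite subr0 h divr1 -mulrnAl h mul1r.
Qed.

Lemma measurable_gpdf : measurable_fun [set: measurableTypeR R] gpdf.
Proof.
rewrite (_ : gpdf = normal_pdf 0 (Num.sqrt 2)^-1%R); first exact: measurable_normal_pdf.
by apply/funext => x; rewrite gpdfE.
Qed.

Lemma gauE A : gau A = \int[mu]_(x in A) (gpdf x)%:E.
Proof. by rewrite /gau /= /normal_prob; apply: eq_integral => x _; rewrite gpdfE. Qed.

Let integral_gau_nnsfun (h : {nnsfun measurableTypeR R >-> R}) :
  \int[gau]_x (h x)%:E = \int[mu]_x ((h x)%:E * (gpdf x)%:E).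
Proof.
have mpdf := measurable_gpdf.
have pdf0 x := ltW (gpdf_gt0 x).
under [LHS]eq_integral do rewrite fimfunE -fsumEFin//.
rewrite [LHS]ge0_integral_fsum//; last 2 first.
  - by move=> r; exact/measurable_EFinP/measurableT_comp.
  - by move=> n x _; rewrite nnfun_muleindic_ge0.
under [RHS]eq_integral.
  move=> x xD; rewrite fimfunE -fsumEFin// ge0_mule_fsuml; last first.
    by move=> r; rewrite ?EFinM nnfun_muleindic_ge0.
  over.
rewrite [RHS]ge0_integral_fsum//; last 2 first.
  - move=> r; apply: emeasurable_funM; first by apply/measurable_EFinP/measurableT_comp.
    exact/measurable_EFinP.
  - move=> n x _; apply: mule_ge0; last by rewrite lee_fin.
    by rewrite EFinM nnfun_muleindic_ge0.
apply: eq_fsbigr => r _.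
have [r0|r0] := boolP (r \in range h); last first.
  have he : h @^-1` [set r] = set0.
    by apply/seteqP; split => x //= hx; move/negP: r0; apply; rewrite inE; exists x.
  rewrite !integral0_eq // => x _; by rewrite he indic0 mulr0 ?mul0e.
have rge0 : (0 <= r)%R by move: r0; rewrite inE => -[x _ <-].
under [RHS]eq_integral do rewrite EFinM -muleA.
under [LHS]eq_integral do rewrite EFinM.
rewrite [LHS]ge0_integralZl ?lee_fin //; last exact/measurable_EFinP.
rewrite [RHS]ge0_integralZl ?lee_fin //; last 2 first.
- apply: emeasurable_funM; exact/measurable_EFinP.
- by move=> x _; rewrite mule_ge0 // lee_fin.
congr (_ * _).
rewrite integral_indic // setIT -[LHS]/(gau _) gauE.
rewrite [LHS]integral_mkcond; apply: eq_integral => x _.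
rewrite patchE indicE; case: ifPn => _; by rewrite ?mul1e ?mul0e.
Qed.

(** Both sides agree on simple functions, and monotone convergence along [nnsfun_approx] passes to
    the limit. *)
Lemma integral_gau (f : measurableTypeR R -> \bar R) :
  measurable_fun setT f -> (forall x, 0 <= f x) ->
  \int[gau]_x f x = \int[mu]_x (f x * (gpdf x)%:E).
Proof.
move=> mf f0.
have mpdf := measurable_gpdf.
have pdf0 x := ltW (gpdf_gt0 x).
pose f_ := nnsfun_approx measurableT mf.
transitivity (lim (\int[gau]_x (f_ n x)%:E @[n --> \oo])).
  rewrite -monotone_convergence//=.
  - apply: eq_integral => ? /[!inE] xD; apply/esym/cvg_lim => //=.
    exact: cvg_nnsfun_approx.
  - by move=> n; exact/measurable_EFinP/measurable_funTS.
  - by move=> n ? _; rewrite lee_fin.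
  - by move=> ? _ ? ? mn; rewrite lee_fin; exact/lefP/nd_nnsfun_approx.
under eq_fun do rewrite integral_gau_nnsfun.
rewrite -monotone_convergence//=.
- apply: eq_integral => x /[!inE] xD; apply/cvg_lim => //.
  apply: cvgeZr => //; exact: cvg_nnsfun_approx.
- move=> n; apply: emeasurable_funM; exact/measurable_EFinP/measurable_funTS.
- by move=> n x _; rewrite mule_ge0 // lee_fin.
- by move=> x _ ? ? mn; rewrite lee_wpmul2r ?lee_fin //; exact/lefP/nd_nnsfun_approx.
Qed.

Lemma integral_gau2 (f : measurableTypeR R * measurableTypeR R -> \bar R) :
  measurable_fun setT f -> (forall x, 0 <= f x) ->
  \int[gau]_x \int[gau]_y f (x, y) = \int[mu]_x \int[mu]_y (f (x, y) * (gpdf x * gpdf y)%:E).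
Proof.
move=> mf f0.
have mpdf := measurable_gpdf.
have pdf0 x := ltW (gpdf_gt0 x).
have mfx x : measurable_fun [set: measurableTypeR R] (fun y => f (x, y)) by exact: (measurable_fun_pair2 _ mf).
rewrite integral_gau; last 2 first.
- exact: (measurable_fun_fubini_tonelli_F (m2 := gau) f).
- by move=> x; exact: integral_ge0.
apply: eq_integral => x _.
rewrite integral_gau // muleC -ge0_integralZl //; last 3 first.
- apply: emeasurable_funM => //; exact/measurable_EFinP.
- by move=> y _; rewrite mule_ge0 // lee_fin.
- by rewrite lee_fin.
by apply: eq_integral => y _; rewrite muleCA EFinM.
Qed.

(** The product density depends on x^2 + y^2 only, so the invariance of Lebesgue measure carries
    over. *)
Lemma gau_rotation (c s : R) (f : measurableTypeR R * measurableTypeR R -> \bar R) :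
  (c ^+ 2 + s ^+ 2 = 1)%R -> (s != 0)%R ->
  measurable_fun setT f -> (forall z, 0 <= f z) ->
  \int[gau]_x \int[gau]_y f ((c * x + s * y)%R, (- s * x + c * y)%R) = \int[gau]_x \int[gau]_y f (x, y).
Proof.
move=> cs s0 mf f0.
have mpdf := measurable_gpdf.
have pdf0 x := ltW (gpdf_gt0 x).
have m12 a b : measurable_fun setT (fun z : measurableTypeR R * measurableTypeR R => (a * z.1 + b * z.2)%R : measurableTypeR R).
  by apply: measurable_funD; apply: measurable_funM.
have mr : measurable_fun setT (fun z : measurableTypeR R * measurableTypeR R => f ((c * z.1 + s * z.2)%R, (- s * z.1 + c * z.2)%R)).
  apply: (measurableT_comp mf).
  apply: (@measurable_fun_pair _ _ _ _ (measurableTypeR R) (measurableTypeR R)); exact: m12.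
etransitivity; first by apply: (integral_gau2 mr).
symmetry; etransitivity; first exact: (integral_gau2 mf).
pose g z := f z * (gpdf z.1 * gpdf z.2)%:E.
have mg : measurable_fun setT g.
  apply: emeasurable_funM => //; apply/measurable_EFinP/measurable_funM.
    exact: (measurableT_comp mpdf measurable_fst).
  exact: (measurableT_comp mpdf measurable_snd).
have g0 z : 0 <= g z by rewrite mule_ge0 // lee_fin mulr_ge0.
etransitivity; first by symmetry; exact: (leb_rotation cs s0 mg g0).
apply: eq_integral => x _; apply: eq_integral => y _; rewrite /g /=; congr (_ * _%:E).
rewrite /gpdf mulrACA [RHS]mulrACA; congr (_ * _)%R.
rewrite -!expRD; congr expR.
transitivity (- (c ^+ 2 + s ^+ 2) * (x ^+ 2 + y ^+ 2))%R; first by ring.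
by rewrite cs; ring.
Qed.

Lemma gau_opp (f : measurableTypeR R -> \bar R) :
  measurable_fun setT f -> (forall x, 0 <= f x) ->
  \int[gau]_x f (- x)%R = \int[gau]_x f x.
Proof.
move=> mf f0.
have mpdf := measurable_gpdf.
have pdf0 x := ltW (gpdf_gt0 x).
rewrite !integral_gau //; last first.
  by apply: (measurableT_comp mf); exact: oppr_measurable.
etransitivity; last first.
  apply: (integral_opp (f := fun x => f x * (gpdf x)%:E)) => [|x].
    by apply: emeasurable_funM => //; exact/measurable_EFinP.
  by rewrite mule_ge0 // lee_fin.
by apply: eq_integral => x _; rewrite /gpdf sqrrN.
Qed.

End Gau1.

(** * Orthogonal invariance of the Gaussian law *)

Section Law.
Local Open Scope ereal_scope.
Context {R : realType}.

Definition EG : nat -> (Om R -> \bar R) -> \bar R := itI (@gau R).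

Definition colv k (v : seq R) : 'cV[R]_k := \col_i nth 0%R v i.

Definition seqc k (c : 'cV[R]_k) : seq R := [seq c i 0%R | i <- enum 'I_k].

Lemma seqcK k c : colv k (seqc c) = c.
Proof.
apply/matrixP => i j; rewrite mxE ord1 (nth_map i) ?nth_ord_enum // size_enum_ord.
exact: ltn_ord.
Qed.

Lemma nth_seqc k (c : 'cV[R]_k) (i : 'I_k) : nth 0%R (seqc c) i = c i 0%R.
Proof. by rewrite -[in RHS](seqcK c) mxE. Qed.

Lemma nth_seqc_default k (c : 'cV[R]_k) i : (k <= i)%N -> nth 0%R (seqc c) i = 0%R.
Proof. by move=> ki; rewrite nth_default // size_map size_enum_ord. Qed.

Lemma colv_cons k x v : colv k.+1 (x :: v) = col_mx x%:M (colv k v) :> 'cV[R]_(1 + k).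
Proof.
apply/matrixP => i j; rewrite !mxE ord1.
case: splitP => l li; rewrite li ?ord1 /=; first by rewrite mxE.
by rewrite mxE.
Qed.

Definition meas_cV k (F : 'cV[R]_k -> \bar R) := measurable_fun setT (fun v : Om R => F (colv k v)).

Lemma meas_cV_comp k d (T : measurableType d) (F : 'cV[R]_k -> \bar R) (g : T -> 'cV[R]_k) :
  meas_cV F -> (forall i, measurable_fun setT (fun t => g t i 0%R : measurableTypeR R)) ->
  measurable_fun setT (fun t => F (g t)).
Proof.
move=> mF mg.
have ms : measurable_fun setT (fun t => seqc (g t) : Om R).
  apply: measurable_Om => i.
  have [ki|ki] := leqP k i.
    by (under eq_fun do rewrite nth_seqc_default //); exact: measurable_cst.
  by (under eq_fun do rewrite (nth_seqc _ (Ordinal ki))); exact: mg.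
under eq_fun do rewrite -(seqcK (g _)).
exact: (measurableT_comp mF ms).
Qed.

Lemma measurable_colv k i : measurable_fun setT (fun v : Om R => colv k v i 0%R : measurableTypeR R).
Proof. by (under eq_fun do rewrite mxE); exact: measurable_nth. Qed.

Lemma measurable_mulmx_col m k (A : 'M[R]_(m, k)) d (T : measurableType d) (g : T -> 'cV[R]_k) :
  (forall i, measurable_fun setT (fun t => g t i 0%R : measurableTypeR R)) ->
  forall i, measurable_fun setT (fun t => (A *m g t) i 0%R : measurableTypeR R).
Proof.
move=> mg i; under eq_fun do rewrite mxE.
by apply: measurable_sum => j; apply: measurable_funM => //; exact: mg.
Qed.

Lemma meas_cV_mul m k (A : 'M[R]_(m, k)) F : meas_cV F -> meas_cV (fun c => F (A *m c)).
Proof.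
move=> mF; apply: (@meas_cV_comp m _ (Om R) F (fun v => A *m colv k v) mF) => i.
apply: (@measurable_mulmx_col m k A _ (Om R) (fun v => colv k v)) => j; exact: measurable_colv.
Qed.

Definition mpres k (Q : 'M[R]_k) := forall F, meas_cV F -> (forall c, 0 <= F c) ->
  EG k (fun v => F (Q *m colv k v)) = EG k (fun v => F (colv k v)).

Lemma mpres1 k : @mpres k 1%:M.
Proof. by move=> F mF F0; apply: eq_itI => v _; rewrite mul1mx. Qed.

Lemma mpres_mul k (P Q : 'M[R]_k) : mpres P -> mpres Q -> mpres (P *m Q).
Proof.
move=> hP hQ F mF F0; rewrite -hP //.
rewrite -(hQ (fun c => F (P *m c))) //; last exact: meas_cV_mul.
by apply: eq_itI => v _; rewrite mulmxA.
Qed.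

Lemma meas_cV_col k F x : meas_cV (F : 'cV[R]_(1 + k) -> _) -> meas_cV (fun c : 'cV[R]_k => F (col_mx x%:M c)).
Proof.
move=> mF; apply: (meas_cV_comp mF) => i.
have [l ->|l ->] := @split_ordP 1 k i.
  by (under eq_fun do rewrite col_mxEu); exact: measurable_cst.
by (under eq_fun do rewrite col_mxEd); exact: measurable_colv.
Qed.

Lemma EG_cons k (F : 'cV[R]_(1 + k) -> \bar R) :
  EG k.+1 (fun v => F (colv k.+1 v)) = \int[gau]_x EG k (fun v => F (col_mx x%:M (colv k v))).
Proof. by rewrite /EG /=; apply: eq_integral => x _; apply: eq_itI => v _; rewrite -colv_cons. Qed.

Lemma mpres_block k (Q : 'M[R]_k) : mpres Q -> @mpres k.+1 (block_mx (1%:M : 'M[R]_1) 0%R 0%R Q).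
Proof.
move=> hQ F mF F0.
transitivity (EG k.+1 (fun v => (fun c : 'cV[R]_(1 + k) => F (block_mx (1%:M : 'M[R]_1) 0%R 0%R Q *m c)) (colv k.+1 v))) => //.
rewrite (EG_cons (fun c : 'cV[R]_(1 + k) => F (block_mx (1%:M : 'M[R]_1) 0%R 0%R Q *m c))) EG_cons.
apply: eq_integral => x _.
rewrite -(hQ (fun c => F (col_mx x%:M c))) //; last exact: meas_cV_col.
by apply: eq_itI => v _; rewrite mul_block_col !mul0mx mul1mx addr0 add0r.
Qed.

Lemma mpres_flip k : @mpres k.+1 (block_mx ((-1)%:M : 'M[R]_1) 0%R 0%R 1%:M).
Proof.
move=> F mF F0.
transitivity (EG k.+1 (fun v => (fun c : 'cV[R]_(1 + k) => F (block_mx ((-1)%:M : 'M[R]_1) 0%R 0%R 1%:M *m c)) (colv k.+1 v))) => //.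
rewrite (EG_cons (fun c : 'cV[R]_(1 + k) => F (block_mx ((-1)%:M : 'M[R]_1) 0%R 0%R 1%:M *m c))) EG_cons.
rewrite -[RHS]gau_opp; last by move=> x; exact: itI_ge0.
  apply: eq_integral => x _; apply: eq_itI => v _; congr F.
  by rewrite mul_block_col !mul0mx mul1mx addr0 add0r -scalar_mxM mulN1r.
apply: (@measurable_itI _ _ k _ (measurableTypeR R) (fun z => F (col_mx (z.1)%:M (colv k z.2)))) => //.
apply: (@meas_cV_comp (1 + k) _ (measurableTypeR R * Om R)%type F (fun z => col_mx (z.1)%:M (colv k z.2)) mF) => i.
have [l ->|l ->] := @split_ordP 1 k i.
  by (under eq_fun do rewrite col_mxEu mxE ord1 eqxx mulr1n); exact: measurable_fst.
by (under eq_fun do rewrite col_mxEd mxE); exact: (measurableT_comp (measurable_nth _) measurable_snd).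
Qed.

(** The Givens rotation of the first two coordinates, cut into blocks that match a column
    [col_mx x (col_mx y w)]. *)
Definition rotmx k (c s : R) : 'M[R]_(1 + (1 + k)) :=
  block_mx c%:M (row_mx s%:M 0%R) (col_mx (- s)%:M 0%R) (block_mx c%:M 0%R 0%R 1%:M).

Lemma rotmx_col k c s x y (w : 'cV[R]_k) :
  rotmx k c s *m col_mx x%:M (col_mx y%:M w) = col_mx (c * x + s * y)%R%:M (col_mx (- s * x + c * y)%R%:M w).
Proof.
rewrite /rotmx mul_block_col mul_row_col mul0mx addr0 -!scalar_mxM -raddfD /=; congr col_mx.
rewrite mul_col_mx mul_block_col !mul0mx mul1mx !addr0 !add0r add_col_mx add0r.
by rewrite -!scalar_mxM -raddfD.
Qed.

Lemma measurable_col2 k i : measurable_fun setT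
  (fun z : (measurableTypeR R * measurableTypeR R) * Om R =>
    (col_mx (z.1.1)%:M (col_mx (z.1.2)%:M (colv k z.2)) : 'cV[R]_(1 + (1 + k))) i 0%R : measurableTypeR R).
Proof.
have [l ->|l ->] := @split_ordP 1 (1 + k) i.
  rewrite (_ : (fun _ => _) = (fun z => z.1.1)).
    exact: (measurableT_comp measurable_fst measurable_fst).
  by apply/funext => z; rewrite col_mxEu mxE ord1 eqxx mulr1n.
have [j ->|j ->] := @split_ordP 1 k l.
  rewrite (_ : (fun _ => _) = (fun z => z.1.2)).
    exact: (measurableT_comp measurable_snd measurable_fst).
  by apply/funext => z; rewrite col_mxEd col_mxEu mxE ord1 eqxx mulr1n.
rewrite (_ : (fun _ => _) = (fun z => nth 0%R z.2 j)).
  exact: (measurableT_comp (measurable_nth _) measurable_snd).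
by apply/funext => z; rewrite !col_mxEd mxE.
Qed.

Lemma mpres_rot k c s : (c ^+ 2 + s ^+ 2 = 1)%R -> (s != 0)%R -> @mpres k.+2 (rotmx k c s).
Proof.
move=> cs s0 F mF F0.
have E2 (G : 'cV[R]_(1 + (1 + k)) -> \bar R) : EG k.+2 (fun v => G (colv k.+2 v)) =
    \int[gau]_x \int[gau]_y EG k (fun v => G (col_mx x%:M (col_mx y%:M (colv k v)))).
  rewrite EG_cons; apply: eq_integral => x _.
  by rewrite (EG_cons (fun c => G (col_mx x%:M c))).
rewrite (E2 (fun v => F (rotmx k c s *m v))) E2.
pose h (z : measurableTypeR R * measurableTypeR R) := EG k (fun v => F (col_mx z.1%:M (col_mx z.2%:M (colv k v)))).
have mh : measurable_fun setT h.
  apply: (@measurable_itI _ _ k _ (measurableTypeR R * measurableTypeR R)%type (fun z => F (col_mx (z.1.1)%:M (col_mx z.1.2%:M (colv k z.2))))) => //.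
  apply: (@meas_cV_comp (1 + (1 + k)) _ ((measurableTypeR R * measurableTypeR R) * Om R)%type F (fun z => col_mx (z.1.1)%:M (col_mx z.1.2%:M (colv k z.2))) mF).
  exact: measurable_col2.
have h0 z : 0 <= h z by exact: itI_ge0.
rewrite -[RHS](gau_rotation cs s0 mh h0).
apply: eq_integral => x _; apply: eq_integral => y _; apply: eq_itI => v _.
by rewrite rotmx_col.
Qed.

Local Close Scope ereal_scope.

Lemma rotmx_orth k c s : (c ^+ 2 + s ^+ 2 = 1)%R -> (rotmx k c s *m (rotmx k c s)^T = 1%:M)%R.
Proof.
move=> cs.
have -> : ((rotmx k c s)^T = rotmx k c (- s))%R.
  by rewrite /rotmx tr_block_mx tr_row_mx tr_col_mx tr_block_mx !tr_scalar_mx !trmx0 opprK.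
apply: (@can_inj _ _ trmx trmx (@trmxK _ _ _)); apply/row_matrixP => j.
rewrite -!tr_col !colE; congr trmx.
set v : 'cV[R]_(1 + (1 + k)) := delta_mx j 0.
rewrite mul1mx -mulmxA -[v]vsubmxK -[dsubmx v]vsubmxK.
rewrite [usubmx v]mx11_scalar [usubmx (dsubmx v)]mx11_scalar !rotmx_col.
move: (usubmx v 0 0) (usubmx (dsubmx v) 0 0) (dsubmx (dsubmx v)) => x y w.
congr col_mx; [|congr col_mx]; congr scalar_mx.
  by transitivity ((c ^+ 2 + s ^+ 2) * x); [ring | rewrite cs mul1r].
by transitivity ((c ^+ 2 + s ^+ 2) * y); [ring | rewrite cs mul1r].
Qed.

Lemma flip_orth k (F := block_mx ((-1)%:M : 'M[R]_1) 0 0 1%:M : 'M[R]_(1 + k)) : F *m F^T = 1%:M.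
Proof.
rewrite /F tr_block_mx !tr_scalar_mx !trmx0 mulmx_block !mulmx0 !mul0mx !addr0 !add0r mulmx1.
by rewrite -scalar_mxM mulrNN mulr1 -scalar_mx_block.
Qed.

Lemma block_orth k (Q : 'M[R]_k) (B := block_mx (1%:M : 'M[R]_1) 0 0 Q) : Q *m Q^T = 1%:M -> B *m B^T = 1%:M.
Proof.
move=> oQ; rewrite /B tr_block_mx !tr_scalar_mx !trmx0 mulmx_block !mulmx0 !mul0mx !addr0 !add0r mulmx1 oQ.
by rewrite -scalar_mx_block.
Qed.

Lemma row_e1 k : delta_mx 0 0 = row_mx 1%:M 0 :> 'rV[R]_(1 + k).
Proof.
apply/matrixP => i j; rewrite [LHS]mxE ord1 eqxx /=.
have [l ->|l ->] := @split_ordP 1 k j.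
  by rewrite row_mxEl mxE ord1 eqxx.
by rewrite row_mxEr mxE.
Qed.

Lemma unit_row_block k (a : R) (b : 'rV[R]_k) :
  ((row_mx a%:M b : 'rV_(1 + k)) *m (row_mx a%:M b)^T = 1%:M)%R -> (a ^+ 2 + (b *m b^T) 0 0 = 1)%R.
Proof.
rewrite tr_row_mx mul_row_col tr_scalar_mx -scalar_mxM => /matrixP /(_ 0%R 0%R).
by rewrite !mxE eqxx !mulr1n expr2 => ->.
Qed.

Lemma row_norm_ge0 k (b : 'rV[R]_k) : (0 <= (b *m b^T) 0 0)%R.
Proof. by rewrite mxE sumr_ge0 // => i _; rewrite mxE -expr2 sqr_ge0. Qed.

Lemma row_norm_eq0 k (b : 'rV[R]_k) : ((b *m b^T) 0 0 = 0)%R -> b = 0%R.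
Proof.
rewrite mxE => /psumr_eq0P h; apply/matrixP => i j; rewrite ord1 mxE.
have /h : (forall i : 'I_k, true -> (0 <= b 0 i * (b^T) i 0)%R) by move=> l _; rewrite mxE -expr2 sqr_ge0.
by move=> /(_ j isT)/eqP; rewrite mxE -expr2 sqrf_eq0 => /eqP.
Qed.

(** By induction the tail of [a] is turned onto its own first axis; a Givens rotation then merges
    the two coordinates that remain. Rotations of the first two coordinates, nested in blocks, and
    sign flips thus suffice. *)
Lemma mpres_to_e1 k (a : 'rV[R]_k.+1) : (a *m a^T = 1%:M)%R ->
  exists Q : 'M[R]_k.+1, [/\ mpres Q, (Q *m Q^T = 1%:M)%R & (a *m Q = delta_mx 0 0)%R].
Proof.
elim: k a => [|k IH] a.
  rewrite (mx11_scalar a) tr_scalar_mx -scalar_mxM => /matrixP/(_ 0%R 0%R).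
  rewrite !mxE eqxx !mulr1n -expr2 => /eqP; rewrite sqrf_eq1 => /orP[|] /eqP ->.
    exists 1%:M; split; [exact: mpres1 | by rewrite trmx1 mulmx1 |].
    by rewrite mulmx1; apply/matrixP => i j; rewrite !mxE !ord1.
  have E : block_mx ((-1)%:M : 'M[R]_1) 0 0 (1%:M : 'M[R]_0) = (-1)%:M :> 'M[R]_(1 + 0).
    by rewrite [RHS](scalar_mx_block 1 0); congr block_mx; rewrite (flatmx0 1%:M) (flatmx0 (-1)%:M).
  exists (-1)%:M; split; first by rewrite -E; exact: mpres_flip.
    by rewrite tr_scalar_mx -scalar_mxM mulrNN mulr1.
  by rewrite -scalar_mxM mulrNN mulr1; apply/matrixP => i j; rewrite !mxE !ord1.
rewrite -(@hsubmxK R 1 1 k.+1 a) (mx11_scalar (@lsubmx R 1 1 k.+1 a)).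
move: (@lsubmx R 1 1 k.+1 a 0 0)%R (@rsubmx R 1 1 k.+1 a) => al be hab.
have := unit_row_block hab.
set n2 := ((be *m be^T) 0 0)%R => hn.
(* A zero tail is separated because [mpres_rot] requires a nonzero sine; the head is then 1 or -1,
   and a sign flip settles the second case. *)
have [n0|n0] := eqVneq n2 0%R.
  have be0 := row_norm_eq0 n0; move: hn; rewrite n0 addr0 => /eqP; rewrite sqrf_eq1.
  move=> /orP[|] /eqP ->; rewrite be0.
    exists 1%:M; split; [exact: mpres1 | by rewrite trmx1 mulmx1 |].
    by rewrite mulmx1 row_e1.
  exists (block_mx ((-1)%:M : 'M[R]_1) 0%R 0%R 1%:M); split; [exact: mpres_flip | exact: flip_orth |].
  rewrite [LHS](@mul_row_block R 1 1 k.+1 1 k.+1) !(mul0mx, mulmx0) !addr0.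
  by rewrite -scalar_mxM mulrNN mulr1 [RHS](@row_e1 k.+1).
have n2p : (0 < n2)%R by rewrite lt_neqAle eq_sym n0 row_norm_ge0.
pose r := Num.sqrt n2.
have r0 : (r != 0)%R by rewrite gt_eqF // sqrtr_gt0.
have r2 : (r ^+ 2 = n2)%R by rewrite sqr_sqrtr // ltW.
have [|Q [mQ oQ eQ]] := IH (r^-1 *: be)%R.
  rewrite linearZ /= -scalemxAl -scalemxAr scalerA.
  apply/matrixP => i j; rewrite !ord1 [LHS]mxE -/n2 -r2 mxE eqxx mulr1n; field; exact: r0.
exists ((block_mx (1%:M : 'M[R]_1) 0%R 0%R Q : 'M[R]_(1 + k.+1)) *m rotmx k al (- r)); split.
- apply: mpres_mul; first exact: mpres_block.
  by apply: mpres_rot; rewrite ?oppr_eq0 // sqrrN r2.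
- rewrite trmx_mul mulmxA -(mulmxA _ (rotmx k al (- r))) rotmx_orth ?sqrrN ?r2 // mulmx1.
  exact: block_orth.
- rewrite mulmxA [X in X *m _](@mul_row_block R 1 1 k.+1 1 k.+1) !mulmx0 addr0 add0r mulmx1.
  have -> : (be *m Q = r *: delta_mx 0 0)%R.
    by rewrite -eQ -scalemxAl scalerA mulfV // scale1r.
  rewrite (@row_e1 k) (@scale_row_mx R 1 1 k) scaler0 /rotmx (@mul_row_block R 1 1 (1 + k) 1 (1 + k)).
  rewrite -scalar_mxM mul_row_col mul0mx addr0.
  rewrite mul_mx_row mul_row_block !(mul0mx, mulmx0) !addr0. rewrite add_row_mx addr0.
  rewrite scale_scalar_mx -!scalar_mxM -!raddfD /= opprK.
  rewrite (_ : al * - r + r * 1 * al = 0)%R; last by ring.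
  rewrite raddf0 row_mx0 (_ : al * al + r * 1 * r = 1); last by rewrite mulr1 -!expr2 r2.
  by rewrite [RHS](@row_e1 k.+1).
Qed.

(** Induction on the rows: a law-preserving orthogonal matrix brings the first row to the first
    axis, orthonormality of the rows then clears the first column below it, and the remaining block
    is a smaller coisometry to be applied for a fixed first coordinate. *)
Theorem EG_coisometry m k (A : 'M[R]_(m, k)) (F : 'cV[R]_m -> \bar R) :
  A *m A^T = 1%:M -> meas_cV F -> (forall c, (0 <= F c)%E) ->
  EG k (fun v => F (A *m colv k v)) = EG m (fun w => F (colv m w)).
Proof.
elim: m k A F => [|m IH] k A F oA mF F0.
  have Fc c : F c = F 0 by rewrite (flatmx0 c).
  transitivity (EG k (fun=> F 0)); first by apply: eq_itI => v _.
  by rewrite /EG itI_cst //= -Fc.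
have uA : usubmx (A : 'M[R]_(1 + m, k)) *m (usubmx (A : 'M[R]_(1 + m, k)))^T = 1%:M.
  apply/matrixP => i j; have /matrixP/(_ (lshift m i) (lshift m j)) := oA.
  rewrite !mxE => h; transitivity ((lshift m i == lshift m j)%:R : R); last by rewrite eq_lshift.
  by rewrite -h; apply: eq_bigr => l _; rewrite !mxE.
case: k A oA uA => [|k] A oA uA.
  exfalso; move/matrixP/(_ 0 0): uA; rewrite !mxE big_ord0 eqxx => /eqP.
  by rewrite eq_sym oner_eq0.
have [Q [mQ oQ eQ]] := mpres_to_e1 uA.
rewrite -(mQ (fun c => F (A *m c))) //; last exact: meas_cV_mul.
have oAQ : (A *m Q) *m (A *m Q)^T = 1%:M by rewrite trmx_mul mulmxA -(mulmxA A) oQ mulmx1.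
pose B : 'M[R]_(m, k) := @drsubmx R 1 m 1 k (A *m Q).
have uAQ : @usubmx R 1 m k.+1 (A *m Q) = row_mx 1%:M 0 :> 'rV[R]_(1 + k) by rewrite -mul_usub_mx eQ row_e1.
have ul : @ulsubmx R 1 m 1 k (A *m Q) = 1%:M by rewrite /ulsubmx uAQ row_mxKl.
have ur : @ursubmx R 1 m 1 k (A *m Q) = 0 by rewrite /ursubmx uAQ row_mxKr.
have AQE : A *m Q = block_mx 1%:M 0 (@dlsubmx R 1 m 1 k (A *m Q)) B :> 'M[R]_(1 + m, 1 + k).
  by rewrite -ul -ur submxK.
move: (@dlsubmx R 1 m 1 k (A *m Q)) AQE => L AQE.
move: oAQ; rewrite AQE.
rewrite (@tr_block_mx R 1 m 1 k) (@mulmx_block R 1 m 1 k 1 m).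
rewrite !trmx0 trmx1 !(mulmx0, mul0mx, mulmx1, mul1mx, addr0) => h.
have {h} := etrans h (@scalar_mx_block R 1 m 1).
move=> /(@eq_block_mx _ 1 m 1 m) [_ _ L0 oB].
rewrite L0 mul0mx add0r in oB.
transitivity (EG k.+1 (fun v => (fun c : 'cV[R]_(1 + k) => F (block_mx (1%:M : 'M[R]_1) 0 0 B *m c)) (colv k.+1 v))).
  by apply: eq_itI => v _; rewrite mulmxA AQE L0.
rewrite (EG_cons (fun c : 'cV[R]_(1 + k) => F (block_mx (1%:M : 'M[R]_1) 0 0 B *m c))) EG_cons.
apply: eq_integral => x _.
rewrite -(IH k B (fun c => F (col_mx x%:M c))) //; last exact: meas_cV_col.
by apply: eq_itI => v _; rewrite mul_block_col !mul0mx mul1mx addr0 add0r.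
Qed.

End Law.

(** * Complex vectors as interleaved real ones *)

Section Complexes.
Context {R : realType}.
Local Notation C := (R[i]).
Local Notation re := (@complex.Re R).
Local Notation im := (@complex.Im R).

Lemma re_add (x y : C) : re (x + y) = re x + re y. Proof. by case: x; case: y. Qed.
Lemma im_add (x y : C) : im (x + y) = im x + im y. Proof. by case: x; case: y. Qed.
Lemma re_opp (x : C) : re (- x) = - re x. Proof. by case: x. Qed.
Lemma im_opp (x : C) : im (- x) = - im x. Proof. by case: x. Qed.
Lemma re_mul (x y : C) : re (x * y) = re x * re y - im x * im y. Proof. by case: x; case: y. Qed.
Lemma im_mul (x y : C) : im (x * y) = re x * im y + im x * re y. Proof. by case: x => a b; case: y. Qed.
Lemma re_conj (x : C) : re (Num.conj x) = re x. Proof. by case: x. Qed.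
Lemma im_conj (x : C) : im (Num.conj x) = - im x. Proof. by case: x. Qed.
Lemma re_sum I r (P : pred I) (F : I -> C) : re (\sum_(i <- r | P i) F i) = \sum_(i <- r | P i) re (F i).
Proof. by elim/big_rec2: _ => // i x y _ <-; rewrite re_add. Qed.
Lemma im_sum I r (P : pred I) (F : I -> C) : im (\sum_(i <- r | P i) F i) = \sum_(i <- r | P i) im (F i).
Proof. by elim/big_rec2: _ => // i x y _ <-; rewrite im_add. Qed.
Lemma re_nat n : re n%:R = n%:R. Proof. by elim: n => // n IH; rewrite -addn1 !natrD re_add IH. Qed.
Lemma im_nat n : im n%:R = 0. Proof. by elim: n => // n IH; rewrite -addn1 natrD im_add IH add0r. Qed.

Lemma complex_ext (x y : C) : re x = re y -> im x = im y -> x = y.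
Proof. by case: x; case: y => ? ? ? ? /= -> ->. Qed.

Lemma ctrE m n (A : 'M[C]_(m, n)) i j : ctr A i j = Num.conj (A j i).
Proof. by rewrite !mxE. Qed.

Lemma half_lt k (r : 'I_(2 * k)) : (r./2 < k)%N.
Proof. by rewrite ltn_half_double -mul2n. Qed.
Definition hf k (r : 'I_(2 * k)) : 'I_k := Ordinal (half_lt r).
Lemma ev_lt k (b : 'I_k) : (2 * b < 2 * k)%N. Proof. by rewrite ltn_pmul2l. Qed.
Lemma od_lt k (b : 'I_k) : ((2 * b).+1 < 2 * k)%N.
Proof. by have := ltn_ord b; rewrite -(leq_pmul2l (m := 2)) // mulnS => /(leq_trans _) ->. Qed.
Definition ev k (b : 'I_k) : 'I_(2 * k) := Ordinal (ev_lt b).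
Definition od k (b : 'I_k) : 'I_(2 * k) := Ordinal (od_lt b).

Lemma hf_ev k (b : 'I_k) : hf (ev b) = b.
Proof. by apply/val_inj; rewrite /= mul2n doubleK. Qed.
Lemma hf_od k (b : 'I_k) : hf (od b) = b.
Proof. by apply/val_inj; rewrite /= mul2n uphalf_double. Qed.
Lemma odd_ev k (b : 'I_k) : odd (ev b) = false.
Proof. by rewrite /= mul2n odd_double. Qed.
Lemma odd_od k (b : 'I_k) : odd (od b) = true.
Proof. by rewrite /= mul2n odd_double. Qed.

Lemma sum_evod (V : nmodType) k (F : 'I_(2 * k) -> V) :
  \sum_c F c = \sum_(b < k) (F (ev b) + F (od b)).
Proof.
pose f n := if insub n is Some i then F i else 0.
have fE i : f (val i) = F i by rewrite /f valK.
rewrite (eq_bigr (fun i : 'I_(2 * k) => f i)); last by move=> i _; rewrite fE.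
rewrite [RHS](eq_bigr (fun b : 'I_k => f (2 * b)%N + f (2 * b).+1)); last first.
  by move=> b _; rewrite -!fE.
rewrite -(big_mkord predT f) -(big_mkord predT (fun b => f (2 * b)%N + f (2 * b).+1)).
elim: (k) => [|m IH]; first by rewrite muln0 !big_geq.
by rewrite mulnS addnC addn2 !big_nat_recr //= IH addrA.
Qed.

(** Each entry a + i b becomes the 2 x 2 block with rows (a, - b) and (b, a), in the interleaved
    layout that [cvec_of] reads. *)
Definition realmx m k (B : 'M[C]_(m, k)) : 'M[R]_(2 * m, 2 * k) :=
  \matrix_(r, c) let z := B (hf r) (hf c) in
    if odd r then (if odd c then re z else im z) else (if odd c then - im z else re z).

Lemma realmx_coisometry m k (B : 'M[C]_(m, k)) : B *m ctr B = 1%:M ->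
  realmx B *m (realmx B)^T = 1%:M.
Proof.
move=> oB; apply/matrixP => r r'; rewrite mxE sum_evod.
have /matrixP/(_ (hf r) (hf r')) := oB; rewrite mxE => h.
have hre := congr1 (@complex.Re R) h; have him := congr1 (@complex.Im R) h.
rewrite re_sum in hre; rewrite im_sum in him.
rewrite mxE re_nat in hre; rewrite mxE im_nat in him.
have eqrr : (r == r') = (hf r == hf r') && (odd r == odd r').
  apply/eqP/andP => [->|[/eqP [h1] /eqP h2]] //; apply/val_inj => /=.
  by rewrite -[LHS]odd_double_half -[RHS]odd_double_half h1 h2.
rewrite [RHS]mxE eqrr.
under eq_bigr => b _ do rewrite !mxE !hf_ev !hf_od !odd_ev !odd_od.
case: (odd r); case: (odd r') => /=; rewrite ?andbT ?andbF.
- by rewrite -hre; apply: eq_bigr => b _; rewrite re_mul ctrE re_conj im_conj; ring.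
- by rewrite -[RHS]/(0 : R) -[RHS]him; apply: eq_bigr => b _; rewrite im_mul ctrE re_conj im_conj; ring.
- rewrite -[RHS]/(0 : R) -[RHS]oppr0 -[X in - X]him -sumrN; apply: eq_bigr => b _; rewrite im_mul ctrE re_conj im_conj; ring.
- by rewrite -hre; apply: eq_bigr => b _; rewrite re_mul ctrE re_conj im_conj; ring.
Qed.

Lemma cvec_realmx m k (B : 'M[C]_(m, k)) v :
  cvec_of m (seqc (realmx B *m colv (2 * k) v)) = B *m cvec_of k v.
Proof.
apply/matrixP => i j; rewrite ord1 !mxE.
have -> : (2 * i = ev i)%N by [].
have -> : ((ev i).+1 = od i)%N by [].
rewrite !nth_seqc !mxE !sum_evod.
apply: complex_ext; rewrite ?re_sum ?im_sum /=; apply: eq_bigr => b _.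
  by rewrite !mxE !hf_ev !hf_od !odd_ev !odd_od re_mul /= mulNr.
by rewrite !mxE !hf_ev !hf_od !odd_ev !odd_od im_mul /= addrC.
Qed.

Lemma cvec_colv m (w : seq R) : cvec_of m (seqc (colv (2 * m) w)) = cvec_of m w.
Proof.
apply/matrixP => i j; rewrite ord1 !mxE.
have -> : (2 * i = ev i)%N by [].
have -> : ((ev i).+1 = od i)%N by [].
by rewrite !nth_seqc !mxE.
Qed.

Definition meas_C m (F : 'cV[C]_m -> \bar R) := measurable_fun setT (fun v : Om R => F (cvec_of m v)).

Lemma EG_coisometryC m k (B : 'M[C]_(m, k)) (F : 'cV[C]_m -> \bar R) :
  B *m ctr B = 1%:M -> meas_C F -> (forall c, (0 <= F c)%E) ->
  EG (2 * k) (fun v => F (B *m cvec_of k v)) = EG (2 * m) (fun w => F (cvec_of m w)).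
Proof.
move=> oB mF F0.
pose G (c : 'cV[R]_(2 * m)) := F (cvec_of m (seqc c)).
have mG : meas_cV G by rewrite /meas_cV /G; under eq_fun do rewrite cvec_colv.
transitivity (EG (2 * k) (fun v => G (realmx B *m colv (2 * k) v))).
  by apply: eq_itI => v _; rewrite /G cvec_realmx.
rewrite (EG_coisometry (realmx_coisometry oB) mG (fun c => F0 _)).
by apply: eq_itI => v _; rewrite /G cvec_colv.
Qed.

Lemma meas_C_mul m k (B : 'M[C]_(m, k)) F : meas_C F -> meas_C (fun c => F (B *m c)).
Proof.
move=> mF; rewrite /meas_C.
pose G (c : 'cV[R]_(2 * m)) := F (cvec_of m (seqc c)).
have mG : meas_cV G by rewrite /meas_cV /G; under eq_fun do rewrite cvec_colv.
rewrite (_ : (fun _ => _) = (fun v => G (realmx B *m colv (2 * k) v))); last first.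
  by apply/funext => v; rewrite /G cvec_realmx.
exact: (meas_cV_mul (realmx B) mG).
Qed.

Lemma cvec_cat n m (u w : seq R) : size u = (2 * n)%N ->
  cvec_of (n + m) (u ++ w)%SEQ = col_mx (cvec_of n u) (cvec_of m w).
Proof.
move=> su; apply/matrixP => i j; rewrite ord1.
have [l ->|l ->] := split_ordP i; rewrite ?col_mxEu ?col_mxEd !mxE !nth_cat su.
  by rewrite /= ev_lt od_lt.
rewrite /= mulnDr -addnS !ltnNge !leq_addr /=.
by rewrite !addKn -{2}[(2 * n)%N]addn0 leq_add2l.
Qed.

Lemma EG_cat n m (F : 'cV[C]_(n + m) -> \bar R) :
  EG (2 * (n + m)) (fun v => F (cvec_of (n + m) v)) =
  EG (2 * n) (fun u => EG (2 * m) (fun w => F (col_mx (cvec_of n u) (cvec_of m w)))).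
Proof.
rewrite mulnDr /EG itI_cat; apply: eq_itI => u su; apply: eq_itI => w _.
by rewrite cvec_cat.
Qed.

End Complexes.

(** * Frobenius geometry, eigenvalues and Klein's inequality *)

Section Spectral.
Context {R : realType}.
Local Notation C := (R[i]).
Local Notation re := (@complex.Re R).
Local Notation im := (@complex.Im R).

Definition nsq (z : C) : R := re z ^+ 2 + im z ^+ 2.
Definition cdot (z w : C) : R := re z * re w + im z * im w.
Definition rn m n (X : 'M[C]_(m, n)) i : R := \sum_j nsq (X i j).
Definition rdot m n (X Y : 'M[C]_(m, n)) i : R := \sum_j cdot (X i j) (Y i j).
(** The square of the Frobenius norm, hence of the Euclidean norm on columns; distances below are
    squared distances throughout. *)
Definition fro m n (X : 'M[C]_(m, n)) : R := \sum_i rn X i.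
Definition fdot m n (X Y : 'M[C]_(m, n)) : R := \sum_i rdot X Y i.

Lemma nsq_ge0 z : 0 <= nsq z. Proof. by rewrite addr_ge0 // sqr_ge0. Qed.
Lemma rn_ge0 m n (X : 'M[C]_(m, n)) i : 0 <= rn X i.
Proof. by apply: sumr_ge0 => j _; exact: nsq_ge0. Qed.
Lemma fro_ge0 m n (X : 'M[C]_(m, n)) : 0 <= fro X.
Proof. by apply: sumr_ge0 => j _; exact: rn_ge0. Qed.

Lemma ctrK m n (A : 'M[C]_(m, n)) : ctr (ctr A) = A.
Proof. by apply/matrixP => i j; rewrite !ctrE; case: (A i j) => a b; apply: complex_ext => //=; rewrite opprK. Qed.

Lemma ctr_mul m n p (A : 'M[C]_(m, n)) (B : 'M[C]_(n, p)) : ctr (A *m B) = ctr B *m ctr A.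
Proof. by rewrite /ctr trmx_mul map_mxM. Qed.

Lemma ctr_add m n (A B : 'M[C]_(m, n)) : ctr (A + B) = ctr A + ctr B.
Proof. by rewrite /ctr linearD /= map_mxD. Qed.

Lemma ctr_scale m n a (A : 'M[C]_(m, n)) : ctr (a *: A) = Num.conj a *: ctr A.
Proof. by rewrite /ctr linearZ /= map_mxZ. Qed.

Lemma mul_ctr_diag m n (X : 'M[C]_(m, n)) i : (X *m ctr X) i i = Complex (rn X i) 0.
Proof.
rewrite mxE; apply: complex_ext; rewrite ?re_sum ?im_sum /=.
  by apply: eq_bigr => j _; rewrite ctrE re_mul re_conj im_conj /nsq; ring.
by apply: big1 => j _; rewrite ctrE im_mul re_conj im_conj; ring.
Qed.

Lemma mul_ctr_re m n (X Y : 'M[C]_(m, n)) i : re ((X *m ctr Y) i i) = rdot X Y i.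
Proof.
rewrite mxE re_sum; apply: eq_bigr => j _.
by rewrite ctrE re_mul re_conj im_conj /cdot; ring.
Qed.

Lemma fdot_tr m n (X Y : 'M[C]_(m, n)) : fdot X Y = re (\tr (X *m ctr Y)).
Proof. by rewrite /mxtrace re_sum; apply: eq_bigr => i _; rewrite mul_ctr_re. Qed.

Lemma rdotXX m n (X : 'M[C]_(m, n)) i : rdot X X i = rn X i.
Proof. by apply: eq_bigr => j _; rewrite /cdot /nsq !expr2. Qed.

Lemma fdotXX m n (X : 'M[C]_(m, n)) : fdot X X = fro X.
Proof. by apply: eq_bigr => i _; rewrite rdotXX. Qed.

Lemma fro_tr m n (X : 'M[C]_(m, n)) : fro X = re (\tr (X *m ctr X)).
Proof. by rewrite -fdotXX fdot_tr. Qed.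

Lemma fdot_adj m n p (U : 'M[C]_(p, m)) (X : 'M[C]_(p, n)) (Y : 'M[C]_(m, n)) :
  fdot (ctr U *m X) Y = fdot X (U *m Y).
Proof. by rewrite !fdot_tr ctr_mul mulmxA -mulmxA mxtrace_mulC. Qed.

Definition unitary n (U : 'M[C]_n) := (U *m ctr U = 1%:M) /\ (ctr U *m U = 1%:M).

Lemma unitaryP n (U : 'M[C]_n) : U *m ctr U = 1%:M -> unitary U.
Proof. by move=> h; split => //; apply: mulmx1C. Qed.

Lemma unitary_ctr n (U : 'M[C]_n) : unitary U -> unitary (ctr U).
Proof. by move=> [h1 h2]; split; rewrite ctrK. Qed.

Lemma unitary_mul n (U V : 'M[C]_n) : unitary U -> unitary V -> unitary (U *m V).
Proof.
move=> [h1 h2] [h3 h4]; apply: unitaryP.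
by rewrite ctr_mul mulmxA -(mulmxA U) h3 mulmx1.
Qed.

Lemma fdot_unitary m n (U : 'M[C]_m) (X Y : 'M[C]_(m, n)) : unitary U ->
  fdot (U *m X) (U *m Y) = fdot X Y.
Proof. by move=> [h1 h2]; rewrite -fdot_adj mulmxA h2 mul1mx. Qed.

Lemma fro_unitary m n (U : 'M[C]_m) (X : 'M[C]_(m, n)) : unitary U -> fro (U *m X) = fro X.
Proof. by move=> uU; rewrite -!fdotXX fdot_unitary. Qed.

Lemma rn_comb m n (X Y : 'M[C]_(m, n)) (c s : R) i :
  rn (Complex c 0 *: X + Complex s 0 *: Y) i = c ^+ 2 * rn X i + s ^+ 2 * rn Y i + 2 * c * s * rdot X Y i.
Proof.
rewrite /rn /rdot !mulr_sumr -!big_split /=; apply: eq_bigr => j _.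
by rewrite !mxE /nsq /cdot re_add im_add !re_mul !im_mul /=; ring.
Qed.

Lemma unitary_nsq_row n (V : 'M[C]_n) i : unitary V -> \sum_j nsq (V i j) = 1.
Proof.
move=> [h _]; have := mul_ctr_diag V i.
by rewrite h mxE eqxx => /(congr1 (@complex.Re R)) /= /esym.
Qed.

Lemma unitary_nsq_col n (V : 'M[C]_n) j : unitary V -> \sum_i nsq (V i j) = 1.
Proof.
move=> /unitary_ctr /(unitary_nsq_row j) <-; apply: eq_bigr => i _.
by rewrite ctrE /nsq re_conj im_conj sqrrN.
Qed.

Definition rdiag n (x : 'I_n -> R) : 'M[C]_n := diag_mx (\row_i Complex (x i) 0).

Lemma rdiagE n (x : 'I_n -> R) i j : rdiag x i j = Complex (x i) 0 *+ (i == j).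
Proof. by rewrite /rdiag !mxE. Qed.

Lemma conj_rdiag_diag n (V : 'M[C]_n) (x : 'I_n -> R) i :
  (V *m rdiag x *m ctr V) i i = Complex (\sum_j nsq (V i j) * x j) 0.
Proof.
rewrite mxE; apply: complex_ext; rewrite ?re_sum ?im_sum /=.
  apply: eq_bigr => j _; rewrite mxE (bigD1 j) //= big1 ?addr0; last first.
    by move=> l lj; rewrite rdiagE (negbTE lj) mulr0n mulr0.
  by rewrite rdiagE eqxx mulr1n ctrE re_mul re_mul im_mul /= re_conj im_conj /nsq; ring.
apply: big1 => j _; rewrite mxE (bigD1 j) //= big1 ?addr0; last first.
  by move=> l lj; rewrite rdiagE (negbTE lj) mulr0n mulr0.
by rewrite rdiagE eqxx mulr1n ctrE im_mul re_mul im_mul /= re_conj im_conj; ring.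
Qed.

(** An entry of the unitary [V] is nonzero only between equal eigenvalues, and its squared moduli
    sum to 1 along every row and column, so either sum of [psi] can be spread over the entries of
    [V]. *)
Lemma eigen_unique n (V : 'M[C]_n) (x y : 'I_n -> R) (psi : R -> R) : unitary V ->
  V *m rdiag x = rdiag y *m V -> \sum_i psi (x i) = \sum_i psi (y i).
Proof.
move=> uV e.
have key i j : nsq (V i j) * psi (x j) = nsq (V i j) * psi (y i).
  have /matrixP/(_ i j) := e; rewrite !mxE (bigD1 j) //= big1 ?addr0; last first.
    by move=> l lj; rewrite rdiagE (negbTE lj) mulr0n mulr0.
  rewrite (bigD1 i) //= big1 ?addr0; last first.
    by move=> l lj; rewrite rdiagE eq_sym (negbTE lj) mulr0n mul0r.
  rewrite !rdiagE !eqxx !mulr1n [RHS]mulrC => /eqP; rewrite -subr_eq0 -mulrBr mulf_eq0 => /orP[/eqP ->|].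
    by rewrite /nsq /= expr0n addr0 !mul0r.
  by rewrite subr_eq0 => /eqP [->].
transitivity (\sum_j \sum_i nsq (V i j) * psi (x j)).
  by apply: eq_bigr => j _; rewrite -mulr_suml unitary_nsq_col // mul1r.
rewrite exchange_big /=; apply: eq_bigr => i _.
by under eq_bigr do rewrite key; rewrite -mulr_suml unitary_nsq_row // mul1r.
Qed.

Definition eigs n (A : 'M[C]_n) (i : 'I_n) : R := re (spectral_diag A 0 i).

Definition spf n (psi : R -> R) (A : 'M[C]_n) : R := \sum_i psi (eigs A i).

Definition hermitian n (A : 'M[C]_n) := ctr A = A.

Lemma hermitian_gram m n (X : 'M[C]_(m, n)) : hermitian (X *m ctr X).
Proof. by rewrite /hermitian ctr_mul ctrK. Qed.

Lemma spectral_unitary n (A : 'M[C]_n) : unitary (spectralmx A).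
Proof. by apply: unitaryP; have /unitarymxP := spectral_unitarymx A. Qed.

Lemma spectral_decomp n (A : 'M[C]_n) : hermitian A ->
  spectralmx A *m A = rdiag (eigs A) *m spectralmx A.
Proof.
move=> hA.
have hs : A \is hermsymmx.
  apply/is_hermitianmxP; rewrite expr0 scale1r -[LHS]hA.
  by apply/matrixP => i j; rewrite !mxE.
have /orthomx_spectralP e : A \is normalmx by apply: hermitian_normalmx.
have /mxOverP dr := hermitian_spectral_diag_real hs.
rewrite [LHS](congr1 (mulmx (spectralmx A)) e) !mulmxA mulmxV ?spectral_unit // mul1mx; congr (_ *m _).
rewrite /rdiag; congr diag_mx; apply/matrixP => i j; rewrite ord1 [RHS]mxE /eigs.
have /Creal_ImP := dr 0 j.
have := dr 0 j; case: (spectral_diag A 0 j) => a b /=.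
by rewrite complex_real => /eqP -> _.
Qed.

Lemma spf_diag n (A V : 'M[C]_n) (x : 'I_n -> R) psi : hermitian A -> unitary V ->
  V *m A = rdiag x *m V -> spf psi A = \sum_i psi (x i).
Proof.
move=> hA uV e; have eA := spectral_decomp hA; have uU := spectral_unitary A.
set U := spectralmx A in eA uU.
apply/esym/(@eigen_unique _ (U *m ctr V)); first by apply: unitary_mul => //; exact: unitary_ctr.
have [v1 v2] := uV.
have e' : A *m ctr V = ctr V *m rdiag x.
  by rewrite -[LHS]mul1mx -v2 -!mulmxA (mulmxA V) e -!mulmxA v1 mulmx1.
by rewrite -mulmxA -e' mulmxA eA -mulmxA.
Qed.

Lemma spf_scale n (A : 'M[C]_n) (a : R) psi : hermitian A ->
  spf psi (Complex a 0 *: A) = spf (fun x => psi (a * x)) A.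
Proof.
move=> hA; apply: (@spf_diag _ _ (spectralmx A) (fun i => a * eigs A i)).
- rewrite /hermitian ctr_scale hA; congr (_ *: _); apply: complex_ext => //=; exact: oppr0.
- exact: spectral_unitary.
- rewrite -scalemxAr spectral_decomp // scalemxAl; congr (_ *m _).
  apply/matrixP => i j; rewrite !mxE; case: eqP => _; rewrite ?mulr1n ?mulr0n ?mulr0 //.
  by apply: complex_ext => /=; ring.
Qed.

(** In the eigenbasis the Gram matrix is diagonal with the squared row norms on the diagonal. This
    turns spectral sums into sums over rows. *)
Lemma eigs_gram m n (X : 'M[C]_(m, n)) i :
  eigs (X *m ctr X) i = rn (spectralmx (X *m ctr X) *m X) i.
Proof.
set A := X *m ctr X; set U := spectralmx A.
have := mul_ctr_diag (U *m X) i.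
rewrite ctr_mul mulmxA -(mulmxA U) -/A spectral_decomp; last exact: hermitian_gram.
have [u1 _] := spectral_unitary A.
by rewrite -mulmxA u1 mulmx1 rdiagE eqxx mulr1n => -[].
Qed.

Lemma eigs_gram_ge0 m n (X : 'M[C]_(m, n)) i : 0 <= eigs (X *m ctr X) i.
Proof. by rewrite eigs_gram rn_ge0. Qed.

Lemma sum_eigs_gram m n (X : 'M[C]_(m, n)) : \sum_i eigs (X *m ctr X) i = fro X.
Proof.
rewrite (eq_bigr _ (fun i _ => eigs_gram X i)) -/(fro _) fro_unitary //.
exact: spectral_unitary.
Qed.

Definition supergrad (psi dpsi : R -> R) :=
  forall x y, 0 <= x -> 0 <= y -> psi y <= psi x + dpsi x * (y - x).

(* Klein's inequality: the squared moduli of the transition matrix between two eigenbases are doubly stochastic. *)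
Lemma klein m n p (psi dpsi : R -> R) (X : 'M[C]_(m, n)) (Y : 'M[C]_(m, p)) :
  supergrad psi dpsi ->
  spf psi (Y *m ctr Y) <= spf psi (X *m ctr X) +
    \sum_i dpsi (eigs (X *m ctr X) i) * (rn (spectralmx (X *m ctr X) *m Y) i - eigs (X *m ctr X) i).
Proof.
move=> sg; set A := X *m ctr X; set B := Y *m ctr Y.
have uU := spectral_unitary A; have uU' := spectral_unitary B.
set U := spectralmx A in uU *; set U' := spectralmx B in uU'.
pose V := U *m ctr U'.
have uV : unitary V by apply: unitary_mul => //; exact: unitary_ctr.
have rnE i : rn (U *m Y) i = \sum_j nsq (V i j) * eigs B j.
  have := mul_ctr_diag (U *m Y) i.
  have [u1 u2] := uU'.
  rewrite ctr_mul mulmxA -(mulmxA U) -/B.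
  have -> : U *m B *m ctr U = V *m rdiag (eigs B) *m ctr V.
    have e' : rdiag (eigs B) = U' *m B *m ctr U'.
      by rewrite spectral_decomp -?mulmxA ?u1 ?mulmx1 //; exact: hermitian_gram.
    by rewrite e' /V ctr_mul ctrK -!mulmxA (mulmxA (ctr U') U') u2 mul1mx (mulmxA (ctr U') U') u2 mul1mx.
  by rewrite conj_rdiag_diag => -[].
rewrite /spf -big_split /=.
apply: (@le_trans _ _ (\sum_i \sum_j nsq (V i j) * psi (eigs B j))).
  rewrite exchange_big /=; apply: ler_sum => j _.
  by rewrite -mulr_suml unitary_nsq_col // mul1r.
apply: ler_sum => i _.
apply: (@le_trans _ _ (\sum_j nsq (V i j) * (psi (eigs A i) + dpsi (eigs A i) * (eigs B j - eigs A i)))).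
  by apply: ler_sum => j _; rewrite ler_wpM2l ?nsq_ge0 // sg // eigs_gram_ge0.
under eq_bigr do rewrite mulrDr mulrCA.
rewrite big_split /= -mulr_suml unitary_nsq_row // mul1r lerD2l -mulr_sumr.
under eq_bigr do rewrite mulrBr.
by rewrite sumrB -mulr_suml unitary_nsq_row // mul1r -rnE.
Qed.

End Spectral.

(** * Exponential moments of Gaussian quadratic forms *)

Section GaussExp.
Context {R : realType}.
Local Notation re := (@complex.Re R).
Local Notation im := (@complex.Im R).

Lemma measurable_quad (a b c : R) : measurable_fun [set: measurableTypeR R] (fun x : R => expR (a * x ^+ 2 + b * x + c)).
Proof.
apply: measurableT_comp => //; apply: measurable_funD => //; apply: measurable_funD; apply: measurable_funM => //.
Qed.

Lemma measurable_quad2 (a b : R) : measurable_fun [set: measurableTypeR R] (fun x : measurableTypeR R => (expR (a * x ^+ 2 + b * x))%:E).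
Proof.
apply/measurable_EFinP; have := @measurable_quad a b 0.
by under eq_fun do rewrite addr0.
Qed.

(** Completing the square: the substitution w x - be / w, with w^2 = 1 - al, leads to the Gauss
    integral. *)
Lemma gau_exp1 (al be : R) : al < 1 ->
  (\int[gau]_x (expR (al * x ^+ 2 + 2 * be * x))%:E = ((Num.sqrt (1 - al))^-1 * expR (be ^+ 2 / (1 - al)))%:E)%E.
Proof.
move=> al1; have a0 : 0 < 1 - al by rewrite subr_gt0.
set w := Num.sqrt (1 - al); have w0 : 0 < w by rewrite sqrtr_gt0.
have w2 : w ^+ 2 = 1 - al by rewrite sqr_sqrtr // ltW.
have mg : measurable_fun [set: measurableTypeR R] (fun x : measurableTypeR R => (expR (- x ^+ 2))%:E).
  have := @measurable_quad2 (-1) 0.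
  by under eq_fun do rewrite mulN1r mul0r addr0.
have h := @integral_affine R w (- be / w) _ w0 mg (fun x => expR_ge0 _).
rewrite integral_gau; last 2 first.
- exact: measurable_quad2.
- by move=> x; rewrite lee_fin expR_ge0.
have spi : Num.sqrt pi != 0 :> R by rewrite gt_eqF // sqrtr_gt0 pi_gt0.
transitivity ((Num.sqrt pi)^-1%:E * (expR (be ^+ 2 / (1 - al)))%:E * \int[lebesgue_measure]_x (expR (- (w * x + - be / w) ^+ 2))%:E)%E.
  rewrite -EFinM -ge0_integralZl //; last exact: (measurableT_comp mg (measurable_affine w (- be / w))).
  apply: eq_integral => x _; rewrite /gpdf -!EFinM mulrCA -!mulrA -!expRD; congr (_ * expR _)%:E.
  have ale : al = 1 - w ^+ 2 by rewrite w2; ring.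
  by rewrite -w2 [in LHS]ale; field; rewrite gt_eqF.
have -> : (\int[lebesgue_measure]_x (expR (- (w * x + - be / w) ^+ 2))%:E = (w^-1 * Num.sqrt pi)%:E)%E.
  have := @integralT_gauss R; rewrite /gauss_fun h => h2.
  by rewrite EFinM -h2 muleA -EFinM mulVf ?mul1e // gt_eqF.
rewrite -!EFinM; congr EFin; field.
by rewrite spi gt_eqF.
Qed.

Lemma measurable_quad_sum k (al : R) (be : nat -> R) :
  measurable_fun setT (fun v : Om R => (expR (\sum_(i < k) (al * (nth 0 v i) ^+ 2 + 2 * be i * nth 0 v i)))%:E).
Proof.
apply/measurable_EFinP; apply: measurableT_comp => //.
apply: measurable_sum => i; apply: measurable_funD; apply: measurable_funM => //; last exact: measurable_nth.
by apply: measurable_funX; exact: measurable_nth.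
Qed.

Lemma EG_exp k (al : R) (be : nat -> R) : al < 1 ->
  EG k (fun v => (expR (\sum_(i < k) (al * (nth 0 v i) ^+ 2 + 2 * be i * nth 0 v i)))%:E) =
  ((Num.sqrt (1 - al))^-1 ^+ k * expR ((\sum_(i < k) be i ^+ 2) / (1 - al)))%:E.
Proof.
move=> al1; elim: k be => [|k IH] be.
  by rewrite /EG /= !big_ord0 mul0r expR0 expr0 mulr1.
rewrite /EG /=.
under eq_integral => x _.
  have -> : itI gau k (fun v => (expR (\sum_(i < k.+1) (al * (nth 0 (x :: v) i) ^+ 2 + 2 * be i * nth 0 (x :: v) i)))%:E) =
    ((expR (al * x ^+ 2 + 2 * be 0%N * x))%:E * ((Num.sqrt (1 - al))^-1 ^+ k * expR ((\sum_(i < k) be i.+1 ^+ 2) / (1 - al)))%:E)%E.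
    rewrite -(IH (fun i => be i.+1)) -itI_Z //; last exact: (measurable_quad_sum k al (fun i => be i.+1)).
    by apply: eq_itI => v _; rewrite -EFinM -expRD big_ord_recl.
  over.
rewrite ge0_integralZr ?lee_fin ?mulr_ge0 ?expR_ge0 ?exprn_ge0 ?invr_ge0 ?sqrtr_ge0 //; last exact: measurable_quad2.
rewrite (@gau_exp1 al (be 0%N)) // -EFinM mulrACA -expRD -mulrDl -exprS.
by rewrite [in RHS]big_ord_recl.
Qed.

Lemma sum_col1 n (F : 'I_n -> 'I_1 -> R) : \sum_(i < n) \sum_(j < 1) F i j = \sum_(i < n) F i 0.
Proof. by apply: eq_bigr => i _; rewrite big_ord_recl big_ord0 addr0; congr F; apply/val_inj. Qed.

Lemma EG_expC n (al : R) (b : 'cV[R[i]]_n) : al < 1 ->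
  EG (2 * n) (fun v => (expR (al * fro (cvec_of n v) + 2 * fdot b (cvec_of n v)))%:E) =
  ((1 - al)^-1 ^+ n * expR (fro b / (1 - al)))%:E.
Proof.
move=> al1.
pose be i := nth 0 (seqc (\col_(r < 2 * n) (if odd r then im (b (hf r) 0) else re (b (hf r) 0)))) i.
have bee (a : 'I_n) : be (ev a) = re (b a 0) by rewrite /be nth_seqc mxE hf_ev odd_ev.
have beo (a : 'I_n) : be (od a) = im (b a 0) by rewrite /be nth_seqc mxE hf_od odd_od.
transitivity (EG (2 * n) (fun v => (expR (\sum_(i < 2 * n) (al * (nth 0 v i) ^+ 2 + 2 * be i * nth 0 v i)))%:E)).
  apply: eq_itI => v _; congr (expR _)%:E.
  rewrite sum_evod /fro /fdot /rn /rdot !sum_col1 !mulr_sumr -big_split /=; apply: eq_bigr => a _.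
  by rewrite bee beo /nsq /cdot !mxE /=; ring.
have e1 : (Num.sqrt (1 - al))^-1 ^+ (2 * n) = (1 - al)^-1 ^+ n.
  by rewrite exprM exprVn sqr_sqrtr // subr_ge0 ltW.
have e2 : \sum_(i < 2 * n) be i ^+ 2 = fro b.
  by rewrite sum_evod /fro /rn sum_col1; apply: eq_bigr => a _; rewrite bee beo.
by rewrite -e1 -e2; exact: EG_exp.
Qed.

End GaussExp.

(** * Bipartite vectors as matrices, and spectral functionals of them *)

Section Reshape.
Context {R : realType}.
Local Notation C := (R[i]).

Lemma sum_mxvec (V : nmodType) p q (F : 'I_(p * q) -> V) :
  \sum_i F i = \sum_(a < p) \sum_(b < q) F (mxvec_index a b).
Proof.
rewrite pair_bigA /= (reindex _ (curry_mxvec_bij p q)).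
by apply: eq_bigr => -[a b].
Qed.

Definition mat p q (phi : 'cV[C]_(p * q)) : 'M[C]_(p, q) := \matrix_(a, b) phi (mxvec_index a b) 0.

Lemma matD p q (f g : 'cV[C]_(p * q)) : mat (f + g) = mat f + mat g.
Proof. by apply/matrixP => i j; rewrite !mxE. Qed.

Lemma matZ p q a (f : 'cV[C]_(p * q)) : mat (a *: f) = a *: mat f.
Proof. by apply/matrixP => i j; rewrite !mxE. Qed.

Definition unmat p q (M : 'M[C]_(p, q)) : 'cV[C]_(p * q) := (mxvec M)^T.

Lemma unmatK p q (M : 'M[C]_(p, q)) : mat (unmat M) = M.
Proof. by apply/matrixP => i j; rewrite !mxE mxvecE. Qed.

Lemma fro_col n (phi : 'cV[C]_n) : fro phi = \sum_i nsq (phi i 0).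
Proof. by rewrite /fro /rn sum_col1. Qed.

Lemma fdot_col n (f g : 'cV[C]_n) : fdot f g = \sum_i cdot (f i 0) (g i 0).
Proof. by rewrite /fdot /rdot sum_col1. Qed.

Lemma fro_mat p q (phi : 'cV[C]_(p * q)) : fro (mat phi) = fro phi.
Proof.
by rewrite fro_col sum_mxvec; apply: eq_bigr => a _; apply: eq_bigr => b _; rewrite mxE.
Qed.

Lemma fdot_mat p q (f g : 'cV[C]_(p * q)) : fdot (mat f) (mat g) = fdot f g.
Proof.
by rewrite fdot_col sum_mxvec; apply: eq_bigr => a _; apply: eq_bigr => b _; rewrite !mxE.
Qed.

Lemma ptrace2_proj p q (phi : 'cV[C]_(p * q)) : ptrace2 (Defs.proj phi) = mat phi *m ctr (mat phi).
Proof.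
apply/matrixP => a a'; rewrite !mxE; apply: eq_bigr => b _.
by rewrite ctrE !mxE big_ord_recl big_ord0 addr0 !mxE; congr (_ * Num.conj (phi _ _)); apply/val_inj.
Qed.

Lemma fro_comb m n (X Y : 'M[C]_(m, n)) (c s : R) :
  fro (Complex c 0 *: X + Complex s 0 *: Y) = c ^+ 2 * fro X + s ^+ 2 * fro Y + 2 * c * s * fdot X Y.
Proof.
by rewrite /fro /fdot !mulr_sumr -!big_split /=; apply: eq_bigr => i _; rewrite rn_comb.
Qed.

Lemma Complex1E : Complex 1 0 = 1 :> C. Proof. by []. Qed.

Lemma fro_add m n (X Y : 'M[C]_(m, n)) : fro (X + Y) = fro X + fro Y + 2 * fdot X Y.
Proof.
have := fro_comb X Y 1 1; rewrite !Complex1E !scale1r => ->; ring.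
Qed.

Lemma rn_add m n (X Y : 'M[C]_(m, n)) i : rn (X + Y) i = rn X i + rn Y i + 2 * rdot X Y i.
Proof.
have := rn_comb X Y 1 1 i; rewrite !Complex1E !scale1r => ->; ring.
Qed.

Lemma rn_scaleR m n (X : 'M[C]_(m, n)) (c : R) i : rn (Complex c 0 *: X) i = c ^+ 2 * rn X i.
Proof.
have := rn_comb X 0 c 0 i; rewrite scaler0 addr0 => ->.
by rewrite expr0n /= mul0r mulr0 mul0r !addr0.
Qed.

Lemma fro_scaleR m n (X : 'M[C]_(m, n)) (c : R) : fro (Complex c 0 *: X) = c ^+ 2 * fro X.
Proof. by rewrite /fro mulr_sumr; apply: eq_bigr => i _; rewrite rn_scaleR. Qed.

Lemma fdot_scaleRl m n (X Y : 'M[C]_(m, n)) (c : R) : fdot (Complex c 0 *: X) Y = c * fdot X Y.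
Proof.
rewrite /fdot /rdot mulr_sumr; apply: eq_bigr => i _; rewrite mulr_sumr; apply: eq_bigr => j _.
by rewrite /cdot !mxE re_mul im_mul /=; ring.
Qed.

(** Young's inequality with weight [eta], applied to each real product and to its opposite. *)
Lemma rdot_amgm m n (X Y : 'M[C]_(m, n)) i (eta : R) : 0 < eta ->
  `| 2 * rdot X Y i | <= eta * rn X i + eta^-1 * rn Y i.
Proof.
move=> e0; rewrite /rdot /rn !mulr_sumr -big_split /=.
apply: (le_trans (ler_norm_sum _ _ _)); apply: ler_sum => j _.
move: (X i j) (Y i j) => [a b] [c e]; rewrite /cdot /nsq /=.
have h (u v : R) : 2 * (u * v) <= eta * u ^+ 2 + eta^-1 * v ^+ 2.
  rewrite -subr_ge0 (_ : _ - _ = eta^-1 * (eta * u - v) ^+ 2).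
    by rewrite mulr_ge0 ?sqr_ge0 // invr_ge0 ltW.
  by field; rewrite gt_eqF.
have h1 := h a c; have h2 := h b e; have h3 := h a (- c); have h4 := h b (- e).
rewrite sqrrN in h3; rewrite sqrrN in h4.
by rewrite ler_norml; apply/andP; split; lra.
Qed.

Section Fpsi.
Variables (d : nat) (psi dpsi : R -> R).
Hypothesis sg : supergrad psi dpsi.
Hypothesis dpsi01 : forall x, 0 <= x -> 0 <= dpsi x <= 1.

(** The sum of [psi] over the squared singular values of the reshaped vector; for a unit vector
    these are the eigenvalues of its reduced state. *)
Definition Fpsi p (psi : R -> R) q (phi : 'cV[C]_(p * q)) : R := spf psi (mat phi *m ctr (mat phi)).

(** Concavity puts the functional below its linearisation in the eigenbasis of [g]. The vector [b]
    is dpsi (A) applied to [g], with A the Gram matrix of [mat g]: half the gradient. Its norm is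
    computed exactly because the logarithmic functional needs more than [fro b <= fro g]. *)
Lemma Fpsi_step (g : 'cV[C]_(d * d)) : exists b : 'cV[C]_(d * d),
  fro b = \sum_i dpsi (eigs (mat g *m ctr (mat g)) i) ^+ 2 * eigs (mat g *m ctr (mat g)) i /\
  forall g' c s, c ^+ 2 + s ^+ 2 = 1 ->
   Fpsi psi (Complex c 0 *: g + Complex s 0 *: g') <= Fpsi psi g + s ^+ 2 * fro g' + 2 * c * s * fdot b g'.
Proof.
set A := mat g *m ctr (mat g); set U := spectralmx A.
have uU : unitary U by exact: spectral_unitary.
pose Z := rdiag (fun i => dpsi (eigs A i)).
have ZX (X : 'M[C]_d) i j : (Z *m X) i j = Complex (dpsi (eigs A i)) 0 * X i j.
  rewrite mxE (bigD1 i) //= big1 ?addr0; last by move=> l li; rewrite rdiagE eq_sym (negbTE li) mulr0n mul0r.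
  by rewrite rdiagE eqxx mulr1n.
exists (unmat (ctr U *m (Z *m (U *m mat g)))); split.
  rewrite -fro_mat unmatK fro_unitary; last exact: unitary_ctr.
  apply: eq_bigr => i _; rewrite [X in _ ^+ 2 * X]eigs_gram /rn mulr_sumr; apply: eq_bigr => j _.
  by rewrite ZX /nsq re_mul im_mul /=; ring.
move=> g' c s cs; rewrite /Fpsi.
apply: (le_trans (klein (mat g) _ sg)); rewrite -/A -/U -addrA lerD2l.
rewrite -[fdot _ g']fdot_mat unmatK fdot_adj -(fro_mat g') -(fro_unitary (mat g') uU).
rewrite /fro /fdot !mulr_sumr -big_split /=; apply: ler_sum => i _.
rewrite matD !matZ mulmxDr -!scalemxAr rn_comb.
have -> : eigs A i = rn (U *m mat g) i by rewrite eigs_gram.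
set x := rn _ i.
have x0 : 0 <= x by exact: rn_ge0.
have /andP[z0 z1] := dpsi01 x0.
have -> : rdot (Z *m (U *m mat g)) (U *m mat g') i = dpsi x * rdot (U *m mat g) (U *m mat g') i.
  rewrite /rdot mulr_sumr; apply: eq_bigr => j _.
  rewrite ZX eigs_gram -/A -/U -/x /cdot re_mul im_mul /= mul0r subr0 mul0r addr0.
  by rewrite -!mulrA -mulrDr.
set y := rn _ i; set w := rdot _ _ i.
have y0 : 0 <= y by exact: rn_ge0.
clearbody x y w.
have -> : c ^+ 2 = 1 - s ^+ 2 by rewrite -cs; ring.
(* After c^2 = 1 - s^2 the slack is visibly nonnegative, since the slope [dpsi x] lies in [0, 1]. *)
rewrite -subr_ge0 (_ : _ - _ = s ^+ 2 * ((1 - dpsi x) * y + dpsi x * x)); last by ring.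
by rewrite mulr_ge0 ?sqr_ge0 // addr_ge0 // mulr_ge0 // subr_ge0.
Qed.

Lemma Fpsi_step_id (g : 'cV[C]_(d * d)) : exists b : 'cV[C]_(d * d), fro b <= fro g /\
  forall g' c s, c ^+ 2 + s ^+ 2 = 1 ->
   Fpsi psi (Complex c 0 *: g + Complex s 0 *: g') <= Fpsi psi g + s ^+ 2 * fro g' + 2 * c * s * fdot b g'.
Proof.
have [b [bE hb]] := Fpsi_step g; exists b; split => //.
rewrite bE -(fro_mat g) -sum_eigs_gram; apply: ler_sum => i _.
have x0 := eigs_gram_ge0 (mat g) i; have /andP[z0 z1] := dpsi01 x0.
by rewrite -[leRHS]mul1r ler_wpM2r // expr_le1.
Qed.

(** Klein's inequality with Young's inequality on the cross term; used in both directions, it gives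
    continuity. *)
Lemma Fpsi_upper (g g' : 'cV[C]_(d * d)) (eta : R) : 0 < eta ->
  Fpsi psi g' - Fpsi psi g <= (1 + eta^-1) * fro (g' - g) + eta * fro g.
Proof.
move=> e0; rewrite lerBlDl /Fpsi.
apply: (le_trans (klein (mat g) _ sg)); rewrite lerD2l.
set A := mat g *m ctr (mat g); set U := spectralmx A.
have uU : unitary U by exact: spectral_unitary.
rewrite -(fro_mat (g' - g)) -(fro_mat g) -(fro_unitary (mat (g' - g)) uU) -(fro_unitary (mat g) uU).
rewrite /fro !mulr_sumr -big_split /=; apply: ler_sum => i _.
have -> : U *m mat g' = U *m mat g + U *m mat (g' - g).
  by rewrite -mulmxDr -matD addrC subrK.
rewrite rn_add eigs_gram -/A -/U.
have := rdot_amgm (U *m mat g) (U *m mat (g' - g)) i e0.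
set x := rn (U *m mat g) i; set y := rn _ i; set w := rdot _ _ i => hw.
have x0 : 0 <= x by exact: rn_ge0.
have y0 : 0 <= y by exact: rn_ge0.
have /andP[z0 z1] := dpsi01 x0.
clearbody x y w.
have hw2 : 2 * w <= eta * x + eta^-1 * y by apply: le_trans hw; exact: ler_norm.
have r0 : 0 <= y + (eta * x + eta^-1 * y).
  by rewrite !addr_ge0 // mulr_ge0 // ?invr_ge0 ltW.
apply: (@le_trans _ _ (dpsi x * (y + (eta * x + eta^-1 * y)))).
  by rewrite ler_wpM2l //; lra.
apply: (@le_trans _ _ (y + (eta * x + eta^-1 * y))); last by lra.
by rewrite -[leRHS]mul1r ler_wpM2r.
Qed.

End Fpsi.

Definition fcontinuous n (F : 'cV[C]_n -> R) := forall g eps, 0 < eps ->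
  exists2 del, 0 < del & forall g', fro (g' - g) <= del -> `|F g' - F g| <= eps.

Lemma Fpsi_continuous d psi dpsi : supergrad psi dpsi -> (forall x, 0 <= x -> 0 <= dpsi x <= 1) ->
  fcontinuous (@Fpsi d psi d).
Proof.
move=> sg dp g eps e0.
pose P := fro g; have P0 : 0 <= P by exact: fro_ge0.
(* Here 2 P + 2 bounds [fro g'] when [g'] is within distance 1 of [g], so the terms weighted by
   [eta] stay below eps / 4 in both directions. *)
pose eta := eps / (4 * (2 * P + 2)).
have eta0 : 0 < eta by rewrite divr_gt0 // mulr_gt0 //; lra.
pose del := Num.min 1 (eps / (2 * (1 + eta^-1))).
have i0 : 0 < eta^-1 by rewrite invr_gt0.
have q0 : 0 < 1 + eta^-1 by lra.
have del0 : 0 < del by rewrite lt_min ltr01 divr_gt0 // mulr_gt0.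
exists del => // g' hg'.
have h1 : fro (g' - g) <= 1 by apply: (le_trans hg'); rewrite ge_min lexx.
have h2 : (1 + eta^-1) * fro (g' - g) <= eps / 2.
  have h : fro (g' - g) <= eps / (2 * (1 + eta^-1)) by apply: (le_trans hg'); rewrite ge_min lexx orbT.
  move: (1 + eta^-1) q0 h => q q0 h.
  apply: (@le_trans _ _ (q * (eps / (2 * q)))); first by rewrite ler_pM2l.
  by rewrite le_eqVlt; apply/orP; left; apply/eqP; field; rewrite gt_eqF.
have Pg' : fro g' <= 2 * P + 2.
  have : fro (g + (g' - g)) = fro g + fro (g' - g) + 2 * fdot g (g' - g) by exact: fro_add.
  rewrite addrC subrK => ->.
  have : 2 * fdot g (g' - g) <= fro g + fro (g' - g).
    rewrite /fdot /fro mulr_sumr -big_split /=; apply: ler_sum => i _.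
    have := rdot_amgm g (g' - g) i ltr01; rewrite invr1 !mul1r => h.
    by apply: le_trans h; exact: ler_norm.
  rewrite -/P => *; lra.
have eP (Q : R) : Q <= 2 * P + 2 -> eta * Q <= eps / 4.
  move=> hQ; apply: (@le_trans _ _ (eta * (2 * P + 2))); first by rewrite ler_pM2l.
  by rewrite /eta le_eqVlt; apply/orP; left; apply/eqP; field; apply/eqP; lra.
have u1 := Fpsi_upper sg dp g g' eta0.
have u2 := Fpsi_upper sg dp g' g eta0.
have fr : fro (g - g') = fro (g' - g).
  rewrite -opprB; have := fro_scaleR (g' - g) (-1).
  by rewrite sqrrN expr1n mul1r => <-; congr fro; apply/matrixP => i j; rewrite !mxE -[LHS]mulN1r;
    congr (_ * _); apply: complex_ext => //=; rewrite oppr0.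
rewrite fr in u2.
have e1 := eP _ Pg'; have e2 : eta * fro g <= eps / 4 by apply: eP; rewrite -/P; lra.
rewrite ler_norml; apply/andP; split; lra.
Qed.

End Reshape.

(** * Measurability of continuous functionals *)

Section ContMeas.
Context {R : realType}.
Local Notation C := (R[i]).

Definition cells (n m : nat) (v : seq R) : seq int := mkseq (fun i => Num.floor (m.+1%:R * nth 0 v i)) (2 * n).

Lemma measurable_cells n m (z : seq int) : measurable [set v : Om R | cells n m v = z].
Proof.
have [sz|sz] := eqVneq (size z) (2 * n)%N; last first.
  rewrite (_ : [set _ | _] = set0) //; apply/seteqP; split => v //= h.
  by move: sz; rewrite -h size_mkseq eqxx.
rewrite (_ : [set _ | _] = \bigcap_(i in [set i | (i < 2 * n)%N])
   ((fun v : Om R => nth 0 v i : measurableTypeR R) @^-1`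
     [set` `[(nth 0 z i)%:~R / m.+1%:R, (nth 0 z i + 1)%:~R / m.+1%:R[%R])); last first.
  have m0 : (0 : R) < m.+1%:R by rewrite ltr0n.
  have e (v : seq R) i : (Num.floor (m.+1%:R * nth 0 v i) == nth 0 z i) =
      (nth 0 v i \in `[(nth 0 z i)%:~R / m.+1%:R, (nth 0 z i + 1)%:~R / m.+1%:R[).
    by rewrite floor_eq // in_itv /= ler_pdivrMr // ltr_pdivlMr // ![_ * m.+1%:R]mulrC.
  apply/seteqP; split => v /=.
    by move=> h i /= ik; rewrite -e -h nth_mkseq.
  move=> h; apply: (@eq_from_nth _ 0); rewrite size_mkseq // => i ik.
  by rewrite nth_mkseq //; apply/eqP; rewrite e; exact: h.
apply: bigcap_measurableType => // i _.
by rewrite -[X in measurable X]setTI; apply: measurable_nth.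
Qed.

Definition gridpt n m (z : seq int) : 'cV[C]_n := cvec_of n (map (fun k : int => k%:~R / m.+1%:R : R) z).

Lemma fro_gridpt n m (v : seq R) : fro (gridpt n m (cells n m v) - cvec_of n v) <= (2 * n)%:R / m.+1%:R.
Proof.
have m0 : (0 : R) < m.+1%:R by rewrite ltr0n.
have close i : (i < 2 * n)%N -> (nth 0 (map (fun k : int => k%:~R / m.+1%:R : R) (cells n m v)) i - nth 0 v i) ^+ 2 <= m.+1%:R^-1.
  move=> ik; rewrite (nth_map 0) ?size_mkseq // nth_mkseq //.
  set y := nth 0 v i; have := floor_le (m.+1%:R * y); have := floorD1_gt (m.+1%:R * y).
  set f := Num.floor _; rewrite intrD => h1 h2.
  have -> : f%:~R / m.+1%:R - y = - (m.+1%:R * y - f%:~R) / m.+1%:R by field; rewrite addrC natr1 pnatr_eq0.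
  set w := m.+1%:R * y - f%:~R.
  have w0 : 0 <= w by rewrite /w; lra.
  have w1 : w <= 1 by rewrite /w; lra.
  rewrite mulNr sqrrN expr_div_n.
  apply: (@le_trans _ _ (1 / m.+1%:R ^+ 2)).
    by rewrite ler_pM2r ?invr_gt0 ?exprn_gt0 // expr_le1.
  by rewrite mul1r lef_pV2 ?posrE ?exprn_gt0 // expr2 ler_peMl ?ler1n // ltW.
have -> : (2 * n)%:R / m.+1%:R = \sum_(i < n) (m.+1%:R^-1 + m.+1%:R^-1) :> R.
  by rewrite sumr_const card_ord -mulr_natr natrM; ring.
rewrite fro_col; apply: ler_sum => a _; rewrite /gridpt !mxE /nsq re_add im_add re_opp im_opp.
by apply: lerD; [have := close _ (ev_lt a) | have := close _ (od_lt a)].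
Qed.

(** The function is a pointwise limit of step functions, each constant on the countably many cells
    of a grid of mesh 1 / (m + 1); a cell is cut out by finitely many coordinate conditions and so
    is measurable in [Om]. *)
Lemma fcontinuous_measurable n (F : 'cV[C]_n -> R) : fcontinuous F ->
  measurable_fun setT (fun v : Om R => F (cvec_of n v) : measurableTypeR R).
Proof.
move=> cF.
apply: (@measurable_fun_cvg _ _ _ setT (fun m (v : Om R) => F (gridpt n m (cells n m v)))) => //.
- move=> m _ Y mY; rewrite setTI.
  rewrite (_ : _ @^-1` _ = \bigcup_(z : seq int) (if F (gridpt n m z) \in Y then [set v : Om R | cells n m v = z] else set0)).
    apply: countable_bigcupT_measurable => // z.
    by case: ifP => _ //; exact: measurable_cells.
  apply/seteqP; split => v /=.
    by move=> h; exists (cells n m v) => //; rewrite ifT ?inE.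
  by move=> [z _]; case: ifPn => //=; rewrite inE => h ->.
- move=> v _; apply/cvgrPdist_le => eps e0.
  have [del d0 hd] := cF (cvec_of n v) eps e0.
  near=> m; rewrite distrC; apply: hd.
  apply: (le_trans (fro_gridpt n m v)).
  rewrite ler_pdivrMr ?ltr0n // mulrC -ler_pdivrMr //.
  apply: (@le_trans _ _ m%:R); last by rewrite ler_nat.
  by near: m; exact: nbhs_infty_ger.
Unshelve. all: by end_near.
Qed.

Lemma fcont_meas_C n (F : 'cV[C]_n -> R) (h : R -> \bar R) : fcontinuous F ->
  measurable_fun [set: measurableTypeR R] h -> meas_C (fun g => h (F g)).
Proof. by move=> cF mh; exact: (measurableT_comp mh (fcontinuous_measurable cF)). Qed.

End ContMeas.

(** * The joint law of the images of two orthonormal vectors *)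

Section PairLaw.
Context {R : realType}.
Local Notation C := (R[i]).

(** The matrix of the linear map that sends the flattened G to G x; its rows are orthonormal exactly
    because x is a unit vector, which makes it a coisometry. *)
Definition applymx n s (x : 'cV[C]_s) : 'M[C]_(n, n * s) :=
  \matrix_(a, c) mxvec (\matrix_(a', b) ((a == a')%:R * x b 0)) 0 c.

Lemma applymxE n s (x : 'cV[C]_s) a a' b : applymx n x a (mxvec_index a' b) = (a == a')%:R * x b 0.
Proof. by rewrite mxE mxvecE mxE. Qed.

Lemma applymx_mul n s (x : 'cV[C]_s) (psi : 'cV[C]_(n * s)) : applymx n x *m psi = mat psi *m x.
Proof.
apply/matrixP => a j; rewrite ord1 !mxE sum_mxvec (bigD1 a) //= [X in _ + X]big1 ?addr0.
  by apply: eq_bigr => b _; rewrite applymxE eqxx mul1r !mxE mulrC.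
by move=> a' aa'; apply: big1 => b _; rewrite applymxE eq_sym (negbTE aa') !mul0r.
Qed.

Definition inner s (x y : 'cV[C]_s) : C := \sum_b x b 0 * Num.conj (y b 0).

Lemma applymx_ctr n s (x y : 'cV[C]_s) : applymx n x *m ctr (applymx n y) = (inner x y)%:M.
Proof.
apply/matrixP => a a'; rewrite !mxE sum_mxvec (bigD1 a) //= [X in _ + X]big1 ?addr0; last first.
  by move=> l la; apply: big1 => b _; rewrite applymxE eq_sym (negbTE la) !mul0r.
rewrite /inner; case: eqP => [->|ne].
  rewrite mulr1n; apply: eq_bigr => b _.
  by rewrite ctrE !applymxE eqxx !mul1r.
rewrite mulr0n; apply: big1 => b _.
rewrite ctrE !applymxE (_ : a' == a = false); last by apply/eqP => e; apply: ne.
by rewrite mul0r rmorph0 mulr0.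
Qed.

Lemma inner_re s (x y : 'cV[C]_s) : complex.Re (inner x y) = fdot x y.
Proof.
rewrite fdot_col /inner re_sum; apply: eq_bigr => b _.
by rewrite re_mul re_conj im_conj /cdot; ring.
Qed.

Lemma innerxx s (x : 'cV[C]_s) : inner x x = Complex (fro x) 0.
Proof.
apply: complex_ext; first by rewrite inner_re fdotXX.
rewrite /inner im_sum /=; apply: big1 => b _.
by rewrite im_mul re_conj im_conj; ring.
Qed.

Lemma inner_conj s (x y : 'cV[C]_s) : Num.conj (inner x y) = inner y x.
Proof.
rewrite /inner rmorph_sum; apply: eq_bigr => b _.
by rewrite rmorphM /= conjCK mulrC.
Qed.

Lemma inner_scaleR s (x y : 'cV[C]_s) a b : inner (a *: x) (b *: y) = a * Num.conj b * inner x y.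
Proof. by rewrite /inner mulr_sumr; apply: eq_bigr => i _; rewrite !mxE rmorphM /=; ring. Qed.

Lemma inner_Dl s (x y z : 'cV[C]_s) : inner (x + y) z = inner x z + inner y z.
Proof. by rewrite /inner -big_split; apply: eq_bigr => i _; rewrite mxE /= mulrDl. Qed.

Lemma inner_Dr s (x y z : 'cV[C]_s) : inner z (x + y) = inner z x + inner z y.
Proof. by rewrite /inner -big_split; apply: eq_bigr => i _; rewrite mxE /= rmorphD mulrDr. Qed.

Definition orthopair s (x y : 'cV[C]_s) := [/\ fro x = 1, fro y = 1 & inner x y = 0].

Lemma EG_single n s (x : 'cV[C]_s) (F : 'cV[C]_n -> \bar R) : fro x = 1 ->
  meas_C F -> (forall c, (0 <= F c)%E) ->
  EG (2 * (n * s)) (fun v => F (mat (cvec_of (n * s) v) *m x)) = EG (2 * n) (fun w => F (cvec_of n w)).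
Proof.
move=> x1 mF F0.
rewrite -(@EG_coisometryC _ _ _ (applymx n x) F) //; last first.
  by rewrite applymx_ctr innerxx x1.
by apply: eq_itI => v _; rewrite applymx_mul.
Qed.

(** For orthonormal [x] and [y] the two application maps stack to a coisometry, so G x and G y are
    independent standard Gaussian vectors. *)
Lemma EG_pair n s (x y : 'cV[C]_s) (F : 'cV[C]_(n + n) -> \bar R) : orthopair x y ->
  meas_C F -> (forall c, (0 <= F c)%E) ->
  EG (2 * (n * s)) (fun v => F (col_mx (mat (cvec_of (n * s) v) *m x) (mat (cvec_of (n * s) v) *m y))) =
  EG (2 * n) (fun u => EG (2 * n) (fun w => F (col_mx (cvec_of n u) (cvec_of n w)))).
Proof.
move=> [x1 y1 xy] mF F0; rewrite -EG_cat.
rewrite -(@EG_coisometryC _ _ _ (col_mx (applymx n x) (applymx n y)) F) //; last first.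
  have -> : ctr (col_mx (applymx n x) (applymx n y)) = row_mx (ctr (applymx n x)) (ctr (applymx n y)).
    by rewrite /ctr tr_col_mx map_row_mx.
  rewrite mul_col_row !applymx_ctr !innerxx x1 y1 xy -(inner_conj x y) xy rmorph0.
  by rewrite !raddf0 -scalar_mx_block.
by apply: eq_itI => v _; rewrite mul_col_mx !applymx_mul.
Qed.

End PairLaw.

(** * Exponential moments over a single rotation *)

Section MGF.
Context {R : realType}.
Local Notation C := (R[i]).
Local Notation "a %:CR" := (Complex a 0) (at level 2, format "a %:CR").

(** The only structural property of the functional that the moment bounds use. It is applied with
    ([k0], [k1]) = (0, 1) for the chaining and with (d / (4 u), 0) for ln (x + u), where the
    gradient is bounded. *)
Definition stepF n (k0 k1 : R) (F : 'cV[C]_n -> R) := forall g, exists b : 'cV[C]_n,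
  fro b <= k0 + k1 * fro g /\
  forall g' c s, c ^+ 2 + s ^+ 2 = 1 ->
    F (c%:CR *: g + s%:CR *: g') <= F g + s ^+ 2 * fro g' + 2 * c * s * fdot b g'.

Lemma fro_continuous n : fcontinuous (@fro R n 1).
Proof.
move=> g eps e0; pose P := fro g; have P0 : 0 <= P by exact: fro_ge0.
pose eta := eps / (2 * (P + 1)).
have eta0 : 0 < eta by rewrite divr_gt0 // mulr_gt0 //; lra.
have i0 : 0 < eta^-1 by rewrite invr_gt0.
have q0 : 0 < 1 + eta^-1 by lra.
exists (eps / (2 * (1 + eta^-1))); first by rewrite divr_gt0 // mulr_gt0.
move=> g'; move: (g' - g) (subrK g g') => h <- hh.
have h2 : (1 + eta^-1) * fro h <= eps / 2.
  apply: (@le_trans _ _ ((1 + eta^-1) * (eps / (2 * (1 + eta^-1))))); first by rewrite ler_pM2l.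
  move: (1 + eta^-1) q0 => q q0.
  by rewrite le_eqVlt; apply/orP; left; apply/eqP; field; rewrite gt_eqF.
have h3 : eta * P <= eps / 2.
  have -> : eps / 2 = eta * (P + 1) by rewrite /eta; field; apply/eqP; lra.
  by rewrite ler_pM2l //; lra.
rewrite fro_add -/P.
have : `|2 * fdot h g| <= eta * P + eta^-1 * fro h.
  rewrite /fdot /P /fro !mulr_sumr -big_split /=; apply: (le_trans (ler_norm_sum _ _ _)).
  apply: ler_sum => i _; have := rdot_amgm g h i eta0.
  by rewrite (_ : rdot g h i = rdot h g i) //; apply: eq_bigr => j _; rewrite /cdot; ring.
have f0 := fro_ge0 h.
rewrite mulrDl mul1r in h2.
rewrite !ler_norml => /andP[a b]; apply/andP; split; lra.
Qed.

Lemma inv1m_le (a : R) : 0 <= a <= 2^-1 -> (1 - a)^-1 <= expR (2 * a).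
Proof.
move=> /andP[a0 a1].
have h : 1 <= (1 - a) * expR (2 * a).
  have := expR_ge1Dx (2 * a) => h.
  apply: (@le_trans _ _ ((1 - a) * (1 + 2 * a))); first by nra.
  by rewrite ler_wpM2l //; lra.
have p : 0 < 1 - a by lra.
by rewrite -(ler_pM2l p) mulfV ?gt_eqF.
Qed.

Lemma EG_exp_fro n (a : R) : 0 <= a <= 2^-1 ->
  (EG (2 * n) (fun v => (expR (a * fro (cvec_of n v)))%:E) <= (expR (2 * n%:R * a))%:E)%E.
Proof.
move=> ha; have /andP[a0 a1] := ha.
have := @EG_expC R n a 0 _; rewrite (_ : a < 1) => [/(_ isT) h|]; last by lra.
have e0 : fro (0 : 'cV[C]_n) = 0.
  by rewrite fro_col big1 // => i _; rewrite mxE /nsq /= expr0n addr0.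
rewrite (_ : EG _ _ = EG (2 * n) (fun v => (expR (a * fro (cvec_of n v) + 2 * fdot (0 : 'cV[C]_n) (cvec_of n v)))%:E)).
  rewrite h e0 mul0r expR0 mulr1 lee_fin.
  apply: (le_trans (_ : _ <= expR (2 * a) ^+ n)).
    by rewrite lerXn2r ?nnegrE ?expR_ge0 ?inv1m_le // invr_ge0; lra.
  by rewrite -expRM_natr le_eqVlt; apply/orP; left; apply/eqP; congr expR; ring.
apply: eq_itI => v _; rewrite fdot_col big1 ?mulr0 ?addr0 // => i _.
by rewrite mxE /cdot /= !mul0r addr0.
Qed.

Variables (n : nat) (k0 k1 : R) (F : 'cV[C]_n -> R).
Hypothesis cF : fcontinuous F.
Hypothesis sF : stepF k0 k1 F.
Hypothesis k00 : 0 <= k0.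
Hypothesis k10 : 0 <= k1.

Lemma measF_exp (h : R -> R) : measurable_fun [set: measurableTypeR R] (h : measurableTypeR R -> measurableTypeR R) ->
  meas_C (fun g => (expR (h (F g)))%:E).
Proof.
move=> mh; apply: (@fcont_meas_C _ _ F (fun x => (expR (h x))%:E) cF).
by apply/measurable_EFinP; apply: measurableT_comp.
Qed.

(** For fixed [u] the exponent is bounded by a quadratic in [w] with linear part [b], which
    integrates explicitly; then [fro b <= k0 + k1 * fro g] leaves an exponential moment of the
    squared norm of [u]. The factor 2 in [q] comes from (1 - a)^-1 <= 2. *)
Lemma step_mgf mu c s : 0 <= mu -> c ^+ 2 + s ^+ 2 = 1 ->
  let a := mu * s ^+ 2 in let q := 2 * (mu * c * s) ^+ 2 in
  a <= 2^-1 -> q * k1 <= 2^-1 ->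
  (EG (2 * n) (fun u => EG (2 * n) (fun w =>
     (expR (mu * (F (c%:CR *: cvec_of n u + s%:CR *: cvec_of n w) - F (cvec_of n u))))%:E))
  <= (expR (2 * n%:R * a + q * k0 + 2 * n%:R * (q * k1)))%:E)%E.
Proof.
move=> mu0 cs a q a1 q1.
have a0 : 0 <= a by rewrite mulr_ge0 ?sqr_ge0.
have q0 : 0 <= q by rewrite mulr_ge0 ?sqr_ge0.
have inner_bound u : (EG (2 * n) (fun w =>
     (expR (mu * (F (c%:CR *: cvec_of n u + s%:CR *: cvec_of n w) - F (cvec_of n u))))%:E)
   <= (expR (2 * n%:R * a + q * k0))%:E * (expR (q * k1 * fro (cvec_of n u)))%:E)%E.
  have [b [hb sb]] := sF (cvec_of n u).
  pose b' : 'cV[C]_n := (mu * c * s)%:CR *: b.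
  apply: (@le_trans _ _ (EG (2 * n) (fun w => (expR (a * fro (cvec_of n w) + 2 * fdot b' (cvec_of n w)))%:E))).
    apply: le_itI => [w|w _]; first by rewrite lee_fin expR_ge0.
    rewrite lee_fin ler_expR /b' fdot_scaleRl.
    have := ler_wpM2l mu0 (sb (cvec_of n w) c s cs).
    move: (fro _) (fdot _ _) (F _) (F (cvec_of n u)) => X Y Z W.
    by rewrite /a !mulrDr mulrN; lra.
  rewrite EG_expC; last by lra.
  rewrite -EFinM lee_fin -expRD -addrA expRD.
  apply: ler_pM; rewrite ?expR_ge0 ?exprn_ge0 ?invr_ge0 //; first by lra.
    apply: (le_trans (_ : _ <= expR (2 * a) ^+ n)).
      by rewrite lerXn2r ?nnegrE ?expR_ge0 ?inv1m_le ?a0 // invr_ge0; lra.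
    by rewrite -expRM_natr le_eqVlt; apply/orP; left; apply/eqP; congr expR; ring.
  rewrite ler_expR /b' fro_scaleR.
  have i2 : (1 - a)^-1 <= 2.
    have p : 0 < 1 - a by lra.
    by rewrite -(ler_pM2l p) mulfV ?gt_eqF //; lra.
  have fb := fro_ge0 b.
  apply: (@le_trans _ _ ((mu * c * s) ^+ 2 * fro b * 2)).
    by rewrite ler_wpM2l // mulr_ge0 // sqr_ge0.
  have -> : q * k0 + q * k1 * fro (cvec_of n u) = q * (k0 + k1 * fro (cvec_of n u)) by ring.
  have -> : (mu * c * s) ^+ 2 * fro b * 2 = q * fro b by rewrite /q; ring.
  by rewrite ler_wpM2l.
apply: (@le_trans _ _ (EG (2 * n) (fun u => (expR (2 * n%:R * a + q * k0))%:E * (expR (q * k1 * fro (cvec_of n u)))%:E)%E)).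
  by apply: le_itI => [u|u _]; [apply: itI_ge0 => w; rewrite lee_fin expR_ge0 | exact: inner_bound].
rewrite /EG itI_Z; last 3 first.
- apply: (@fcont_meas_C _ _ (@fro R n 1) (fun x => (expR (q * k1 * x))%:E) (@fro_continuous n)).
  by apply/measurable_EFinP; apply: measurableT_comp => //; exact: measurable_funM.
- by move=> v; rewrite lee_fin expR_ge0.
- by rewrite lee_fin expR_ge0.
rewrite (expRD (2 * n%:R * a + q * k0)) EFinM lee_pmul2l ?lte_fin ?expR_gt0 //.
by apply: EG_exp_fro; rewrite q1 mulr_ge0.
Qed.

End MGF.

(** * Subdivision of an arc into small rotations *)

Section Path.
Context {R : realType}.
Local Notation C := (R[i]).
Local Notation "a %:CR" := (Complex a 0) (at level 2, format "a %:CR").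

Lemma expR_mean N (a : 'I_N.+1 -> R) :
  expR (N.+1%:R^-1 * \sum_j a j) <= N.+1%:R^-1 * \sum_j expR (a j).
Proof.
set m := _ * \sum_j a j.
have N0 : (0 : R) < N.+1%:R by rewrite ltr0n.
rewrite -(ler_pM2l N0) mulrA mulfV ?mul1r ?gt_eqF //.
apply: (@le_trans _ _ (\sum_j (expR m * (1 + (a j - m))))); last first.
  apply: ler_sum => j _; rewrite -[leRHS](_ : expR m * expR (a j - m) = _); last first.
    by rewrite -expRD; congr expR; ring.
  by rewrite ler_pM2l ?expR_gt0 // expR_ge1Dx.
rewrite -mulr_sumr big_split /= sumrB !sumr_const !card_ord -mulr_natr mul1r.
have -> : \sum_j a j = N.+1%:R * m by rewrite /m mulrA mulfV ?mul1r ?gt_eqF.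
by rewrite le_eqVlt; apply/orP; left; apply/eqP; rewrite -[m *+ _]mulr_natr; ring.
Qed.

Lemma measurable_EFin_id : measurable_fun [set: measurableTypeR R] (EFin : measurableTypeR R -> \bar R).
Proof. by apply/measurable_EFinP; exact: measurable_id. Qed.

Lemma EG_sum k N (f : 'I_N -> Om R -> \bar R) : (forall j, measurable_fun setT (f j)) ->
  (forall j v, (0 <= f j v)%E) ->
  EG k (fun v => (\sum_j f j v)%E) = (\sum_j EG k (f j))%E.
Proof.
elim: N f => [|N IH] f mf f0.
  by rewrite big_ord0 /EG (@eq_itI _ _ _ _ (fun=> 0%E)) ?itI_cst // => v _; rewrite big_ord0.
rewrite big_ord_recl -IH // /EG -itI_D //.
- by apply: eq_itI => v _; rewrite big_ord_recl.
- exact: emeasurable_sum.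
- by move=> v; apply: sume_ge0.
Qed.

Definition GX n s (v : seq R) (x : 'cV[C]_s) : 'cV[C]_n := mat (cvec_of (n * s) v) *m x.

Lemma measurable_FGX n s (F : 'cV[C]_n -> R) (x : 'cV[C]_s) : fcontinuous F ->
  measurable_fun setT (fun v : Om R => F (GX n v x) : measurableTypeR R).
Proof.
move=> cF; apply/measurable_EFinP.
have := @meas_C_mul R _ _ (applymx n x) (fun g => (F g)%:E) (@fcont_meas_C R n F EFin cF measurable_EFin_id).
by rewrite /meas_C => h; under eq_fun do rewrite /GX -applymx_mul.
Qed.

Lemma measurable_FGXdiff n s (F : 'cV[C]_n -> R) (x y : 'cV[C]_s) (l : R) : fcontinuous F ->
  measurable_fun setT (fun v : Om R => (expR (l * (F (GX n v x) - F (GX n v y))))%:E).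
Proof.
move=> cF; apply/measurable_EFinP; apply: measurableT_comp => //; apply: measurable_funM => //.
by apply: measurable_funB; exact: measurable_FGX.
Qed.

Section rot.
Variables (s : nat) (x x' : 'cV[C]_s).
Hypothesis xx' : orthopair x x'.

Definition rotv (t : R) : 'cV[C]_s := (cos t)%:CR *: x + (sin t)%:CR *: x'.
Definition rotv' (t : R) : 'cV[C]_s := (- sin t)%:CR *: x + (cos t)%:CR *: x'.

Lemma rotv_add t e : rotv (t + e) = (cos e)%:CR *: rotv t + (sin e)%:CR *: rotv' t.
Proof.
rewrite /rotv /rotv' cosD sinD !scalerDr !scalerA addrACA -!scalerDl.
by congr (_ *: _ + _ *: _); apply: complex_ext => /=; ring.
Qed.

Lemma fdot_orth : fdot x x' = 0.
Proof. by have [_ _ h] := xx'; rewrite -inner_re h. Qed.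

Lemma rotv_orthopair t : orthopair (rotv t) (rotv' t).
Proof.
have [x1 x1' xy] := xx'.
have cs := cos2Dsin2 t.
split.
- by rewrite /rotv fro_comb x1 x1' fdot_orth mulr0 addr0 !mulr1.
- by rewrite /rotv' fro_comb x1 x1' fdot_orth mulr0 addr0 !mulr1 sqrrN addrC.
- rewrite /rotv /rotv' inner_Dl !inner_Dr !inner_scaleR !innerxx x1 x1' xy -(inner_conj x x') xy rmorph0 !mulr0.
  by apply: complex_ext => /=; ring.
Qed.

End rot.

Section path.
Variables (n : nat) (k0 k1 : R) (F : 'cV[C]_n -> R).
Hypothesis cF : fcontinuous F.
Hypothesis sF : stepF k0 k1 F.
Hypothesis k00 : 0 <= k0.
Hypothesis k10 : 0 <= k1.

Lemma pair_mgf s (x y : 'cV[C]_s) mu (c e : R) : orthopair x y -> 0 <= mu -> c ^+ 2 + e ^+ 2 = 1 ->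
  let a := mu * e ^+ 2 in let q := 2 * (mu * c * e) ^+ 2 in
  a <= 2^-1 -> q * k1 <= 2^-1 ->
  (EG (2 * (n * s)) (fun v => (expR (mu * (F (GX n v (c%:CR *: x + e%:CR *: y)) - F (GX n v x))))%:E)
   <= (expR (2 * n%:R * a + q * k0 + 2 * n%:R * (q * k1)))%:E)%E.
Proof.
move=> xy mu0 cs a q a1 q1.
apply: le_trans (step_mgf sF k10 mu0 cs a1 q1).
pose P (z : 'cV[C]_(n + n)) : \bar R := (expR (mu * (F (c%:CR *: usubmx z + e%:CR *: dsubmx z) - F (usubmx z))))%:E.
have mP : meas_C P.
  rewrite /meas_C /P; apply/measurable_EFinP; apply: measurableT_comp => //; apply: measurable_funM => //.
  have mEF (B : 'M[C]_(n, n + n)) : measurable_fun setT (fun v : Om R => F (B *m cvec_of (n + n) v)).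
    apply/measurable_EFinP.
    exact: (@meas_C_mul R _ _ B (fun g => (F g)%:E) (@fcont_meas_C R n F EFin cF measurable_EFin_id)).
  apply: measurable_funB.
    have := mEF (row_mx c%:CR%:M e%:CR%:M).
    by under eq_fun => v do rewrite -{1}[cvec_of _ _]vsubmxK mul_row_col !mul_scalar_mx.
  have := mEF (row_mx 1%:M 0).
  by under eq_fun => v do rewrite -{1}[cvec_of _ _]vsubmxK mul_row_col mul1mx mul0mx addr0.
rewrite le_eqVlt; apply/orP; left; apply/eqP.
transitivity (EG (2 * n) (fun u => EG (2 * n) (fun w => P (col_mx (cvec_of n u) (cvec_of n w))))).
  rewrite -(EG_pair xy mP) => [|z]; last by rewrite lee_fin expR_ge0.
  apply: eq_itI => v _; rewrite /P col_mxKu col_mxKd /GX mulmxDr.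
  by rewrite -!scalemxAr.
by apply: eq_itI => u _; apply: eq_itI => w _; rewrite /P col_mxKu col_mxKd.
Qed.

(** The increment along the arc telescopes into N + 1 pieces, and convexity of exp bounds the
    exponential of their sum by the average of exponentials of N + 1 times each piece. Hence [mu]:
    then [a] is O(1 / N) while [q] stays near 2 lam^2 phi^2. All pieces satisfy the same bound, each
    being the same small rotation of some orthonormal pair. *)
Lemma path_mgf s (x x' : 'cV[C]_s) lam phi N : orthopair x x' -> 0 <= lam ->
  let eps := phi / N.+1%:R in let mu := N.+1%:R * lam in
  let a := mu * (sin eps) ^+ 2 in let q := 2 * (mu * cos eps * sin eps) ^+ 2 in
  a <= 2^-1 -> q * k1 <= 2^-1 ->
  (EG (2 * (n * s)) (fun v => (expR (lam * (F (GX n v (rotv x x' phi)) - F (GX n v x))))%:E)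
   <= (expR (2 * n%:R * a + q * k0 + 2 * n%:R * (q * k1)))%:E)%E.
Proof.
move=> xx' l0 eps mu a q a1 q1.
have N0 : (0 : R) < N.+1%:R by rewrite ltr0n.
have mu0 : 0 <= mu by rewrite mulr_ge0 // ltW.
pose w j := rotv x x' (j%:R * eps).
pose del v (j : 'I_N.+1) := F (GX n v (w j.+1)) - F (GX n v (w j)).
have wN : w N.+1 = rotv x x' phi by rewrite /w /eps mulrC divfK // gt_eqF.
have w0 : w 0%N = x.
  by rewrite /w mul0r /rotv cos0 sin0 scale1r scale0r addr0.
have tele v : F (GX n v (rotv x x' phi)) - F (GX n v x) = \sum_j del v j.
  rewrite /del -wN -{1}w0.
  rewrite -(big_mkord predT (fun j => F (GX n v (w j.+1)) - F (GX n v (w j)))).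
  by rewrite telescope_sumr // w0.
apply: (@le_trans _ _ (EG (2 * (n * s)) (fun v => (N.+1%:R^-1)%:E * (\sum_j (expR (mu * del v j))%:E))%E)).
  apply: le_itI => [v|v _]; first by rewrite lee_fin expR_ge0.
  rewrite sumEFin -EFinM lee_fin tele.
  apply: le_trans (expR_mean _); rewrite ler_expR -mulr_sumr /mu !mulrA mulVf ?mul1r // gt_eqF.
rewrite /EG itI_Z; last 3 first.
- by apply: emeasurable_sum => j; exact: measurable_FGXdiff.
- by move=> v; apply: sume_ge0 => j _; rewrite lee_fin expR_ge0.
- by rewrite lee_fin invr_ge0 ltW.
rewrite -/(EG _) (@EG_sum _ _ (fun (j : 'I_N.+1) v => (expR (mu * del v j))%:E)); last 2 first.
- by move=> j; exact: measurable_FGXdiff.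
- by move=> j v; rewrite lee_fin expR_ge0.
apply: (@le_trans _ _ ((N.+1%:R^-1)%:E * \sum_(j < N.+1) (expR (2 * n%:R * a + q * k0 + 2 * n%:R * (q * k1)))%:E)%E).
  rewrite lee_wpmul2l ?lee_fin ?invr_ge0 ?(ltW N0) //; apply: lee_sum => j _.
  have hE v : del v j = F (GX n v ((cos eps)%:CR *: w j + (sin eps)%:CR *: rotv' x x' (j%:R * eps))) - F (GX n v (w j)).
    by rewrite /del /w -natr1 mulrDl mul1r rotv_add.
  (under eq_fun do rewrite hE).
  apply: pair_mgf => //; first exact: rotv_orthopair.
  exact: cos2Dsin2.
rewrite sumEFin -EFinM lee_fin sumr_const card_ord; move: (expR _) => B.
by rewrite -[X in _ * X <= _]mulr_natl mulrA mulVf ?mul1r ?gt_eqF.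
Qed.

Lemma abs_sin_le (t : R) : 0 <= t -> `|sin t| <= t.
Proof.
move=> t0.
have [->|tn0] := eqVneq t 0; first by rewrite sin0 normr0.
have tp : 0 < t by rewrite lt_neqAle eq_sym tn0.
have [|c hc] := @MVT R sin cos 0 t tp (fun y _ => is_derive_sin y).
  by apply: continuous_subspaceT; exact: continuous_sin.
rewrite sin0 !subr0 => ->; rewrite normrM (ger0_norm t0) ler_piMl //.
exact: cos_max.
Qed.

Lemma path_mgf_lim s (x x' : 'cV[C]_s) lam phi eta : orthopair x x' -> 0 <= lam -> 0 <= phi -> 0 < eta ->
  2 * lam ^+ 2 * phi ^+ 2 * k1 <= 2^-1 ->
  (EG (2 * (n * s)) (fun v => (expR (lam * (F (GX n v (rotv x x' phi)) - F (GX n v x))))%:E)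
   <= (expR (2 * lam ^+ 2 * phi ^+ 2 * (k0 + 2 * n%:R * k1) + eta))%:E)%E.
Proof.
move=> xx' l0 p0 e0 hk.
(* The two summands secure [a <= 2^-1] and [2 * n%:R * a <= eta] respectively. *)
pose T := lam * phi ^+ 2 * (2 + 2 * n%:R / eta).
have [N hN] : exists N : nat, T <= N.+1%:R.
  by exists (Num.truncn T); rewrite ltW // truncnS_gt.
have N0 : (0 : R) < N.+1%:R by rewrite ltr0n.
pose eps := phi / N.+1%:R.
have ep0 : 0 <= eps by rewrite divr_ge0 // ltW.
have se : (sin eps) ^+ 2 <= eps ^+ 2.
  by rewrite -real_normK ?num_real // lerXn2r ?nnegrE ?normr_ge0 // abs_sin_le.
have ce : (cos eps) ^+ 2 <= 1 by have := cos2Dsin2 eps; have := sqr_ge0 (sin eps); lra.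
have lp0 : 0 <= lam * phi ^+ 2 by rewrite mulr_ge0 ?sqr_ge0.
set a := N.+1%:R * lam * (sin eps) ^+ 2.
set q := 2 * (N.+1%:R * lam * cos eps * sin eps) ^+ 2.
have ha : a <= lam * phi ^+ 2 / N.+1%:R.
  apply: (@le_trans _ _ (N.+1%:R * lam * eps ^+ 2)); first by rewrite ler_wpM2l // mulr_ge0 // ltW.
  by rewrite /eps le_eqVlt; apply/orP; left; apply/eqP; field; rewrite gt_eqF.
have hq : q <= 2 * lam ^+ 2 * phi ^+ 2.
  have -> : q = 2 * (N.+1%:R ^+ 2 * lam ^+ 2 * ((cos eps) ^+ 2 * (sin eps) ^+ 2)) by rewrite /q; ring.
  have -> : 2 * lam ^+ 2 * phi ^+ 2 = 2 * (N.+1%:R ^+ 2 * lam ^+ 2 * (1 * eps ^+ 2)).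
    by rewrite /eps; field; rewrite gt_eqF.
  rewrite ler_wpM2l // ler_wpM2l ?mulr_ge0 ?sqr_ge0 //.
  by apply: ler_pM; rewrite ?sqr_ge0.
have hT : lam * phi ^+ 2 / N.+1%:R * (2 + 2 * n%:R / eta) <= 1.
  by rewrite mulrAC ler_pdivrMr // mul1r.
have u0 : 0 <= lam * phi ^+ 2 / N.+1%:R by rewrite divr_ge0 // ltW.
have v0 : 0 <= 2 * n%:R / eta by rewrite divr_ge0 ?mulr_ge0 // ltW.
move: (lam * phi ^+ 2 / N.+1%:R) ha hT u0 => u ha hT u0.
have a1 : a <= 2^-1 by nra.
have q1 : q * k1 <= 2^-1 by apply: le_trans hk; rewrite ler_wpM2r.
apply: (le_trans (path_mgf xx' l0 a1 q1)).
rewrite lee_fin ler_expR -/eps -/a -/q.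
have na : 2 * n%:R * a <= eta.
  apply: (@le_trans _ _ (2 * n%:R * u)); first by rewrite ler_wpM2l // mulr_ge0.
  have : u * (2 * n%:R / eta) <= 1 by nra.
  by rewrite mulrA ler_pdivrMr // mul1r mulrC.
have -> : 2 * n%:R * a + q * k0 + 2 * n%:R * (q * k1) = 2 * n%:R * a + q * (k0 + 2 * n%:R * k1) by ring.
rewrite addrC lerD // ler_wpM2r // addr_ge0 // !mulr_ge0 //.
Qed.

End path.
End Path.

(** * Increments between unit vectors, and deviations from the mean *)

Section GenMgf.
Context {R : realType}.
Local Notation C := (R[i]).
Local Notation "a %:CR" := (Complex a 0) (at level 2, format "a %:CR").

Lemma one_sub_cos (t : R) : 1 - cos t = 2 * (sin (t / 2)) ^+ 2.
Proof.
have := cosD (t / 2) (t / 2); rewrite (_ : t / 2 + t / 2 = t) => [->|]; last by field.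
by have := cos2Dsin2 (t / 2); rewrite -!expr2; lra.
Qed.

Lemma sin_half_le (t : R) : 0 <= t -> t <= 1 -> t / 2 <= sin t.
Proof.
move=> t0 t1.
have [->|tn0] := eqVneq t 0; first by rewrite sin0 mul0r.
have tp : 0 < t by rewrite lt_neqAle eq_sym tn0.
have [|c hc] := @MVT R sin cos 0 t tp (fun y _ => is_derive_sin y).
  by apply: continuous_subspaceT; exact: continuous_sin.
rewrite sin0 !subr0 => ->; rewrite mulrC ler_pM2r //.
move: hc; rewrite in_itv /= => /andP[c0 c1].
have := one_sub_cos c.
have h : `|sin (c / 2)| <= c / 2 by apply: abs_sin_le; rewrite divr_ge0 // ltW.
have : (sin (c / 2)) ^+ 2 <= (c / 2) ^+ 2.
  by rewrite -real_normK ?num_real // lerXn2r ?nnegrE ?normr_ge0 // divr_ge0 // ltW.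
have : (c / 2) ^+ 2 <= 2^-1 ^+ 2 by rewrite lerXn2r ?nnegrE //; lra.
rewrite expr2; lra.
Qed.

Lemma sqr_le_one_sub_cos (t : R) : 0 <= t <= pi / 2 -> t ^+ 2 <= 8 * (1 - cos t).
Proof.
move=> /andP[t0 t1]; rewrite one_sub_cos.
have h2 : t / 2 <= 1 by have := pihalf_lt2 R; lra.
have h : t / 2 / 2 <= sin (t / 2) by apply: sin_half_le => //; lra.
have : (t / 2 / 2) ^+ 2 <= (sin (t / 2)) ^+ 2 by rewrite lerXn2r ?nnegrE //; lra.
by rewrite !expr2; lra.
Qed.

Definition phase_inv n (F : 'cV[C]_n -> R) := forall w g, nsq w = 1 -> F (w *: g) = F g.

Lemma GX_scale n s v (w : C) (x : 'cV[C]_s) : GX n v (w *: x) = w *: GX n v x.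
Proof. by rewrite /GX -scalemxAr. Qed.

Lemma nsqM (z w : C) : nsq (z * w) = nsq z * nsq w.
Proof. by case: z => a b; case: w => c e; rewrite /nsq /=; ring. Qed.

Lemma fro_scaleC m n (X : 'M[C]_(m, n)) (w : C) : fro (w *: X) = nsq w * fro X.
Proof.
rewrite /fro mulr_sumr; apply: eq_bigr => i _; rewrite /rn mulr_sumr; apply: eq_bigr => j _.
by rewrite mxE nsqM.
Qed.

Lemma nsq_eq0 (z : C) : nsq z = 0 -> z = 0.
Proof.
move=> h; have h1 : complex.Re z ^+ 2 = 0 by apply/eqP; rewrite eq_le sqr_ge0 andbT -h lerDl sqr_ge0.
have h2 : complex.Im z ^+ 2 = 0 by apply/eqP; rewrite eq_le sqr_ge0 andbT -h lerDr sqr_ge0.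
by apply: complex_ext; apply/eqP; rewrite -sqrf_eq0 ?h1 ?h2.
Qed.

Lemma fro_eq0 n (x : 'cV[C]_n) : fro x = 0 -> x = 0.
Proof.
rewrite fro_col => /psumr_eq0P h; apply/matrixP => i j; rewrite ord1 mxE.
by apply: nsq_eq0; apply: h => // l _; exact: nsq_ge0.
Qed.

(** A phase does not change the functional, and the right one makes the inner product real and
    nonnegative; then the two vectors span a real arc and their distance has not grown. *)
Lemma align_phase s (x y : 'cV[C]_s) : exists w c, [/\ nsq w = 1, inner (w *: y) x = c%:CR, 0 <= c
   & fdot y x <= c].
Proof.
set z := inner y x; have rz : fdot y x = complex.Re z by rewrite inner_re.
have [z0|zn0] := eqVneq (nsq z) 0.
  exists 1, 0; split => //.
  - by rewrite /nsq /= expr1n expr0n addr0.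
  - by rewrite scale1r -/z (nsq_eq0 z0).
  - by rewrite rz (nsq_eq0 z0).
have zp : 0 < nsq z by rewrite lt_neqAle eq_sym zn0 nsq_ge0.
pose r := Num.sqrt (nsq z).
have rp : 0 < r by rewrite sqrtr_gt0.
have r2 : r ^+ 2 = nsq z by rewrite sqr_sqrtr // ltW.
exists (r^-1%:CR * Num.conj z), r; split; last first.
- rewrite rz; apply: (@le_trans _ _ `|complex.Re z|); first exact: ler_norm.
  by rewrite -sqrtr_sqr ler_wsqrtr // lerDl sqr_ge0.
- exact: ltW.
- have -> : inner ((r^-1%:CR * Num.conj z) *: y) x = (r^-1%:CR * Num.conj z) * z.
    by rewrite -[in LHS](scale1r x) inner_scaleR rmorph1 mulr1.
  have zz : Num.conj z * z = (nsq z)%:CR.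
    by case: (z) => a b; rewrite /nsq; apply: complex_ext => /=; ring.
  rewrite -mulrA zz; apply: complex_ext => /=; last by ring.
  by rewrite mul0r subr0 -r2; field; rewrite gt_eqF.
- rewrite nsqM.
  have -> : nsq (Num.conj z) = nsq z by rewrite /nsq re_conj im_conj sqrrN.
  rewrite {1}/nsq /= expr0n addr0 -r2; field.
  by rewrite gt_eqF.
Qed.

Section gen.
Variables (n : nat) (F : 'cV[C]_n -> R).
Hypothesis cF : fcontinuous F.
Hypothesis sF : stepF 0 1 F.
Hypothesis pF : phase_inv F.
Hypothesis n0 : (0 < n)%N.

(** After alignment, [y] lies on an arc from [x] of angle phi <= pi / 2 with phi^2 <= 8 (1 - cos
    phi) <= 4 rho^2. The arc bound 4 n lam^2 phi^2 is then at most 16 n lam^2 rho^2, and the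
    seventeenth unit is the [eta] of [path_mgf_lim]. *)
Lemma gen_mgf s (x y : 'cV[C]_s) lam rho : fro x = 1 -> fro y = 1 -> 0 < lam -> 0 < rho ->
  fro (y - x) <= rho ^+ 2 -> lam * rho <= 4^-1 ->
  (EG (2 * (n * s)) (fun v => (expR (lam * (F (GX n v y) - F (GX n v x))))%:E)
   <= (expR (17 * n%:R * lam ^+ 2 * rho ^+ 2))%:E)%E.
Proof.
move=> x1 y1 l0 r0 hr hlr.
have [w [c [w1 hc c0 dc]]] := align_phase x y.
set y' := w *: y.
have Fy v : F (GX n v y) = F (GX n v y') by rewrite /y' GX_scale pF.
have y'1 : fro y' = 1 by rewrite /y' fro_scaleC w1 mul1r.
have fd : fdot y' x = c by rewrite -inner_re hc.
have fB (u v : 'cV[C]_s) : fro (u - v) = fro u + fro v - 2 * fdot u v.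
  have -> : u - v = 1%:CR *: u + (-1)%:CR *: v.
    rewrite Complex1E scale1r; congr (_ + _); apply/matrixP => i j; rewrite !mxE -[LHS]mulN1r.
    by congr (_ * _); apply: complex_ext => //=; rewrite oppr0.
  by rewrite fro_comb; ring.
have fy' : fro (y' - x) = 2 - 2 * c by rewrite fB y'1 x1 fd; ring.
have hy' : 2 - 2 * c <= rho ^+ 2.
  by move: hr; rewrite fB x1 y1 => h; lra.
have c1 : c <= 1 by have := fro_ge0 (y' - x); rewrite fy'; lra.
have nR : (0 : R) < n%:R by rewrite ltr0n.
have lr0 : 0 < n%:R * lam ^+ 2 * rho ^+ 2 by rewrite !mulr_gt0 // exprn_gt0.
(* When the aligned vectors coincide there is no direction [x'] to normalise, but the increment
   vanishes. *)
have [cE|cn1] := eqVneq c 1.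
  have y'x : y' = x by apply/eqP; rewrite -subr_eq0; apply/eqP/fro_eq0; rewrite fy' cE; ring.
  under eq_fun do rewrite Fy y'x subrr mulr0 expR0.
  rewrite /EG itI_cst // lee_fin -[X in X <= _]expR0 ler_expR.
  by rewrite (_ : 17 * n%:R * lam ^+ 2 * rho ^+ 2 = 17 * (n%:R * lam ^+ 2 * rho ^+ 2)); [rewrite mulr_ge0 // ltW | ring].
have cI : c \in `[-1, 1] by rewrite in_itv /=; apply/andP; split; lra.
pose phi := acos c.
have cphi : cos phi = c by rewrite /phi acosK.
have ph0 : 0 <= phi by apply: acos_ge0; move: cI; rewrite in_itv.
have phpi : phi <= pi by apply: acos_lepi; move: cI; rewrite in_itv.
have ph2 : phi <= pi / 2.
  rewrite leNgt; apply/negP => h.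
  have p0 : 0 <= pi / 2 :> R by rewrite divr_ge0 // pi_ge0.
  have : cos phi < cos (pi / 2).
    rewrite ltr_cos // in_itv /= ?ph0 ?phpi ?p0 //=.
    by rewrite ler_pdivrMr // ler_peMr // ?pi_ge0 // ler1n.
  by rewrite cos_pihalf cphi ltNge c0.
have s2 : sin phi ^+ 2 = 1 - c ^+ 2 by rewrite -(cos2Dsin2 phi) cphi; ring.
have sn0 : sin phi != 0.
  rewrite -sqrf_eq0 s2 (_ : 1 - c ^+ 2 = (1 - c) * (1 + c)); last by ring.
  by rewrite mulf_neq0 // gt_eqF //; [have := cn1; rewrite neq_lt => /orP[]|]; lra.
pose x' := (sin phi)^-1%:CR *: y' + (- (sin phi)^-1 * c)%:CR *: x.
have iy'x : inner y' x = c%:CR by exact: hc.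
have ixy' : inner x y' = c%:CR.
  by rewrite -(inner_conj y' x) iy'x; apply: complex_ext => //=; rewrite oppr0.
have op : orthopair x x'.
  split => //.
    rewrite /x' fro_comb y'1 x1 fd.
    transitivity ((sin phi)^-1 ^+ 2 * (1 - c ^+ 2)); first by ring.
    by rewrite -s2 exprVn mulVf // sqrf_eq0.
  rewrite /x' inner_Dr -{1}(scale1r x) inner_scaleR ixy' -{1}(scale1r x) inner_scaleR innerxx x1.
  by apply: complex_ext => /=; ring.
have rE : rotv x x' phi = y'.
  rewrite /rotv /x' cphi scalerDr !scalerA addrCA -scalerDl.
  have -> : (sin phi)%:CR * (sin phi)^-1%:CR = 1.
    by apply: complex_ext => /=; rewrite ?mul0r ?mulr0 ?subr0 ?addr0 // mulfV.
  have -> : c%:CR + (sin phi)%:CR * (- (sin phi)^-1 * c)%:CR = 0.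
    apply: complex_ext => /=; last by ring.
    by rewrite mul0r subr0 mulrA mulrN mulfV // mulN1r subrr.
  by rewrite mul1r scale0r addr0.
under eq_fun do rewrite Fy -rE.
have p8 : phi ^+ 2 <= 8 * (1 - c) by rewrite -cphi; apply: sqr_le_one_sub_cos; rewrite ph0.
have p4 : phi ^+ 2 <= 4 * rho ^+ 2 by lra.
have lr2 : lam ^+ 2 * rho ^+ 2 <= 16^-1.
  rewrite -exprMn; apply: (@le_trans _ _ (4^-1 ^+ 2)); last by rewrite expr2; lra.
  by rewrite lerXn2r ?nnegrE // mulr_ge0 // ltW.
have l2 : 0 <= lam ^+ 2 by exact: sqr_ge0.
have lp : lam ^+ 2 * phi ^+ 2 <= 4 * (lam ^+ 2 * rho ^+ 2) by nra.
have ck : 2 * lam ^+ 2 * phi ^+ 2 * 1 <= 2^-1 by lra.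
apply: (le_trans (path_mgf_lim cF sF (lexx 0) ler01 op (ltW l0) ph0 lr0 ck)).
rewrite lee_fin ler_expR add0r mulr1.
have := ler_wpM2l (ltW nR) lp.
by rewrite -!mulrA; lra.
Qed.

End gen.

Lemma EG_Zr k (f : seq R -> R) (c : R) : measurable_fun setT (fun v : Om R => (f v)%:E) ->
  (forall v, 0 <= f v) -> 0 <= c ->
  EG k (fun v => (c * f v)%:E) = (c%:E * EG k (fun v => (f v)%:E))%E.
Proof.
by move=> mf f0 c0; rewrite /EG -itI_Z.
Qed.

Lemma EG_Dr k (f g : seq R -> R) : measurable_fun setT (fun v : Om R => (f v)%:E) ->
  measurable_fun setT (fun v : Om R => (g v)%:E) -> (forall v, 0 <= f v) -> (forall v, 0 <= g v) ->
  EG k (fun v => (f v + g v)%:E) = (EG k (fun v => (f v)%:E) + EG k (fun v => (g v)%:E))%E.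
Proof.
by move=> mf mg f0 g0; rewrite /EG -itI_D.
Qed.

Lemma EG_cst k (c : R) : 0 <= c -> EG k (fun=> c%:E) = c%:E.
Proof. by move=> c0; rewrite /EG itI_cst. Qed.

Lemma le_EG k (f g : seq R -> R) : (forall v, 0 <= f v) -> (forall v, f v <= g v) ->
  (EG k (fun v => (f v)%:E) <= EG k (fun v => (g v)%:E))%E.
Proof. by move=> f0 fg; apply: le_itI => [v|v _]; rewrite lee_fin. Qed.

Section copy.
Variables (n : nat) (k0 k1 : R) (F : 'cV[C]_n -> R).
Hypothesis cF : fcontinuous F.
Hypothesis sF : stepF k0 k1 F.
Hypothesis k00 : 0 <= k0.
Hypothesis k10 : 0 <= k1.

(** A rotation by pi / 2 from one basis vector of C^2 to the other carries a Gaussian vector into an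
    independent copy; (pi / 2)^2 <= 4 turns the factor 2 into 8. *)
Lemma copy_mgf lam eta : 0 <= lam -> 0 < eta -> 8 * lam ^+ 2 * k1 <= 2^-1 ->
  (EG (2 * n) (fun u => EG (2 * n) (fun w => (expR (lam * (F (cvec_of n w) - F (cvec_of n u))))%:E))
   <= (expR (8 * lam ^+ 2 * (k0 + 2 * n%:R * k1) + eta))%:E)%E.
Proof.
move=> l0 e0 hk.
pose x : 'cV[C]_2 := delta_mx 0 0; pose y : 'cV[C]_2 := delta_mx 1 0.
have op : orthopair x y.
  split; rewrite ?fro_col /inner !big_ord_recl big_ord0 !mxE /nsq /=.
  - by rewrite !expr1n !expr0n !addr0.
  - by rewrite !expr1n !expr0n !addr0 add0r.
  - by rewrite mulr0n rmorph0 mulr0 mul0r !addr0.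
have p2 : (pi / 2 : R) ^+ 2 <= 4.
  have /andP[a b] := pihalf_02 R.
  by rewrite -[leRHS](_ : 2 ^+ 2 = _); [rewrite lerXn2r ?nnegrE // ltW | rewrite expr2; ring].
have ph0 : 0 <= pi / 2 :> R by rewrite divr_ge0 // pi_ge0.
have l2 : 0 <= lam ^+ 2 by exact: sqr_ge0.
have lp : lam ^+ 2 * (pi / 2) ^+ 2 <= 4 * lam ^+ 2 by nra.
have ck : 2 * lam ^+ 2 * (pi / 2) ^+ 2 * k1 <= 2^-1.
  by apply: le_trans hk; rewrite ler_wpM2r // -mulrA; lra.
have rE : rotv x y (pi / 2) = y by rewrite /rotv cos_pihalf sin_pihalf scale0r add0r scale1r.
have := path_mgf_lim cF sF k00 k10 op l0 ph0 e0 ck.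
rewrite rE => h.
have kk : 0 <= k0 + 2 * n%:R * k1 by rewrite addr_ge0 // !mulr_ge0.
apply: (@le_trans _ _ (expR (2 * lam ^+ 2 * (pi / 2) ^+ 2 * (k0 + 2 * n%:R * k1) + eta))%:E); last first.
  rewrite lee_fin ler_expR lerD2r ler_wpM2r //.
  by rewrite -mulrA; lra.
apply: le_trans h.
pose P (z : 'cV[C]_(n + n)) : \bar R := (expR (lam * (F (dsubmx z) - F (usubmx z))))%:E.
have mP : meas_C P.
  rewrite /meas_C /P; apply/measurable_EFinP; apply: measurableT_comp => //; apply: measurable_funM => //.
  have mEF (B : 'M[C]_(n, n + n)) : measurable_fun setT (fun v : Om R => F (B *m cvec_of (n + n) v)).
    apply/measurable_EFinP.
    exact: (@meas_C_mul R _ _ B (fun g => (F g)%:E) (@fcont_meas_C R n F EFin cF measurable_EFin_id)).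
  apply: measurable_funB.
    have := mEF (row_mx 0 1%:M).
    by under eq_fun => v do rewrite -{1}[cvec_of _ _]vsubmxK mul_row_col mul1mx mul0mx add0r.
  have := mEF (row_mx 1%:M 0).
  by under eq_fun => v do rewrite -{1}[cvec_of _ _]vsubmxK mul_row_col mul1mx mul0mx addr0.
rewrite le_eqVlt; apply/orP; left; apply/eqP.
transitivity (EG (2 * n) (fun u => EG (2 * n) (fun w => P (col_mx (cvec_of n u) (cvec_of n w))))).
  by apply: eq_itI => u _; apply: eq_itI => w _; rewrite /P col_mxKu col_mxKd.
rewrite -(EG_pair op mP) => [|z]; last by rewrite lee_fin expR_ge0.
by apply: eq_itI => v _; rewrite /P col_mxKu col_mxKd.
Qed.

Hypothesis F0 : forall g, 0 <= F g.

Lemma measurable_F : measurable_fun setT (fun v : Om R => (F (cvec_of n v))%:E).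
Proof. exact: (@fcont_meas_C R n F EFin cF measurable_EFin_id). Qed.

Lemma measurable_expF (h : R -> R) : measurable_fun [set: measurableTypeR R] (h : measurableTypeR R -> measurableTypeR R) ->
  measurable_fun setT (fun v : Om R => (expR (h (F (cvec_of n v))))%:E).
Proof. exact: measF_exp. Qed.

Variable m : R.
Hypothesis mE : EG (2 * n) (fun v => (F (cvec_of n v))%:E) = m%:E.

Lemma mean_ge0 : 0 <= m.
Proof. by rewrite -lee_fin -mE; apply: itI_ge0 => v; rewrite lee_fin. Qed.

(** The tangent of exp at lam m, with its negative term moved to the other side, since [EG] is
    linear on nonnegative functions only. *)
Lemma jensen_exp (lam : R) : 0 <= lam ->
  ((expR (lam * m))%:E <= EG (2 * n) (fun v => (expR (lam * F (cvec_of n v)))%:E))%E.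
Proof.
move=> l0; have m0 := mean_ge0.
set X := EG _ _.
have mm (a : R) : measurable_fun [set: measurableTypeR R] (fun x : measurableTypeR R => a * x : measurableTypeR R).
  by apply: measurable_funM.
have lm0 : 0 <= expR (lam * m) * lam by rewrite mulr_ge0 ?expR_ge0.
have mX : measurable_fun setT (fun v : Om R => (expR (lam * F (cvec_of n v)))%:E) by exact: (measurable_expF (mm lam)).
have mY : measurable_fun setT (fun v : Om R => (expR (lam * m) * lam * F (cvec_of n v))%:E).
  exact: (@fcont_meas_C R n F (fun x => (expR (lam * m) * lam * x)%:E) cF (measurableT_comp measurable_EFin_id (mm _))).
have e0 v : 0 <= expR (lam * F (cvec_of n v)) by exact: expR_ge0.
have c0 : 0 <= expR (lam * m) * lam * m by rewrite mulr_ge0.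
have z0 v : 0 <= expR (lam * m) * lam * F (cvec_of n v) by rewrite mulr_ge0.
have w0 (v : seq R) : 0 <= expR (lam * m) by exact: expR_ge0.
have h : ((expR (lam * m))%:E + (expR (lam * m) * lam)%:E * m%:E <= X + (expR (lam * m) * lam * m)%:E)%E.
  rewrite -mE -(@EG_Zr _ (fun v => F (cvec_of n v))) //; last exact: measurable_F.
  rewrite -{1}(@EG_cst (2 * n) (expR (lam * m))) ?expR_ge0 // -(@EG_cst (2 * n) (expR (lam * m) * lam * m)) //.
  rewrite -(@EG_Dr _ (fun=> expR (lam * m)) (fun v => expR (lam * m) * lam * F (cvec_of n v))) //.
  rewrite /X -(@EG_Dr _ (fun v => expR (lam * F (cvec_of n v))) (fun=> expR (lam * m) * lam * m)) //.
  apply: le_EG => v; first by rewrite addr_ge0 ?expR_ge0 // mulr_ge0.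
  have -> : expR (lam * F (cvec_of n v)) = expR (lam * m) * expR (lam * F (cvec_of n v) - lam * m).
    by rewrite -expRD; congr expR; ring.
  clear w0; have := expR_ge1Dx (lam * F (cvec_of n v) - lam * m).
  by rewrite -(ler_pM2l (expR_gt0 (lam * m))) => h; lra.
by move: h; rewrite -EFinM leeD2rE.
Qed.

Lemma jensen_expN (lam : R) : 0 <= lam ->
  ((expR (- (lam * m)))%:E <= EG (2 * n) (fun v => (expR (- (lam * F (cvec_of n v))))%:E))%E.
Proof.
move=> l0; have m0 := mean_ge0.
set X := EG _ _.
have mm (a : R) : measurable_fun [set: measurableTypeR R] (fun x : measurableTypeR R => - (a * x) : measurableTypeR R).
  by apply: measurable_funN; apply: measurable_funM.
have lm0 : 0 <= expR (- (lam * m)) * lam by rewrite mulr_ge0 ?expR_ge0.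
have mX : measurable_fun setT (fun v : Om R => (expR (- (lam * F (cvec_of n v))))%:E) by exact: (measurable_expF (mm lam)).
have mY : measurable_fun setT (fun v : Om R => (expR (- (lam * m)) * lam * F (cvec_of n v))%:E).
  apply: (@fcont_meas_C R n F (fun x => (expR (- (lam * m)) * lam * x)%:E) cF).
  by apply: (measurableT_comp measurable_EFin_id); apply: measurable_funM.
have c0 : 0 <= expR (- (lam * m)) * lam * m by rewrite mulr_ge0.
have z0 v : 0 <= expR (- (lam * m)) * lam * F (cvec_of n v) by rewrite mulr_ge0.
have w0 v : 0 <= expR (- (lam * F (cvec_of n v))) by exact: expR_ge0.
have h : ((expR (- (lam * m)) + expR (- (lam * m)) * lam * m)%:E <= X + (expR (- (lam * m)) * lam)%:E * m%:E)%E.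
  rewrite -mE -(@EG_Zr _ (fun v => F (cvec_of n v))) //; last exact: measurable_F.
  rewrite -(@EG_cst (2 * n) (expR (- (lam * m)) + expR (- (lam * m)) * lam * m)) ?addr_ge0 ?expR_ge0 //.
  rewrite /X -(@EG_Dr _ (fun v => expR (- (lam * F (cvec_of n v)))) (fun v => expR (- (lam * m)) * lam * F (cvec_of n v))) //.
  apply: le_EG => v; first by rewrite addr_ge0 ?expR_ge0.
  have -> : expR (- (lam * F (cvec_of n v))) = expR (- (lam * m)) * expR (lam * m - lam * F (cvec_of n v)).
    by rewrite -expRD; congr expR; ring.
  have := expR_ge1Dx (lam * m - lam * F (cvec_of n v)).
  by rewrite -(ler_pM2l (expR_gt0 (- (lam * m)))) => h; lra.
by move: h; rewrite -EFinM EFinD leeD2rE.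
Qed.

Lemma prod_copy lam :
  EG (2 * n) (fun u => EG (2 * n) (fun w => (expR (lam * (F (cvec_of n w) - F (cvec_of n u))))%:E)) =
  (EG (2 * n) (fun u => (expR (- (lam * F (cvec_of n u))))%:E) * EG (2 * n) (fun w => (expR (lam * F (cvec_of n w)))%:E))%E.
Proof.
have mm (a : R) : measurable_fun [set: measurableTypeR R] (fun x : measurableTypeR R => a * x : measurableTypeR R).
  by apply: measurable_funM.
have mm' (a : R) : measurable_fun [set: measurableTypeR R] (fun x : measurableTypeR R => - (a * x) : measurableTypeR R).
  by apply: measurable_funN; apply: measurable_funM.
have mX := measurable_expF (mm lam); have mY := measurable_expF (mm' lam).
have [x0 y0] : (0 <= EG (2 * n) (fun w => (expR (lam * F (cvec_of n w)))%:E))%E /\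
  forall v, (0 <= (expR (- (lam * F (cvec_of n v))))%:E)%E.
  by split; [apply: itI_ge0 => v; rewrite lee_fin expR_ge0 | move=> v; rewrite lee_fin expR_ge0].
rewrite muleC -(itI_Z _ _ mY y0 x0).
apply: eq_itI => u _; rewrite muleC -(@EG_Zr _ (fun w => expR (lam * F (cvec_of n w)))) ?expR_ge0 //.
by apply: eq_itI => w _; rewrite -expRD; congr (expR _)%:E; ring.
Qed.

(** Symmetrisation: in the bound for two independent copies, Jensen's inequality replaces the factor
    of one copy by the exponential of the mean. *)
Lemma center_mgf lam eta : 0 <= lam -> 0 < eta -> 8 * lam ^+ 2 * k1 <= 2^-1 ->
  (EG (2 * n) (fun v => (expR (lam * (F (cvec_of n v) - m)))%:E)
   <= (expR (8 * lam ^+ 2 * (k0 + 2 * n%:R * k1) + eta))%:E)%E.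
Proof.
move=> l0 e0 hk; have := copy_mgf l0 e0 hk; rewrite prod_copy => h.
apply: le_trans h.
have mm (a : R) : measurable_fun [set: measurableTypeR R] (fun x : measurableTypeR R => a * x : measurableTypeR R).
  by apply: measurable_funM.
have -> : EG (2 * n) (fun v => (expR (lam * (F (cvec_of n v) - m)))%:E) =
   ((expR (- (lam * m)))%:E * EG (2 * n) (fun w => (expR (lam * F (cvec_of n w)))%:E))%E.
  rewrite -(@EG_Zr _ (fun w => expR (lam * F (cvec_of n w)))) ?expR_ge0 //; last exact: (measurable_expF (mm lam)).
  by apply: eq_itI => v _; rewrite -expRD; congr (expR _)%:E; ring.
rewrite lee_wpmul2r //; last exact: jensen_expN.
by apply: itI_ge0 => v; rewrite lee_fin expR_ge0.
Qed.

Lemma center_mgfN lam eta : 0 <= lam -> 0 < eta -> 8 * lam ^+ 2 * k1 <= 2^-1 ->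
  (EG (2 * n) (fun v => (expR (lam * (m - F (cvec_of n v))))%:E)
   <= (expR (8 * lam ^+ 2 * (k0 + 2 * n%:R * k1) + eta))%:E)%E.
Proof.
move=> l0 e0 hk; have := copy_mgf l0 e0 hk; rewrite prod_copy => h.
apply: le_trans h.
have mm' (a : R) : measurable_fun [set: measurableTypeR R] (fun x : measurableTypeR R => - (a * x) : measurableTypeR R).
  by apply: measurable_funN; apply: measurable_funM.
have -> : EG (2 * n) (fun v => (expR (lam * (m - F (cvec_of n v))))%:E) =
   (EG (2 * n) (fun w => (expR (- (lam * F (cvec_of n w))))%:E) * (expR (lam * m))%:E)%E.
  rewrite muleC -(@EG_Zr _ (fun w => expR (- (lam * F (cvec_of n w))))) ?expR_ge0 //; last exact: (measurable_expF (mm' lam)).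
  by apply: eq_itI => v _; rewrite -expRD; congr (expR _)%:E; ring.
rewrite lee_wpmul2l //; last exact: jensen_exp.
by apply: itI_ge0 => v; rewrite lee_fin expR_ge0.
Qed.

End copy.
End GenMgf.

(** * A lattice net of the unit ball of C^s *)

Section Net.
Context {R : realType}.
Local Notation C := (R[i]).
Local Notation "a %:CR" := (Complex a 0) (at level 2, format "a %:CR").
Variable s : nat.
Hypothesis s0 : (0 < s)%N.
Let D := (2 * s)%N.

Definition netT := {ffun 'I_s * bool -> bool * 'I_(2 * D).+1}.
(** With [D] real coordinates, an error of [mesh] in each gives squared distance D mesh^2 = 1/4, the
    contraction that [net_chain] iterates. *)
Definition mesh : R := (2 * Num.sqrt D%:R)^-1.
Definition net_coord (c : bool * 'I_(2 * D).+1) : R := (-1) ^+ c.1 * (c.2%:R * mesh).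
Definition net_vec (m : netT) : 'cV[C]_s := \col_i Complex (net_coord (m (i, false))) (net_coord (m (i, true))).
(** The sum of the integer multiples is bounded, rather than the Euclidean norm: roundings of points
    of the ball satisfy it, and it makes the count elementary. *)
Definition net : {pred netT} := [pred m : netT | (\sum_j (m j).2 <= 2 * D)%N].

Let D0 : (0 : R) < D%:R. Proof. by rewrite ltr0n muln_gt0. Qed.
Let sD0 : 0 < Num.sqrt (D%:R : R). Proof. by rewrite sqrtr_gt0. Qed.
Let sD2 : Num.sqrt (D%:R : R) ^+ 2 = D%:R. Proof. by rewrite sqr_sqrtr // ltW. Qed.

Lemma mesh_gt0 : 0 < mesh. Proof. by rewrite invr_gt0 mulr_gt0. Qed.
Lemma mesh2 : mesh ^+ 2 * D%:R = 4^-1.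
Proof. by rewrite /mesh exprVn exprMn sD2; field; rewrite gt_eqF. Qed.

(** Rounding towards zero gives a multiple k <= 2 sqrt D |y|, and this is at most 1 + D y^2 by the
    inequality of means; over all coordinates these bounds sum to at most 2 D. *)
Lemma round_coord (y : R) : y ^+ 2 <= 1 -> exists c : bool * 'I_(2 * D).+1,
  (y - net_coord c) ^+ 2 <= mesh ^+ 2 /\ c.2%:R <= 1 + D%:R * y ^+ 2 :> R.
Proof.
move=> y1; pose k := Num.truncn (`|y| / mesh).
have q0 : 0 <= `|y| / mesh by rewrite divr_ge0 // ltW // mesh_gt0.
have /andP[k1 k2] : k%:R <= `|y| / mesh < k.+1%:R by exact: truncn_itv.
have kb : k%:R <= 1 + D%:R * y ^+ 2 :> R.
  apply: (le_trans k1); rewrite /mesh invrK -[y ^+ 2]real_normK ?num_real //.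
  have := sqr_ge0 (1 - Num.sqrt (D%:R : R) * `|y|); move: sD2.
  by move: (Num.sqrt _) `|y| => a b <-; rewrite !expr2; nra.
have kD : (k < (2 * D).+1)%N.
  rewrite ltnS -(ler_nat R) natrM; apply: (le_trans kb).
  have D1 : (1 : R) <= D%:R by rewrite ler1n muln_gt0.
  have : D%:R * y ^+ 2 <= D%:R * 1 :> R by rewrite ler_pM2l.
  by lra.
exists (y < 0, Ordinal kD); split => //; rewrite /net_coord /=.
have e : (y - (-1) ^+ (y < 0)%R * (k%:R * mesh)) ^+ 2 = (`|y| - k%:R * mesh) ^+ 2.
  case: (ltrP y 0) => hy /=; first by rewrite expr1 (ltr0_norm hy); ring.
  by rewrite expr0 mul1r ger0_norm.
rewrite e.
move: k1 k2; rewrite ler_pdivlMr ?mesh_gt0 // ltr_pdivrMr ?mesh_gt0 // -natr1 => h1 h2.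
have h3 : 0 <= `|y| - k%:R * mesh by rewrite subr_ge0.
have h4 : `|y| - k%:R * mesh <= mesh by move: h2; rewrite mulrDl mul1r => h2; rewrite lerBlDl ltW.
by rewrite lerXn2r ?nnegrE // ltW // mesh_gt0.
Qed.

Lemma sumC_coord (V : nmodType) (f : 'I_s * bool -> V) : \sum_j f j = \sum_i (f (i, false) + f (i, true)).
Proof.
rewrite (eq_bigr (fun p => f (p.1, p.2))) => [|[] //].
rewrite -(pair_bigA _ (fun i b => f (i, b))) /=; apply: eq_bigr => i _.
by rewrite big_bool addrC.
Qed.

Lemma net_approx (y : 'cV[C]_s) : fro y <= 1 -> exists2 m : netT, m \in net & fro (y - net_vec m) <= 4^-1.
Proof.
move=> fy.
pose co (j : 'I_s * bool) := if j.2 then complex.Im (y j.1 0) else complex.Re (y j.1 0).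
have sco : \sum_j co j ^+ 2 = fro y by rewrite sumC_coord fro_col.
have co1 j : co j ^+ 2 <= 1.
  apply: le_trans fy; rewrite -sco (bigD1 j) //= lerDl; apply: sumr_ge0 => l _; exact: sqr_ge0.
pose m : netT := [ffun j => sval (cid (round_coord (co1 j)))].
have mP j : (co j - net_coord (m j)) ^+ 2 <= mesh ^+ 2 /\ (m j).2%:R <= 1 + D%:R * co j ^+ 2 :> R.
  by rewrite ffunE; exact: (svalP (cid (round_coord (co1 j)))).
have card : #|{: 'I_s * bool}| = D by rewrite card_prod card_ord card_bool mulnC.
exists m.
  rewrite inE -(ler_nat R) natr_sum.
  apply: (@le_trans _ _ (\sum_j (1 + D%:R * co j ^+ 2))); first by apply: ler_sum => j _; have [] := mP j.
  rewrite big_split /= -mulr_sumr sco sumr_const card natrM.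
  have : D%:R * fro y <= D%:R * 1 by rewrite ler_pM2l.
  by rewrite -[1 *+ D]/(D%:R); lra.
rewrite fro_col -mesh2.
apply: (@le_trans _ _ (\sum_j (mesh ^+ 2) *+ (j \in {: 'I_s * bool}))).
  under [leRHS]eq_bigr do rewrite inE mulr1n.
  rewrite [leRHS]sumC_coord; apply: ler_sum => i _; rewrite /nsq !mxE re_add im_add re_opp im_opp /=.
  by apply: lerD; [have [] := mP (i, false) | have [] := mP (i, true)].
by under eq_bigr do rewrite inE mulr1n; rewrite sumr_const card mulr_natr.
Qed.

Lemma geom_half (m : nat) : \sum_(k < m) (2^-1 : R) ^+ k <= 2.
Proof.
suff -> : \sum_(k < m) (2^-1 : R) ^+ k = 2 - 2 * 2^-1 ^+ m.
  by have h : 0 <= (2^-1 : R) ^+ m by []; lra.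
elim: m => [|m IH]; first by rewrite big_ord0 expr0; ring.
by rewrite big_ord_recr /= IH exprS; field.
Qed.

(** Give a point the product of the weights 2^-k of its multiples. A net point weighs at least 2^-(2
    D), and the total weight over all points factorises into at most 4^D, two signs times a
    geometric sum; and 2^(2 D) 4^D = 256^s. *)
Lemma card_net : (#|net|)%:R <= 256 ^+ s :> R.
Proof.
have card : #|{: 'I_s * bool}| = D by rewrite card_prod card_ord card_bool mulnC.
pose w (c : bool * 'I_(2 * D).+1) : R := 2^-1 ^+ c.2.
have w0 c : 0 <= w c by rewrite exprn_ge0.
have h1 : (#|net|)%:R <= 2 ^+ (2 * D) * \sum_(m : netT) \prod_j w (m j) :> R.
  rewrite -sum1_card natr_sum mulr_sumr [leRHS](bigID net) /=.
  apply: (@le_trans _ _ (\sum_(i in net) 2 ^+ (2 * D) * \prod_j w (i j))).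
    apply: ler_sum => m; rewrite inE => hm.
    rewrite /w prodrXr exprVn ler_pdivlMr ?exprn_gt0 // mul1r.
    by rewrite ler_weXn2l // ler1n.
  by rewrite lerDl; apply: sumr_ge0 => m _; rewrite mulr_ge0 ?exprn_ge0 // prodr_ge0.
apply: (le_trans h1).
rewrite -(bigA_distr_bigA (fun (_ : 'I_s * bool) c => w c)) prodr_const card.
have h2 : \sum_(c : bool * 'I_(2 * D).+1) w c <= 4.
  rewrite (eq_bigr (fun p => w (p.1, p.2))) => [|[] //].
  rewrite -(pair_bigA _ (fun b k => w (b, k))) /= big_bool /w /=.
  by have := geom_half (2 * D).+1; lra.
have h20 : 0 <= \sum_(c : bool * 'I_(2 * D).+1) w c by apply: sumr_ge0.
apply: (@le_trans _ _ (2 ^+ (2 * D) * 4 ^+ D)).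
  by rewrite ler_wpM2l ?exprn_ge0 // lerXn2r ?nnegrE.
rewrite /D exprM (exprM _ 2 s) exprM -!exprMn le_eqVlt; apply/orP; left; apply/eqP; congr (_ ^+ s).
by rewrite !expr2; ring.
Qed.

End Net.

(** * Normalisation and squared distances *)

Section Normalize.
Context {R : realType}.
Local Notation C := (R[i]).
Local Notation "a %:CR" := (Complex a 0) (at level 2, format "a %:CR").

Definition nrm s (e z : 'cV[C]_s) : 'cV[C]_s := if fro z == 0 then e else (Num.sqrt (fro z))^-1%:CR *: z.

Lemma fro_nrm s (e z : 'cV[C]_s) : fro e = 1 -> fro (nrm e z) = 1.
Proof.
rewrite /nrm => e1; case: eqP => // /eqP z0.
by rewrite fro_scaleR exprVn sqr_sqrtr ?fro_ge0 // mulVf.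
Qed.

Lemma froB m n (u v : 'M[C]_(m, n)) : fro (u - v) = fro u + fro v - 2 * fdot u v.
Proof.
have -> : u - v = 1%:CR *: u + (-1)%:CR *: v.
  rewrite Complex1E scale1r; congr (_ + _); apply/matrixP => i j; rewrite !mxE -[LHS]mulN1r.
  by congr (_ * _); apply: complex_ext => //=; rewrite oppr0.
by rewrite fro_comb; ring.
Qed.

Lemma fro_triangle m n (u v w : 'M[C]_(m, n)) : fro (u - w) <= 2 * fro (u - v) + 2 * fro (v - w).
Proof.
have -> : u - w = (u - v) + (v - w) by rewrite addrA subrK.
have := froB (u - v) (v - w); rewrite (fro_add (u - v) (v - w)).
by have := fro_ge0 (u - v - (v - w)); lra.
Qed.

Lemma fro_sub_le m n (u v : 'M[C]_(m, n)) : fro (u - v) <= 2 * fro u + 2 * fro v.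
Proof. by have := fro_ge0 (u + v); rewrite (fro_add u v) (froB u v); lra. Qed.

(** Normalising at most doubles the distance to a unit vector. With r the norm of z and p the cosine
    of the angle to x, the squared distance before is (r - p)^2 + (1 - p) (1 + p) and after it is 2
    - 2 p; the sign of p decides which part of the former is used. *)
Lemma fro_nrm_sub s (e z x : 'cV[C]_s) : fro e = 1 -> fro x = 1 -> fro (nrm e z - x) <= 4 * fro (z - x).
Proof.
move=> e1 x1; rewrite /nrm; case: eqP => [z0|/eqP z0].
  have -> : fro (z - x) = 1.
    rewrite froB z0 x1 (fro_eq0 z0) fdot_col big1 => [|i _]; last by rewrite mxE /cdot /= !mul0r addr0.
    by ring.
  by have := fro_sub_le e x; rewrite e1 x1; lra.
have zp : 0 < fro z by rewrite lt_neqAle eq_sym z0 fro_ge0.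
set r := Num.sqrt (fro z).
have r0 : 0 < r by rewrite sqrtr_gt0.
have r2 : r ^+ 2 = fro z by rewrite sqr_sqrtr // ltW.
have fu : fro (r^-1%:CR *: z) = 1 by rewrite fro_scaleR exprVn r2 mulVf.
have := froB (r^-1%:CR *: z) x; have := fro_ge0 (r^-1%:CR *: z - x).
rewrite (froB z x) fu x1 fdot_scaleRl -r2.
set p := r^-1 * fdot z x.
have -> : fdot z x = r * p by rewrite /p mulrA mulfV ?mul1r ?gt_eqF.
move=> h1 h2; have h3 := fro_sub_le (r^-1%:CR *: z) x; rewrite fu x1 in h3; rewrite h2 in h1 h3 *.
have p1 : p <= 1 by move: h1; rewrite /p; lra.
have p2 : -1 <= p by move: h3; rewrite /p; lra.
rewrite -/p; move: p1 p2; move: (p) => q p1 p2.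
have := sqr_ge0 (r - q); have : 0 <= (1 - q) * (1 + q) by rewrite mulr_ge0; lra.
case: (lerP 0 q) => p0; nra.
Qed.

Lemma nsq_add_le (a b : C) : nsq (a + b) <= 2 * nsq a + 2 * nsq b.
Proof.
case: a => a1 a2; case: b => b1 b2; rewrite /nsq /= -subr_ge0.
rewrite (_ : _ - _ = (a1 - b1) ^+ 2 + (a2 - b2) ^+ 2); last by ring.
by rewrite addr_ge0 // sqr_ge0.
Qed.

Lemma nsq_sum_le s (a : 'I_s -> C) : nsq (\sum_i a i) <= 2 ^+ s * \sum_i nsq (a i).
Proof.
elim: s a => [|s IH] a; first by rewrite !big_ord0 mulr0 /nsq /= expr0n addr0.
rewrite !big_ord_recl; apply: (le_trans (nsq_add_le _ _)).
have := IH (fun i => a (lift ord0 i)); set S := \sum_(i < s) nsq _ => h.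
have h1 : (1 : R) <= 2 ^+ s by rewrite exprn_ege1 // ler1n.
have := nsq_ge0 (a ord0); rewrite exprS => h2.
have : nsq (a ord0) * 1 <= nsq (a ord0) * 2 ^+ s by rewrite ler_wpM2l.
by move: h; clearbody S; move: (nsq _) (nsq _) (2 ^+ s) => p q z h; nra.
Qed.

(** The crude factor 2^s is harmless: the bound only serves a limit at fixed [s] in [Wch_lt1]. *)
Lemma fro_mul_le m s (M : 'M[C]_(m, s)) (z : 'cV[C]_s) : fro (M *m z) <= 2 ^+ s * fro M * fro z.
Proof.
rewrite fro_col /fro -mulrA mulr_suml mulr_sumr; apply: ler_sum => i _.
rewrite mxE; apply: (le_trans (nsq_sum_le _)); rewrite ler_wpM2l ?exprn_ge0 //.
rewrite /rn mulr_suml; apply: ler_sum => j _; rewrite nsqM ler_wpM2l ?nsq_ge0 //.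
rewrite (bigD1 j) //= big_ord_recl big_ord0 addr0 (_ : ord0 = 0) // lerDl.
by apply: sumr_ge0 => l _; apply: sumr_ge0 => k _; exact: nsq_ge0.
Qed.

End Normalize.

(** * The chaining functional and its mean *)

Section Chain.
Context {R : realType}.
Local Notation C := (R[i]).
Local Notation "a %:CR" := (Complex a 0) (at level 2, format "a %:CR").

Lemma fdotC p q (Y Z : 'M[C]_(p, q)) : fdot Y Z = fdot Z Y.
Proof.
by apply: eq_bigr => i _; apply: eq_bigr => j _; rewrite /cdot; ring.
Qed.

Lemma measurable_bigsum (I : Type) (r : seq I) (P : pred I) (f : I -> Om R -> \bar R) :
  (forall j, measurable_fun setT (f j)) -> measurable_fun setT (fun v : Om R => (\sum_(j <- r | P j) f j v)%E).
Proof. by move=> mf; (under eq_fun do rewrite -big_filter); exact: emeasurable_sum. Qed.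

Lemma EG_bigsum k (I : Type) (r : seq I) (P : pred I) (f : I -> Om R -> \bar R) :
  (forall j, measurable_fun setT (f j)) -> (forall j v, (0 <= f j v)%E) ->
  EG k (fun v => (\sum_(j <- r | P j) f j v)%E) = (\sum_(j <- r | P j) EG k (f j))%E.
Proof.
move=> mf f0; elim: r => [|j r IH].
  by rewrite big_nil /EG (@eq_itI _ _ _ _ (fun=> 0%E)) ?itI_cst // => v _; rewrite big_nil.
rewrite big_cons; case: ifP => Pj; last first.
  by rewrite -IH; apply: eq_itI => v _; rewrite big_cons Pj.
rewrite -IH /EG -itI_D //.
- by apply: eq_itI => v _; rewrite big_cons Pj.
- exact: measurable_bigsum.
- by move=> v; apply: sume_ge0.
Qed.

Lemma le_sum_expR (k : nat) (a : R) : 256 ^+ k <= expR (8 * k%:R) :> R.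
Proof.
have h : (2 : R) <= expR 1 by apply: le_trans (expR_ge1Dx _); lra.
have -> : (256 : R) = 2 ^+ 8 by ring.
rewrite -exprM -natrM -[X in expR X]mulr1 expRM_natl.
by rewrite lerXn2r ?nnegrE // expR_ge0.
Qed.

Variables (n s : nat) (F : 'cV[C]_n -> R) (m kap : R).
Hypothesis cF : fcontinuous F.
Hypothesis sF : stepF 0 1 F.
Hypothesis pF : phase_inv F.
Hypothesis F0 : forall g, 0 <= F g.
Hypothesis n0 : (0 < n)%N.
Hypothesis s0 : (0 < s)%N.
Hypothesis mE : EG (2 * n) (fun v => (F (cvec_of n v))%:E) = m%:E.
Hypothesis k0 : 0 < kap.
Hypothesis k1 : kap <= 1.
Variable X : R.
Hypothesis XE : X = n%:R * kap ^+ 2 / 16384.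
Hypothesis hX : 8 * s%:R <= X.

Let nR : (0 : R) < n%:R. Proof. by rewrite ltr0n. Qed.
Let nk : 0 < n%:R * kap ^+ 2. Proof. by rewrite mulr_gt0 // exprn_gt0. Qed.

Definition baseV : 'cV[C]_s := delta_mx (Ordinal s0) 0.
Lemma fro_baseV : fro baseV = 1.
Proof.
rewrite fro_col (bigD1 (Ordinal s0)) //= big1 => [|i hi]; rewrite mxE.
  by rewrite !eqxx /nsq /= expr1n expr0n !addr0.
by rewrite (negbTE hi) /nsq /= expr0n addr0.
Qed.

(** A binary expansion of a point of the ball, with net vectors as digits. *)
Definition psum (b : nat -> netT s) j : 'cV[C]_s := \sum_(i < j) (2^-1 ^+ i)%:CR *: net_vec (b i).
Definition pnt b j := nrm baseV (psum b j).
Lemma fro_pnt b j : fro (pnt b j) = 1. Proof. exact: (fro_nrm _ fro_baseV). Qed.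

(** Level [k] involves the digits 0 to [k] only; [inord] gives arbitrary values to the others, which
    are never read there. *)
Definition extB k (be : {ffun 'I_k.+1 -> netT s}) (i : nat) : netT s := be (inord i).
(** The product [lamk] [rhok] is kap / 512 at every scale, so the smallness condition of [gen_mgf]
    always holds. The thresholds [tauk] decay like (3/4)^k and sum to at most 4 n kap, while [lamk]
    [tauk] grows like (3/2)^k and outweighs the linear growth in k of the logarithm of the number of
    digit sequences. *)
Definition rhok k : R := 4 * 2^-1 ^+ k.
Definition lamk k : R := kap / 2048 * 2 ^+ k.
Definition tauk k : R := n%:R * kap * (3 / 4) ^+ k.

Definition devt l t (Y Z : 'cV[C]_s) (v : seq R) : R :=
  expR (l * (F (GX n v Y) - F (GX n v Z) - t)).

Definition chterm k (be : {ffun 'I_k.+1 -> netT s}) (v : Om R) : \bar R :=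
  (devt (lamk k) (tauk k) (pnt (extB be) k.+1) (pnt (extB be) k) v +
   devt (lamk k) (tauk k) (pnt (extB be) k) (pnt (extB be) k.+1) v)%:E.

(** Only consecutive points that are close are compared; the expansions of [net_chain] always
    satisfy this. *)
Definition admis k (be : {ffun 'I_k.+1 -> netT s}) : bool :=
  (be \in ffun_on (mem (@net s))) && (fro (pnt (extB be) k.+1 - pnt (extB be) k) <= rhok k ^+ 2).

Definition level k (v : Om R) : \bar R := (\sum_(be | @admis k be) chterm be v)%E.

Definition center_term (v : Om R) : \bar R :=
  (expR (kap / 64 * (F (GX n v baseV) - m - n%:R * kap)) + expR (kap / 64 * (m - F (GX n v baseV) - n%:R * kap)))%:E.

(** A union bound in integrated form: every deviation to be excluded contributes a nonnegative term
    that is at least 1 where it occurs. *)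
Definition Wch (v : Om R) : \bar R := (center_term v + \sum_(0 <= k <oo) level k v)%E.

Let meas_devt l t (Y Z : 'cV[C]_s) : measurable_fun setT (fun v : Om R => (devt l t Y Z v)%:E).
Proof.
apply/measurable_EFinP; apply: measurableT_comp => //; apply: measurable_funM => //.
by apply: measurable_funB => //; apply: measurable_funB; exact: measurable_FGX.
Qed.

Let devt_ge0 l t Y Z v : 0 <= devt l t Y Z v. Proof. exact: expR_ge0. Qed.

Let meas_chterm k be : measurable_fun setT (@chterm k be).
Proof.
apply/measurable_EFinP; apply: measurable_funD; apply/measurable_EFinP; exact: meas_devt.
Qed.

Let chterm_ge0 k be v : (0 <= @chterm k be v)%E.
Proof. by rewrite lee_fin addr_ge0. Qed.

Let meas_level k : measurable_fun setT (level k).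
Proof. exact: measurable_bigsum. Qed.

Let level_ge0 k v : (0 <= level k v)%E. Proof. by apply: sume_ge0. Qed.

Let meas_center : measurable_fun setT center_term.
Proof.
apply/measurable_EFinP; apply: measurable_funD; apply: measurableT_comp => //; apply: measurable_funM => //;
  apply: measurable_funB => //; apply: measurable_funB => //; exact: measurable_FGX.
Qed.

Let center_ge0 v : (0 <= center_term v)%E.
Proof. by rewrite lee_fin addr_ge0 ?expR_ge0. Qed.

Lemma measurable_Wch : measurable_fun setT Wch.
Proof. by apply: emeasurable_funD => //; apply: ge0_emeasurable_sum. Qed.

Lemma Wch_ge0 v : (0 <= Wch v)%E.
Proof. by rewrite adde_ge0 // nneseries_ge0. Qed.

Lemma EG_devt l t (Y Z : 'cV[C]_s) rho : fro Y = 1 -> fro Z = 1 -> 0 < l -> 0 < rho ->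
  fro (Y - Z) <= rho ^+ 2 -> l * rho <= 4^-1 ->
  (EG (2 * (n * s)) (fun v => (devt l t Y Z v)%:E) <= (expR (17 * n%:R * l ^+ 2 * rho ^+ 2 - l * t))%:E)%E.
Proof.
move=> Y1 Z1 l0 r0 hr hl.
have e0 : 0 <= expR (- (l * t)) by exact: expR_ge0.
apply: (@le_trans _ _ ((expR (- (l * t)))%:E * (expR (17 * n%:R * l ^+ 2 * rho ^+ 2))%:E)%E); last first.
  by rewrite -EFinM -expRD lee_fin addrC.
apply: le_trans (lee_wpmul2l _ (gen_mgf cF sF pF n0 Z1 Y1 l0 r0 hr hl)) => //.
rewrite -(@EG_Zr _ _ (fun v => expR (l * (F (GX n v Y) - F (GX n v Z))))) //.
- rewrite le_eqVlt; apply/orP; left; apply/eqP; apply: eq_itI => v _; rewrite /devt -expRD.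
  by congr (expR _)%:E; ring.
- exact: measurable_FGXdiff.
Qed.

Let X8 : 8 <= X.
Proof. by apply: le_trans hX; rewrite ler_peMr // ler1n. Qed.

Let pow2K k : 2 ^+ k * 2^-1 ^+ k = 1 :> R.
Proof. by rewrite -exprMn mulfV ?expr1n. Qed.

Lemma lam_rho k : lamk k * rhok k = kap / 512.
Proof.
rewrite /lamk /rhok (_ : _ * _ = kap / 512 * (2 ^+ k * 2^-1 ^+ k)); last by field.
by rewrite pow2K mulr1.
Qed.

Lemma lam_gt0 k : 0 < lamk k. Proof.
have h : 0 < kap / 2048 by have := k0; lra.
by rewrite /lamk; move: (kap / 2048) h => a h; rewrite mulr_gt0 ?exprn_gt0.
Qed.
Lemma rho_gt0 k : 0 < rhok k. Proof. by rewrite /rhok mulr_gt0 ?exprn_gt0. Qed.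

Lemma bern32 k : 1 + k%:R / 2 <= (3 / 2) ^+ k :> R.
Proof.
elim: k => [|k IH]; first by rewrite expr0 mul0r addr0.
by rewrite exprS -natr1; have : 0 <= k%:R :> R by []; nra.
Qed.

(** The quadratic term is 17/16 X at every level, while the linear one is 8 X (3/2)^k, at least (8 +
    4 k) X by Bernoulli's inequality. *)
Lemma level_exponent k :
  17 * n%:R * lamk k ^+ 2 * rhok k ^+ 2 - lamk k * tauk k <= - (2 * (k.+1%:R * X)).
Proof.
have -> : 17 * n%:R * lamk k ^+ 2 * rhok k ^+ 2 = 17 / 16 * X.
  rewrite (_ : _ * _ * _ = 17 * n%:R * (lamk k * rhok k) ^+ 2); last by ring.
  by rewrite lam_rho XE; field.
have -> : lamk k * tauk k = 8 * X * (3 / 2) ^+ k.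
  rewrite /lamk /tauk XE (_ : 3 / 2 = 2 * (3 / 4)) ?exprMn; last by field.
  by field.
have := bern32 k; have := X8; rewrite -[k.+1%:R]natr1; have : 0 <= k%:R :> R by [].
move: (_ ^+ k) k%:R X => A K Y K0 Y8 hA.
have h1 : 0 <= Y * (A - (1 + K / 2)) by rewrite mulr_ge0; lra.
have h2 : 0 <= Y * K by rewrite mulr_ge0; lra.
lra.
Qed.

Lemma EG_chterm k be : @admis k be ->
  (EG (2 * (n * s)) (chterm be) <= (2 * expR (- (2 * (k.+1%:R * X))))%:E)%E.
Proof.
move=> /andP[_ hr].
rewrite /chterm EG_Dr //.
have hl : lamk k * rhok k <= 4^-1 by rewrite lam_rho; have := k1; lra.
rewrite (_ : 2 * _ = expR (- (2 * (k.+1%:R * X))) + expR (- (2 * (k.+1%:R * X)))); last by ring.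
rewrite EFinD; apply: leeD.
  apply: (le_trans (EG_devt _ (fro_pnt _ _) (fro_pnt _ _) (lam_gt0 k) (rho_gt0 k) hr hl)).
  by rewrite lee_fin ler_expR level_exponent.
have hr' : fro (pnt (extB be) k - pnt (extB be) k.+1) <= rhok k ^+ 2.
  by move: hr; rewrite !froB (fdotC (pnt _ k)) => h; lra.
apply: (le_trans (EG_devt _ (fro_pnt _ _) (fro_pnt _ _) (lam_gt0 k) (rho_gt0 k) hr' hl)).
by rewrite lee_fin ler_expR level_exponent.
Qed.

(** There are at most 256^(s (k + 1)) digit sequences, hence at most exp ((k + 1) X) by 8 s <= X.
    Half of the exponent 2 (k + 1) X pays for them, and the other half splits into exp (- X) and a
    geometric factor. *)
Lemma EG_level k : (EG (2 * (n * s)) (level k) <= (2 * expR (- X) * 2^-1 ^+ k)%:E)%E.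
Proof.
rewrite /level EG_bigsum //.
apply: (@le_trans _ _ (\sum_(be | @admis k be) (2 * expR (- (2 * (k.+1%:R * X))))%:E)%E).
  by apply: lee_sum => be; exact: EG_chterm.
rewrite sumEFin lee_fin.
have c0 : 0 <= 2 * expR (- (2 * (k.+1%:R * X))) by rewrite mulr_ge0 ?expR_ge0.
apply: (@le_trans _ _ (\sum_(be in ffun_on (mem (@net s))) 2 * expR (- (2 * (k.+1%:R * X))))).
  rewrite big_mkcond [leRHS]big_mkcond; apply: ler_sum => be _; rewrite /admis.
  by case: (be \in _) => //=; case: ifP.
rewrite sumr_const card_ffun_on card_ord -[leLHS]mulr_natr natrX.
have c1 : (#|@net s|)%:R ^+ k.+1 <= expR (k.+1%:R * X).
  apply: (@le_trans _ _ ((256 ^+ s) ^+ k.+1)); first by rewrite lerXn2r ?nnegrE ?exprn_ge0 // card_net.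
  apply: (@le_trans _ _ (expR (8 * s%:R) ^+ k.+1)).
    by rewrite lerXn2r ?nnegrE ?exprn_ge0 ?expR_ge0 // le_sum_expR.
  by rewrite -expRM_natl ler_expR ler_wpM2l.
apply: (@le_trans _ _ (2 * expR (- (2 * (k.+1%:R * X))) * expR (k.+1%:R * X))).
  by rewrite ler_wpM2l.
rewrite -!mulrA ler_wpM2l // -expRD.
have -> : - (2 * (k.+1%:R * X)) + k.+1%:R * X = - X + k%:R * (- X) by rewrite -[k.+1%:R]natr1; ring.
rewrite expRD expRM_natl ler_wpM2l ?expR_ge0 // lerXn2r ?nnegrE ?expR_ge0 //.
rewrite expRN lef_pV2 ?posrE ?expR_gt0 //.
by apply: le_trans (expR_ge1Dx _); have := X8; lra.
Qed.

Lemma EG_center : (EG (2 * (n * s)) center_term <= (2 * expR (- X))%:E)%E.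
Proof.
have mm (b : R) : measurable_fun [set: measurableTypeR R] (fun x : measurableTypeR R => kap / 64 * (x - b) : measurableTypeR R).
  by apply: measurable_funM => //; apply: measurable_funB.
have mm' (b : R) : measurable_fun [set: measurableTypeR R] (fun x : measurableTypeR R => kap / 64 * (b - x) : measurableTypeR R).
  by apply: measurable_funM => //; apply: measurable_funB.
have l0 : 0 <= kap / 64 by have := k0; lra.
(* With lam = kap / 64 the quadratic term 16 n lam^2 also equals n kap^2 / 256; together they use
   half of the gain lam n kap = n kap^2 / 64. *)
have e0 : 0 < n%:R * kap ^+ 2 / 256 by have := nk; lra.
have kk : kap ^+ 2 <= 1 by have := k1; have := k0; nra.
have ck : 8 * (kap / 64) ^+ 2 * 1 <= 2^-1 :> R by rewrite exprMn expr2 in kk *; nra.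
have ex : 8 * (kap / 64) ^+ 2 * (0 + 2 * n%:R * 1) + n%:R * kap ^+ 2 / 256 - kap / 64 * (n%:R * kap) <= - X.
  rewrite (_ : _ + _ - _ = - (n%:R * kap ^+ 2 / 128)); last by field.
  by rewrite XE; have := nk; lra.
have d0 : 0 <= expR (- (kap / 64 * (n%:R * kap))) by exact: expR_ge0.
have key (h : R -> R) (f : R -> R) : measurable_fun [set: measurableTypeR R] (h : measurableTypeR R -> measurableTypeR R) ->
  (forall y, f y = expR (- (kap / 64 * (n%:R * kap))) * expR (h y)) ->
  (EG (2 * n) (fun v => (expR (h (F (cvec_of n v))))%:E) <= (expR (8 * (kap / 64) ^+ 2 * (0 + 2 * n%:R * 1) + n%:R * kap ^+ 2 / 256))%:E)%E ->
  (EG (2 * (n * s)) (fun v => (f (F (GX n v baseV)))%:E) <= (expR (- X))%:E)%E.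
  move=> mh fh hb.
  have mP : meas_C (fun g => (expR (h (F g)))%:E) by exact: (measurable_expF cF mh).
  rewrite (_ : EG _ _ = EG (2 * (n * s)) (fun v => (expR (- (kap / 64 * (n%:R * kap))) * expR (h (F (GX n v baseV))))%:E)); last first.
    by apply: eq_itI => v _; rewrite fh.
  rewrite (@EG_Zr _ _ (fun v => expR (h (F (GX n v baseV))))) //.
  - rewrite (EG_single fro_baseV mP) => [|g]; last by rewrite lee_fin expR_ge0.
    apply: (le_trans (lee_wpmul2l _ hb)) => //.
    by rewrite -EFinM -expRD lee_fin ler_expR addrC.
  - apply/measurable_EFinP; apply: measurableT_comp => //.
    apply: (measurableT_comp mh); exact: measurable_FGX.
rewrite /center_term (@EG_Dr _ _ (fun v => expR (kap / 64 * (F (GX n v baseV) - m - n%:R * kap)))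
   (fun v => expR (kap / 64 * (m - F (GX n v baseV) - n%:R * kap)))) //; last 2 first.
- apply/measurable_EFinP; apply: measurableT_comp => //; apply: measurable_funM => //.
  by apply: measurable_funB => //; apply: measurable_funB => //; exact: measurable_FGX.
- apply/measurable_EFinP; apply: measurableT_comp => //; apply: measurable_funM => //.
  by apply: measurable_funB => //; apply: measurable_funB => //; exact: measurable_FGX.
rewrite (_ : 2 * _ = expR (- X) + expR (- X)) ?EFinD; last by ring.
apply: leeD.
  apply: (key (fun y => kap / 64 * (y - m)) (fun y => expR (kap / 64 * (y - m - n%:R * kap)))) => // [y|].
    by rewrite -expRD; congr expR; ring.
  by apply: center_mgf.
apply: (key (fun y => kap / 64 * (m - y)) (fun y => expR (kap / 64 * (m - y - n%:R * kap)))) => // [y|].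
  by rewrite -expRD; congr expR; ring.
by apply: center_mgfN.
Qed.

Lemma EG_Wch : (EG (2 * (n * s)) Wch <= (6 * expR (- X))%:E)%E.
Proof.
rewrite /Wch /EG itI_D //; last 2 first.
- exact: ge0_emeasurable_sum.
- by move=> v; exact: nneseries_ge0.
rewrite itI_nneseries //.
rewrite (_ : 6 * expR (- X) = 2 * expR (- X) + 4 * expR (- X)); last by ring.
rewrite EFinD; apply: leeD; first exact: EG_center.
apply: (le_trans (lee_nneseries _ (fun k _ => EG_level k))) => [k _ _|]; first by apply: itI_ge0.
apply: lime_le; first by apply: is_cvg_nneseries => k _ _; rewrite lee_fin !mulr_ge0 ?expR_ge0 ?exprn_ge0.
apply: nearW => N; rewrite sumEFin lee_fin -mulr_sumr big_mkord.
rewrite (_ : 4 * expR (- X) = 2 * expR (- X) * 2); last by ring.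
by rewrite ler_wpM2l ?mulr_ge0 ?expR_ge0 // geom_half.
Qed.

End Chain.

(** * From the chaining functional to a uniform bound on the sphere *)

Section Chaining.
Context {R : realType}.
Local Notation C := (R[i]).
Local Notation "a %:CR" := (Complex a 0) (at level 2, format "a %:CR").

(** Greedy expansion: subtracting a net vector leaves squared norm at most 1/4, and doubling the
    remainder returns it to the unit ball. *)
Lemma net_chain s (x : 'cV[C]_s) : (0 < s)%N -> fro x = 1 ->
  exists b : nat -> netT s, (forall k, b k \in @net s) /\ (forall k, fro (x - psum b k) <= 4^-1 ^+ k).
Proof.
move=> s0 x1.
have [f fP] : {f : 'cV[C]_s -> netT s & forall y, fro y <= 1 -> f y \in @net s /\ fro (y - net_vec (f y)) <= 4^-1}.
  apply: (@choice _ _ (fun y m => fro y <= 1 -> m \in @net s /\ fro (y - net_vec m) <= 4^-1)) => y.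
  have [y1|y1] := boolP (fro y <= 1); last by exists [ffun=> (false, ord0)].
  by have [m m1 m2] := net_approx s0 y1; exists m.
pose y k := iter k (fun y => 2%:CR *: (y - net_vec (f y))) x.
have y1 k : fro (y k) <= 1.
  elim: k => [|k IH]; first by rewrite /y /= x1.
  rewrite /y /= -/(y k) fro_scaleR; have [_] := fP _ IH.
  by rewrite expr2; lra.
exists (fun k => f (y k)); split => k; first by have [] := fP _ (y1 k).
have -> : x - psum (fun k => f (y k)) k = (2^-1 ^+ k)%:CR *: y k.
  elim: k => [|k IH].
    by rewrite /psum big_ord0 subr0 expr0 Complex1E scale1r.
  rewrite /psum big_ord_recr /= -/(psum _ k) opprD addrA IH -scalerBr /y /= -/(y k) scalerA.
  congr (_ *: _); apply: complex_ext => /=; last by ring.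
  by rewrite mul0r subr0 exprSr -mulrA mulVf ?mulr1.
rewrite fro_scaleR -exprM mulnC exprM.
have -> : (2^-1 : R) ^+ 2 = 4^-1 by rewrite expr2; lra.
by rewrite ler_piMr // exprn_ge0.
Qed.

Lemma dist_le_of_lt (a b t : R) : a - b - t < 0 -> b - a - t < 0 -> `|a - b| <= t.
Proof. by move=> h1 h2; rewrite ler_norml; apply/andP; split; lra. Qed.

Lemma expR_lt1E (x : R) : expR x < 1 -> x < 0.
Proof. by rewrite -[X in _ < X]expR0 ltr_expR. Qed.

Variables (n s : nat) (F : 'cV[C]_n -> R) (m kap : R).
Hypothesis cF : fcontinuous F.
Hypothesis s0 : (0 < s)%N.
Hypothesis n0 : (0 < n)%N.
Hypothesis k0 : 0 < kap.

Lemma sum_tau k : \sum_(i < k) tauk n kap i <= 4 * (n%:R * kap) :> R.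
Proof.
rewrite /tauk -mulr_sumr mulrC ler_wpM2r ?mulr_ge0 ?(ltW k0) //.
suff -> : \sum_(i < k) (3 / 4 : R) ^+ i = 4 - 4 * (3 / 4) ^+ k.
  by have : 0 <= (3 / 4 : R) ^+ k by []; lra.
elim: k => [|k IH]; first by rewrite big_ord0 expr0; ring.
by rewrite big_ord_recr /= IH exprS; field.
Qed.

Lemma lte_sum_part (f : nat -> \bar R) k : (forall i, (0 <= f i)%E) -> (f k <= \sum_(0 <= i <oo) f i)%E.
Proof.
move=> f0; apply: le_trans (nneseries_lim_ge k.+1 _) => //.
by rewrite big_nat_recr //= leeDr // sume_ge0.
Qed.

(** The factor 5 is one n kap for the base vector plus 4 n kap for the sum of all thresholds. *)
Lemma Wch_lt1 v : (Wch F m kap s0 v < 1)%E ->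
  forall x : 'cV[C]_s, fro x = 1 -> `|F (GX n v x) - m| <= 5 * n%:R * kap.
Proof.
move=> W1 x x1.
have nR : (0 : R) < n%:R by rewrite ltr0n.
have nk : 0 < n%:R * kap by rewrite mulr_gt0.
have c0 : (0 <= center_term F m kap s0 v)%E by rewrite lee_fin addr_ge0 ?expR_ge0.
have t0 k be : (0 <= @chterm _ _ _ F kap s0 k be v)%E by rewrite lee_fin addr_ge0 ?expR_ge0.
have l0 k : (0 <= level F kap s0 k v)%E by apply: sume_ge0.
have lser : (0 <= \sum_(0 <= k <oo) level F kap s0 k v)%E by exact: nneseries_ge0.
have hc : (center_term F m kap s0 v < 1)%E.
  by apply: le_lt_trans W1; rewrite /Wch leeDl.
have hl k : (level F kap s0 k v < 1)%E.
  apply: le_lt_trans W1; rewrite /Wch; apply: le_trans (leeDr _ c0).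
  exact: (@lte_sum_part (fun k => level F kap s0 k v)).
have ht k be : @admis R _ s0 k be -> (@chterm _ _ _ F kap s0 k be v < 1)%E.
  move=> hb; apply: le_lt_trans (hl k).
  by rewrite /level (bigD1 be) //=; apply: leeDl; exact: sume_ge0.
have cen : `|F (GX n v (baseV s0)) - m| <= n%:R * kap.
  have kp : 0 < kap / 64 by have := k0; lra.
  move: hc; rewrite /center_term lte_fin => hc.
  have [h1 h2] : expR (kap / 64 * (F (GX n v (baseV s0)) - m - n%:R * kap)) < 1 /\
     expR (kap / 64 * (m - F (GX n v (baseV s0)) - n%:R * kap)) < 1.
    by split; apply: le_lt_trans hc; [rewrite lerDl | rewrite lerDr]; exact: expR_ge0.
  move/expR_lt1E: h1; rewrite pmulr_rlt0 // => h1.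
  move/expR_lt1E: h2; rewrite pmulr_rlt0 // => h2.
  exact: dist_le_of_lt.
have [b [bN bx]] := net_chain s0 x1.
have pc k : fro (pnt s0 b k - x) <= 4 * 4^-1 ^+ k.
  apply: (le_trans (fro_nrm_sub _ (fro_baseV s0) x1)); rewrite ler_wpM2l //.
  by apply: le_trans (bx k); rewrite le_eqVlt; apply/orP; left; rewrite !froB fdotC; apply/eqP; ring.
(* The triangle inequality gives 2 (4 4^-(k+1)) + 2 (4 4^-k) = 10 4^-k, below 16 4^-k; this is the
   origin of the 4 in [rhok]. *)
have pp k : fro (pnt s0 b k.+1 - pnt s0 b k : 'cV[C]_s) <= rhok k ^+ 2.
  apply: (le_trans (fro_triangle _ x _)).
  have := pc k; have := pc k.+1; rewrite /rhok exprMn -exprM mulnC exprM.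
  have -> : (2^-1 : R) ^+ 2 = 4^-1 by rewrite expr2; lra.
  have -> : fro (x - pnt s0 b k) = fro (pnt s0 b k - x) by rewrite !froB fdotC; ring.
  have : 0 <= (4^-1 : R) ^+ k by [].
  by rewrite exprS [4 ^+ 2]expr2; move: (4^-1 ^+ k) => q; lra.
have stp k : `|F (GX n v (pnt s0 b k.+1)) - F (GX n v (pnt s0 b k))| <= tauk n kap k.
  pose be : {ffun 'I_k.+1 -> netT s} := [ffun i : 'I_k.+1 => b i].
  have pE j : (j <= k.+1)%N -> pnt s0 (extB be) j = pnt s0 b j.
    move=> jk; congr nrm; apply: eq_bigr => i _; rewrite /extB ffunE inordK //.
    by apply: leq_trans jk; exact: ltn_ord.
  have adm : @admis R _ s0 k be.
    rewrite /admis !pE // pp andbT; apply/ffun_onP => i; rewrite ffunE; exact: bN.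
  have lp := lam_gt0 k0 k.
  have := ht k be adm; rewrite /chterm lte_fin !pE // /devt; move: (lamk kap k) lp => la lp hd.
  have [h1 h2] : expR (la * (F (GX n v (pnt s0 b k.+1)) - F (GX n v (pnt s0 b k)) - tauk n kap k)) < 1 /\
     expR (la * (F (GX n v (pnt s0 b k)) - F (GX n v (pnt s0 b k.+1)) - tauk n kap k)) < 1.
    by split; apply: le_lt_trans hd; [rewrite lerDl | rewrite lerDr]; exact: expR_ge0.
  move/expR_lt1E: h1; rewrite pmulr_rlt0 // => h1.
  move/expR_lt1E: h2; rewrite pmulr_rlt0 // => h2.
  exact: dist_le_of_lt.
have acc k : `|F (GX n v (pnt s0 b k)) - m| <= n%:R * kap + \sum_(i < k) tauk n kap i.
  elim: k => [|k IH].
    (* The empty partial sum is zero, and its normalisation defaults to [baseV]: the chain starts at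
       the vector that [center_term] controls. *)
    rewrite big_ord0 addr0 (_ : pnt s0 b 0 = baseV s0) //.
    by rewrite /pnt /nrm /psum big_ord0 (_ : fro 0 = 0) ?eqxx // fro_col big1 // => i _;
       rewrite mxE /nsq /= expr0n addr0.
  rewrite big_ord_recr /= addrA.
  rewrite (_ : _ - m = (F (GX n v (pnt s0 b k.+1)) - F (GX n v (pnt s0 b k))) + (F (GX n v (pnt s0 b k)) - m)); last by ring.
  by apply: (le_trans (ler_normD _ _)); rewrite addrC lerD.
(* The bound holds along the chain uniformly in [k]; the chain converges to [x], and continuity at G
   x costs an arbitrary [e]. *)
apply/ler_addgt0Pr => e e0.
have [del d0 hd] := cF (GX n v x) e0.
pose B : R := 2 ^+ s * fro (@mat R n s (cvec_of (n * s) v)) * 4.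
have B0 : 0 <= B by rewrite !mulr_ge0 ?exprn_ge0 ?fro_ge0.
have [k hk] : exists k, B * 4^-1 ^+ k <= del.
  pose k := (Num.truncn (B / del)).+1; exists k.
  have k4 : (k%:R : R) <= 4 ^+ k.
    by rewrite -natrX ler_nat ltnW // ltn_expl.
  rewrite exprVn ler_pdivrMr ?exprn_gt0 //.
  apply: (@le_trans _ _ (del * k%:R)); last by apply: ler_wpM2l; [exact: ltW | exact: k4].
  by rewrite mulrC -ler_pdivrMr // ltW // /k truncnS_gt.
have := hd (GX n v (pnt s0 b k)).
have -> : GX n v (pnt s0 b k) - GX n v x = mat (cvec_of (n * s) v) *m (pnt s0 b k - x).
  by rewrite /GX mulmxBr.
move=> h; have {}h : `|F (GX n v (pnt s0 b k)) - F (GX n v x)| <= e.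
  apply: h; apply: (le_trans (fro_mul_le _ _)); apply: le_trans hk.
  by rewrite /B -[leRHS]mulrA; apply: ler_wpM2l (pc k); rewrite mulr_ge0 ?exprn_ge0 ?fro_ge0.
have := acc k; have := sum_tau k; move: h.
rewrite !ler_norml => /andP[h1 h2] h3 /andP[h4 h5].
by apply/andP; split; lra.
Qed.

End Chaining.

(** * The mean determinant of a shifted Gaussian Gram matrix *)

Section DetMean.
Context {R : realType}.
Local Notation C := (R[i]).
Local Notation "a %:CR" := (Complex a 0) (at level 2, format "a %:CR").
Local Notation re := complex.Re.
Local Notation im := complex.Im.

Definition gram m n (X : 'M[C]_(m, n)) : 'M[C]_m := X *m ctr X.

Lemma gram_row m n p (X : 'M[C]_(m, n)) (Y : 'M[C]_(m, p)) : gram (row_mx X Y) = gram X + gram Y.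
Proof.
rewrite /gram -mul_row_col; congr (_ *m _).
by apply/matrixP => i j; rewrite ctrE; have [l ->|l ->] := split_ordP i;
  rewrite ?row_mxEl ?row_mxEr ?col_mxEu ?col_mxEd ctrE.
Qed.

(** The block matrix [Z] is factored twice, with either diagonal block as pivot. *)
Lemma det_rank1 (K : fieldType) d (x : 'M[K]_(d, 1)) (y : 'M[K]_(1, d)) :
  \det (1%:M + x *m y) = 1 + (y *m x) 0 0.
Proof.
pose Z := block_mx (1%:M : 'M[K]_1) (- y) x (1%:M : 'M[K]_d).
have e1 : Z = block_mx 1%:M 0 x 1%:M *m block_mx 1%:M (- y) 0 (1%:M + x *m y).
  rewrite mulmx_block !mul1mx !mul0mx ?mulmx1 ?mulmx0 !addr0 mulmxN.
  by rewrite [- _ + _]addrC addrK.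
have e2 : Z = block_mx 1%:M (- y) 0 1%:M *m block_mx (1%:M + y *m x) 0 x 1%:M.
  by rewrite mulmx_block !mul1mx !mul0mx !mulmx1 ?mulmx0 !add0r mulNmx addrK.
have := e1; rewrite e2 => /(congr1 (fun M => \det M)).
rewrite !det_mulmx !det_ublock !det_lblock !det1 !mul1r !mulr1 => <-.
by rewrite det_mx11 !mxE eqxx.
Qed.

Definition fac n (x : 'I_n -> R) : {poly R} := \prod_i ('X + (x i)%:P).
Definition fac' n (x : 'I_n -> R) i : {poly R} := \prod_(j | j != i) ('X + (x j)%:P).

Lemma fac_deriv n (x : 'I_n -> R) : (fac x)^`() = \sum_i fac' x i.
Proof.
suff gen (r : seq 'I_n) : uniq r -> (\prod_(i <- r) ('X + (x i)%:P))^`() =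
    \sum_(i <- r) \prod_(j <- r | j != i) ('X + (x j)%:P).
  by rewrite /fac gen ?index_enum_uniq.
elim: r => [|i r IH] /=; first by rewrite !big_nil derivC.
move=> /andP[ir ur]; rewrite !big_cons derivM derivD derivX derivC addr0 mul1r eqxx /=; congr (_ + _).
  by rewrite big_seq_cond [RHS]big_seq_cond; apply: eq_bigl => j; case: eqP => [->|]; rewrite ?andbT // (negbTE ir).
rewrite IH // mulr_sumr big_seq_cond [RHS]big_seq_cond; apply: eq_bigr => j /andP[jr _].
by rewrite big_cons; case: eqP => // ij; rewrite -ij in jr; rewrite jr in ir.
Qed.

Lemma fac_horner n (x : 'I_n -> R) u : (fac x).[u] = \prod_i (u + x i).
Proof. by rewrite horner_prod; apply: eq_bigr => i _; rewrite !hornerE. Qed.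

Lemma realC_prod n (f : 'I_n -> R) : \prod_i (f i)%:CR = (\prod_i f i)%:CR.
Proof.
elim: n f => [|n IH] f; first by rewrite !big_ord0.
by rewrite !big_ord_recl IH; apply: complex_ext => /=; ring.
Qed.

Lemma det_shift n (A : 'M[C]_n) u : hermitian A ->
  \det (u%:CR%:M + A) = (\prod_i (u + eigs A i))%:CR.
Proof.
move=> hA; have e := spectral_decomp hA; have uU := spectral_unitary A.
set U := spectralmx A in e uU.
have e2 : U *m (u%:CR%:M + A) = rdiag (fun i => u + eigs A i) *m U.
  rewrite mulmxDr e mul_mx_scalar -mul_scalar_mx -mulmxDl; congr (_ *m _).
  apply/matrixP => i j; rewrite !mxE; case: (i == j); rewrite ?mulr1n ?mulr0n ?addr0 //.
  by apply: complex_ext => /=; ring.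
have dU : \det U != 0.
  have [h _] := uU; have := congr1 (fun M => \det M) h; rewrite det_mulmx det1 => /eqP.
  by apply: contraTneq => ->; rewrite mul0r eq_sym oner_eq0.
have := congr1 (fun M => \det M) e2; rewrite !det_mulmx mulrC => /(mulIf dU) ->.
rewrite /rdiag det_diag (eq_bigr (fun i => (u + eigs A i)%:CR)) => [|i _]; last by rewrite mxE.
by rewrite realC_prod.
Qed.

Lemma rdiag_mulE m n (x : 'I_m -> R) (Y : 'M[C]_(m, n)) i j : (rdiag x *m Y) i j = (x i)%:CR * Y i j.
Proof.
rewrite mxE (bigD1 i) //= big1 ?addr0 => [|l li]; last by rewrite rdiagE eq_sym (negbTE li) mulr0n mul0r.
by rewrite rdiagE eqxx mulr1n.
Qed.

Lemma hermitianD n (A B : 'M[C]_n) : hermitian A -> hermitian B -> hermitian (A + B).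
Proof. by rewrite /hermitian ctr_add => -> ->. Qed.

Lemma poly_eq_pos (p q : {poly R}) : (forall u, 0 < u -> p.[u] = q.[u]) -> p = q.
Proof.
move=> h; apply/eqP; rewrite -subr_eq0; apply/negPn/negP => pq.
pose rs := [seq (i.+1)%:R : R | i <- iota 0 (size (p - q))].
have h1 : all (root (p - q)) rs.
  by apply/allP => x /mapP[i _ ->]; rewrite rootE !hornerE h ?subrr // ltr0n.
have h2 : uniq rs by rewrite map_inj_uniq ?iota_uniq // => i j /eqP; rewrite eqr_nat => /eqP [].
by have := max_poly_roots pq h1 h2; rewrite size_map size_iota ltnn.
Qed.

(** In the eigenbasis the matrix is diagonal plus rank one, so [det_rank1] applies where the
    diagonal is invertible, in particular at every u > 0; infinitely many points suffice for an
    identity of polynomials. *)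
Lemma fac_rank1 n m (X : 'M[C]_(n, m)) (w : 'cV[C]_n) :
  fac (eigs (gram X + gram w)) =
  fac (eigs (gram X)) + \sum_i nsq ((spectralmx (gram X) *m w) i 0) *: fac' (eigs (gram X)) i.
Proof.
set A := gram X; have hA : hermitian A by exact: hermitian_gram.
have hB : hermitian (A + gram w) by apply: hermitianD => //; exact: hermitian_gram.
apply: poly_eq_pos => u u0.
rewrite hornerD fac_horner horner_sum.
apply: (@complexI R); rewrite -[LHS]/((\prod_i (u + eigs (A + gram w) i))%:CR) -det_shift //.
have e := spectral_decomp hA; have uU := spectral_unitary A.
set U := spectralmx A in e uU *; have [u1 u2] := uU.
pose D := rdiag (fun i => u + eigs A i).
have l0 i : 0 < u + eigs A i by have := eigs_gram_ge0 X i; rewrite -/(gram X) -/A; lra.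
pose D' := rdiag (fun i => (u + eigs A i)^-1).
have DD : D *m D' = 1%:M.
  apply/matrixP => i j; rewrite mxE (bigD1 i) //= big1 ?addr0 => [|l li].
    rewrite !rdiagE eqxx mulr1n mxE; case: (i == j); rewrite ?mulr1n ?mulr0n ?mulr0 //.
    by apply: complex_ext => /=; rewrite ?mulfV ?gt_eqF //; ring.
  by rewrite rdiagE eq_sym (negbTE li) mulr0n mul0r.
pose z := U *m w.
have e2 : U *m (u%:CR%:M + A) = D *m U.
  rewrite mulmxDr e mul_mx_scalar -mul_scalar_mx -mulmxDl; congr (_ *m _).
  apply/matrixP => i j; rewrite !mxE; case: (i == j); rewrite ?mulr1n ?mulr0n ?addr0 //.
  by apply: complex_ext => /=; ring.
have e3 : U *m (u%:CR%:M + (A + gram w)) *m ctr U = D *m (1%:M + (D' *m z) *m ctr z).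
  rewrite addrA [in LHS]mulmxDr [in LHS]mulmxDl e2 -[D *m U *m _]mulmxA u1 mulmx1 [RHS]mulmxDr mulmx1 [in RHS]mulmxA [D *m (D' *m _)]mulmxA DD mul1mx.
  by rewrite /gram /z ctr_mul !mulmxA.
have dU : \det U * \det (ctr U) = 1 by rewrite -det_mulmx u1 det1.
have := congr1 (fun M => \det M) e3; rewrite !det_mulmx mulrAC dU mul1r => ->.
have -> : \det D = (\prod_i (u + eigs A i))%:CR.
  rewrite /D /rdiag det_diag (eq_bigr (fun i => (u + eigs A i)%:CR)) => [|i _]; last by rewrite mxE.
  by rewrite realC_prod.
rewrite det_rank1.
have -> : (ctr z *m (D' *m z)) 0 0 = (\sum_i nsq (z i 0) / (u + eigs A i))%:CR.
  apply: complex_ext; rewrite mxE ?re_sum ?im_sum /=.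
    by apply: eq_bigr => i _; rewrite ctrE rdiag_mulE re_mul re_mul im_mul /= re_conj im_conj /nsq; ring.
  by apply: big1 => i _; rewrite ctrE rdiag_mulE im_mul re_mul im_mul /= re_conj im_conj; ring.
apply: complex_ext => /=; last by ring.
rewrite mul0r subr0 mulrDr mulr1 fac_horner; congr (_ + _); rewrite mulr_sumr; apply: eq_bigr => i _.
rewrite hornerZ -/z (bigD1 i) //= /fac' horner_prod.
under [in RHS]eq_bigr do rewrite !hornerE.
by field; rewrite gt_eqF ?l0.
Qed.

Definition Lop N (p : {poly R}) : {poly R} := iter N (fun q => q + q^`()) p.

Lemma LopD N p q : Lop N (p + q) = Lop N p + Lop N q.
Proof. by elim: N => [|N IH] //=; rewrite IH derivD addrACA. Qed.

Lemma LopZ N a p : Lop N (a *: p) = a *: Lop N p.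
Proof. by elim: N => [|N IH] //=; rewrite IH derivZ scalerDr. Qed.

Lemma Lop0 N : Lop N 0 = 0.
Proof. by elim: N => [|N IH] //=; rewrite IH deriv0 addr0. Qed.

Lemma Lop_sum N n (f : 'I_n -> {poly R}) : Lop N (\sum_i f i) = \sum_i Lop N (f i).
Proof. by rewrite (big_morph (Lop N) (LopD N) (Lop0 N)). Qed.

Lemma LopS N p : Lop N.+1 p = Lop N (p + p^`()).
Proof. by rewrite /Lop iterSr. Qed.

(** Preserved by [Lop], this gives nonnegative values at u >= 0, so expectations can be distributed
    over sums of nonnegative terms. *)
Definition nnegp (p : {poly R}) := forall i, 0 <= p`_i.

Lemma nnegpD p q : nnegp p -> nnegp q -> nnegp (p + q).
Proof. by move=> hp hq i; rewrite coefD addr_ge0. Qed.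

Lemma nnegpM p q : nnegp p -> nnegp q -> nnegp (p * q).
Proof. by move=> hp hq i; rewrite coefM sumr_ge0 // => j _; rewrite mulr_ge0. Qed.

Lemma nnegp_deriv p : nnegp p -> nnegp p^`().
Proof. by move=> hp i; rewrite coef_deriv mulrn_wge0. Qed.

Lemma nnegpX : nnegp 'X.
Proof. by move=> i; rewrite coefX; case: eqP. Qed.

Lemma nnegpC c : 0 <= c -> nnegp c%:P.
Proof. by move=> c0 i; rewrite coefC; case: eqP. Qed.

Lemma Lop_nneg N p : nnegp p -> nnegp (Lop N p).
Proof. by move=> hp; elim: N => [|N IH] //=; apply: nnegpD => //; exact: nnegp_deriv. Qed.

Lemma nneg_horner (p : {poly R}) u : nnegp p -> 0 <= u -> 0 <= p.[u].
Proof.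
by move=> hp u0; rewrite horner_coef; apply: sumr_ge0 => i _; rewrite mulr_ge0 ?exprn_ge0.
Qed.

Lemma prod_nneg n (P : pred 'I_n) (x : 'I_n -> R) : (forall j, 0 <= x j) ->
  nnegp (\prod_(j | P j) ('X + (x j)%:P)).
Proof.
move=> x0; apply: (big_ind nnegp); [exact: (nnegpC ler01) | exact: nnegpM |].
by move=> j _; apply: nnegpD; [exact: nnegpX | exact: nnegpC].
Qed.

Lemma fro_continuousC n : fcontinuous (@fro R n 1).
Proof. exact: fro_continuous. Qed.

(** The exponential moments are known, and 1 + y <= exp y at y = a |z|^2 and y = - a |z|^2 squeezes
    the mean as a tends to 0. *)
Lemma EG_fro1 : EG (2 * 1) (fun v => (fro (cvec_of 1 v))%:E) = (1 : R)%:E.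
Proof.
set Y := EG _ _.
have mY : measurable_fun setT (fun v : Om R => (fro (cvec_of 1 v))%:E).
  exact: (@fcont_meas_C R 1 _ EFin (@fro_continuousC 1) measurable_EFin_id).
have mE (a : R) : measurable_fun setT (fun v : Om R => (expR (a * fro (cvec_of 1 v)))%:E).
  apply: (@fcont_meas_C R 1 _ (fun y => (expR (a * y))%:E) (@fro_continuousC 1)).
  by apply/measurable_EFinP; apply: measurableT_comp => //; apply: measurable_funM.
have eE (a : R) : a < 1 -> EG (2 * 1) (fun v => (expR (a * fro (cvec_of 1 v)))%:E) = ((1 - a)^-1)%:E.
  move=> a1; have := @EG_expC R 1 0 0.
  have := @EG_expC R 1 a 0 a1.
  have -> : fro (0 : 'cV[C]_1) = 0 by rewrite fro_col big1 // => i _; rewrite mxE /nsq /= expr0n addr0.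
  rewrite mul0r expR0 mulr1 expr1 => <- _; apply: eq_itI => v _.
  by rewrite fdot_col big1 ?mulr0 ?addr0 // => i _; rewrite mxE /cdot /= !mul0r addr0.
have f0 v : 0 <= fro (cvec_of 1 v : 'cV[C]_1) by exact: fro_ge0.
have up (a : R) : 0 < a -> a < 1 -> (1 + a%:E * Y <= ((1 - a)^-1)%:E)%E.
  move=> a0 a1; rewrite -eE // /Y -(@EG_Zr _ _ (fun v => fro (cvec_of 1 v))) ?(ltW a0) //.
  rewrite -(@EG_cst _ (2 * 1) 1) // -(@EG_Dr _ _ (fun=> 1) (fun v => a * fro (cvec_of 1 v))) //; last 2 first.
  - by apply/measurable_EFinP; apply: measurable_funM => //; apply/measurable_EFinP.
  - by move=> v; rewrite mulr_ge0 // ltW.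
  by apply: le_EG => v; [rewrite addr_ge0 // mulr_ge0 // ltW | exact: expR_ge1Dx].
have lo (a : R) : 0 < a -> (1 <= ((1 + a)^-1)%:E + a%:E * Y)%E.
  move=> a0; rewrite -[in X in (_ <= X + _)%E](opprK a) -eE; last by lra.
  rewrite /Y -(@EG_Zr _ _ (fun v => fro (cvec_of 1 v))) ?(ltW a0) //.
  rewrite -(@EG_Dr _ _ (fun v => expR (- a * fro (cvec_of 1 v))) (fun v => a * fro (cvec_of 1 v))) //; last 2 first.
  - by apply/measurable_EFinP; apply: measurable_funM => //; apply/measurable_EFinP.
  - by move=> v; rewrite mulr_ge0 // ltW.
  rewrite -(@EG_cst _ (2 * 1) 1) //; apply: le_EG => v //.
  by have := expR_ge1Dx (- a * fro (cvec_of 1 v : 'cV[C]_1)); lra.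
have Y0 : (0 <= Y)%E by apply: itI_ge0 => v; rewrite lee_fin.
have : Y \is a fin_num.
  rewrite ge0_fin_numE // ltNge leye_eq; apply/negP => /eqP Yoo.
  have h1 : (0 : R) < 2^-1 by lra.
  have h2 : (2^-1 : R) < 1 by lra.
  by have := up _ h1 h2; rewrite Yoo gt0_muley ?lte_fin // addey // leye_eq.
move=> /fineK; move: (fine Y) => y yE; rewrite -yE in up lo *.
congr EFin; apply/eqP; rewrite eq_le; apply/andP; split.
  apply/ler_addgt0Pr => e e0.
  pose a : R := e / (1 + e).
  have a0 : 0 < a by rewrite divr_gt0 //; lra.
  have a1 : a < 1 by rewrite ltr_pdivrMr; lra.
  have := up a a0 a1; rewrite -EFinM -EFinD lee_fin.
  have -> : (1 - a)^-1 = 1 + e :> R.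
    by rewrite (_ : 1 - a = (1 + e)^-1) ?invrK // /a; field; rewrite gt_eqF //; lra.
  rewrite -subr_ge0 => h; rewrite -(ler_pM2l a0); have -> : a * (1 + e) = e :> R by rewrite /a mulfVK // gt_eqF //; lra.
  lra.
apply/ler_addgt0Pr => e e0.
have := lo e e0; rewrite -EFinM -EFinD lee_fin.
have : (1 + e)^-1 * (1 + e) = 1 :> R by rewrite mulVf // gt_eqF //; lra.
have : 0 < (1 + e)^-1 :> R by rewrite invr_gt0; lra.
move: (1 + e)^-1 => i i0 hi h.
have h1 : i <= y by rewrite -(ler_pM2l e0); lra.
have h2 : 0 <= e * i by rewrite mulr_ge0 // ltW.
have h3 : i <= 1 by lra.
by have : e * i <= e * 1 by [rewrite ler_wpM2l // ltW|]; lra.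
Qed.

Lemma EG_row n (a : 'M[C]_(1, n)) : a *m ctr a = 1%:M ->
  EG (2 * n) (fun v => (nsq ((a *m cvec_of n v) 0 0))%:E) = 1%:E.
Proof.
move=> ha; rewrite -EG_fro1.
have h := @EG_coisometryC R 1 n a (fun c => (fro c)%:E) ha.
rewrite -h.
- by apply: eq_itI => v _; rewrite fro_col big_ord_recl big_ord0 addr0; congr (nsq (_ _ _))%:E; apply/val_inj.
- exact: (@fcont_meas_C R 1 _ EFin (@fro_continuousC 1) measurable_EFin_id).
- by move=> c; rewrite lee_fin fro_ge0.
Qed.

Definition measCx (f : Om R -> C) :=
  measurable_fun setT (fun v : Om R => re (f v) : measurableTypeR R) /\
  measurable_fun setT (fun v : Om R => im (f v) : measurableTypeR R).

Lemma measCxD f g : measCx f -> measCx g -> measCx (fun v => f v + g v).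
Proof.
move=> [f1 f2] [g1 g2]; split; [under eq_fun do rewrite re_add | under eq_fun do rewrite im_add];
  exact: measurable_funD.
Qed.

Lemma measCxM f g : measCx f -> measCx g -> measCx (fun v => f v * g v).
Proof.
move=> [f1 f2] [g1 g2]; split; [under eq_fun do rewrite re_mul | under eq_fun do rewrite im_mul].
  by apply: measurable_funB; exact: measurable_funM.
by apply: measurable_funD; exact: measurable_funM.
Qed.

Lemma measCx_conj f : measCx f -> measCx (fun v => Num.conj (f v)).
Proof.
move=> [f1 f2]; split; [under eq_fun do rewrite re_conj | under eq_fun do rewrite im_conj] => //.
exact: measurableT_comp.
Qed.

Lemma measCx_cst c : measCx (fun=> c).
Proof. by split; exact: measurable_cst. Qed.

Lemma measCx_sum (I : Type) (r : seq I) (P : pred I) (f : I -> Om R -> C) : (forall i, measCx (f i)) ->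
  measCx (fun v => \sum_(i <- r | P i) f i v).
Proof.
move=> mf; elim: r => [|i r IH].
  by under eq_fun do rewrite big_nil; exact: measCx_cst.
have := measCxD (mf i) IH; case Pi: (P i).
  by under [X in _ -> measCx X]eq_fun do rewrite big_cons Pi.
by move=> _; under eq_fun do rewrite big_cons Pi.
Qed.

Lemma measCx_prod (I : Type) (r : seq I) (P : pred I) (f : I -> Om R -> C) : (forall i, measCx (f i)) ->
  measCx (fun v => \prod_(i <- r | P i) f i v).
Proof.
move=> mf; elim: r => [|i r IH].
  by under eq_fun do rewrite big_nil; exact: measCx_cst.
have := measCxM (mf i) IH; case Pi: (P i).
  by under [X in _ -> measCx X]eq_fun do rewrite big_cons Pi.
by move=> _; under eq_fun do rewrite big_cons Pi.
Qed.

Lemma measCx_det n (A : Om R -> 'M[C]_n) : (forall i j, measCx (fun v => A v i j)) ->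
  measCx (fun v => \det (A v)).
Proof.
move=> mA; rewrite /determinant; apply: measCx_sum => s; apply: measCxM; first exact: measCx_cst.
by apply: measCx_prod => i.
Qed.

Lemma measCx_gram m n (X : Om R -> 'M[C]_(m, n)) : (forall i j, measCx (fun v => X v i j)) ->
  forall i j, measCx (fun v => gram (X v) i j).
Proof.
move=> mX i j; rewrite /gram; under eq_fun do rewrite mxE; apply: measCx_sum => k.
by apply: measCxM => //; under eq_fun do rewrite ctrE; exact: measCx_conj.
Qed.

Lemma measCx_cvec n i j : measCx (fun v => cvec_of n v i j).
Proof. by split; under eq_fun do rewrite mxE /=; exact: measurable_nth. Qed.

Lemma measCxDmx n m (A B : Om R -> 'M[C]_(n, m)) : (forall i j, measCx (fun v => A v i j)) ->
  (forall i j, measCx (fun v => B v i j)) -> forall i j, measCx (fun v => (A v + B v) i j).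
Proof. by move=> mA mB i j; under eq_fun do rewrite mxE; exact: measCxD. Qed.

Lemma measurable_fac n (X : Om R -> 'M[C]_n) u : (forall v, hermitian (X v)) ->
  (forall i j, measCx (fun v => X v i j)) ->
  measurable_fun setT (fun v : Om R => ((fac (eigs (X v))).[u])%:E).
Proof.
move=> hX mX; apply/measurable_EFinP.
have [h _] : measCx (fun v => \det (u%:CR%:M + X v)).
  apply: measCx_det; apply: measCxDmx => // i j; exact: measCx_cst.
rewrite (_ : (fun v => _) = (fun v : Om R => re (\det (u%:CR%:M + X v)))) //.
by apply/funext => v; rewrite fac_horner det_shift.
Qed.

(** Splits off the first column of a Gaussian d x (N + 1) matrix: [B] permutes the entries so that
    this column comes first, and a permutation is a coisometry. *)
Lemma EG_peel d N (h : 'M[C]_d -> \bar R) : (forall A, (0 <= h A)%E) ->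
  meas_C (fun z : 'cV[C]_(d + d * N) => h (gram (usubmx z) + gram (mat (dsubmx z)))) ->
  EG (2 * (d * N.+1)) (fun v => h (gram (mat (cvec_of (d * N.+1) v)))) =
  EG (2 * d) (fun w => EG (2 * (d * N)) (fun v => h (gram (cvec_of d w) + gram (mat (cvec_of (d * N) v))))).
Proof.
move=> h0 mF; set F := (X in meas_C X) in mF.
have [g gK1 gK2] := curry_mxvec_bij d N.
pose sg (r : 'I_(d + d * N)) : 'I_(d * N.+1) :=
  match fintype.split r with inl a => mxvec_index a ord0 | inr k => mxvec_index (g k).1 (lift ord0 (g k).2) end.
pose B : 'M[C]_(d + d * N, d * N.+1) := \matrix_(r, c) (c == sg r)%:R.
have Bmul c r : (B *m c) r 0 = c (sg r) 0 :> C.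
  rewrite mxE (bigD1 (sg r)) //= big1 ?addr0 => [|l hl]; first by rewrite mxE eqxx mul1r.
  by rewrite mxE (negbTE hl) mul0r.
have mvi (a a' : 'I_d) (b b' : 'I_N.+1) : mxvec_index a b = mxvec_index a' b' -> (a, b) = (a', b').
  have [g' g1 g2] := curry_mxvec_bij d N.+1.
  by move=> e; have := congr1 g' e; rewrite (g1 (a, b) isT) (g1 (a', b') isT).
have sgI : injective sg.
  move=> r r'; rewrite /sg; have [a ->|k ->] := split_ordP r; have [a' ->|k' ->] := split_ordP r'.
  - by move=> /mvi [->].
  - by move=> /mvi /(congr1 (fun p => val p.2)).
  - by move=> /mvi /(congr1 (fun p => val p.2)).
  - move=> /mvi e; have h1 := congr1 fst e; have /lift_inj h2 := congr1 snd e; rewrite /= in h1 h2; congr rshift; rewrite -(gK2 k) // -(gK2 k') //.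
    by rewrite (surjective_pairing (g k)) (surjective_pairing (g k')) h1 h2.
have oB : B *m ctr B = 1%:M.
  apply/matrixP => r r'; rewrite mxE (bigD1 (sg r)) //= big1 ?addr0 => [|l hl]; last first.
    by rewrite mxE (negbTE hl) mul0r.
  by rewrite ctrE !mxE eqxx mul1r (inj_eq sgI); case: (r == r'); rewrite ?rmorph1 ?rmorph0.
transitivity (EG (2 * (d * N.+1)) (fun v => F (B *m cvec_of (d * N.+1) v))).
  apply: eq_itI => v _; rewrite /F; congr h; set c := cvec_of _ v.
  apply/matrixP => i j; rewrite !mxE big_ord_recl; congr (_ + _).
    rewrite big_ord_recl big_ord0 addr0 !ctrE.
    rewrite [in RHS](_ : usubmx _ i _ = (B *m c) (lshift _ i) 0); last by rewrite !mxE ord1.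
    rewrite [in RHS](_ : usubmx _ j _ = (B *m c) (lshift _ j) 0); last by rewrite !mxE ord1.
    by rewrite !Bmul /sg !(unsplitK (inl _)) !mxE.
  apply: eq_bigr => b _; rewrite !ctrE.
  have E a : mat (dsubmx (B *m c)) a b = c (mxvec_index a (lift ord0 b)) 0.
    rewrite mxE (_ : dsubmx _ _ _ = (B *m c) (rshift _ (mxvec_index a b)) 0); last by rewrite !mxE.
    by rewrite Bmul /sg (unsplitK (inr _)) (gK1 (a, b) isT).
  by rewrite !E !mxE.
rewrite (EG_coisometryC oB mF) => [|c]; last exact: h0.
by rewrite EG_cat; apply: eq_itI => w _; apply: eq_itI => v _; rewrite /F col_mxKu col_mxKd.
Qed.

(** Adding a Gaussian column acts in mean as 1 + D: the weights in [fac_rank1] are squared moduli of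
    unit Gaussian coordinates, of mean 1, and the polynomials they multiply sum to the
    derivative. *)
Lemma EG_Lop_step d m (X : 'M[C]_(d, m)) N u : 0 <= u ->
  EG (2 * d) (fun w => ((Lop N (fac (eigs (gram X + gram (cvec_of d w))))).[u])%:E) =
  ((Lop N.+1 (fac (eigs (gram X)))).[u])%:E.
Proof.
move=> u0; set U := spectralmx (gram X); have [u1 u2] := spectral_unitary (gram X).
pose c i := (Lop N (fac' (eigs (gram X)) i)).[u].
have e0 j : 0 <= eigs (gram X) j by exact: eigs_gram_ge0.
have c0 i : 0 <= c i by apply: nneg_horner => //; apply: Lop_nneg; exact: prod_nneg.
have f0 : 0 <= (Lop N (fac (eigs (gram X)))).[u].
  by apply: nneg_horner => //; apply: Lop_nneg; exact: prod_nneg.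
have mN i : measurable_fun setT (fun w : Om R => (nsq ((U *m cvec_of d w) i 0))%:E).
  apply/measurable_EFinP.
  have [h1 h2] : measCx (fun w => (U *m cvec_of d w) i 0).
    by under eq_fun do rewrite mxE; apply: measCx_sum => k; apply: measCxM; [exact: measCx_cst | exact: measCx_cvec].
  by rewrite /nsq; apply: measurable_funD; apply: measurable_funX.
transitivity (EG (2 * d) (fun w => ((Lop N (fac (eigs (gram X)))).[u] +
    \sum_i c i * nsq ((U *m cvec_of d w) i 0))%:E)).
  apply: eq_itI => w _; rewrite fac_rank1 LopD Lop_sum hornerD horner_sum; congr (_ + _)%:E.
  by apply: eq_bigr => i _; rewrite LopZ hornerZ mulrC.
rewrite (@EG_Dr _ _ (fun=> (Lop N (fac (eigs (gram X)))).[u]) (fun w => \sum_i c i * nsq ((U *m cvec_of d w) i 0))) //; last 2 first.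
- apply/measurable_EFinP; apply: measurable_sum => i; apply: measurable_funM => //; apply/measurable_EFinP; exact: mN.
- by move=> w; apply: sumr_ge0 => i _; rewrite mulr_ge0 ?nsq_ge0.
rewrite EG_cst // LopS LopD hornerD EFinD; congr (_ + _)%E.
rewrite fac_deriv Lop_sum horner_sum -sumEFin.
transitivity (EG (2 * d) (fun w => (\sum_i (c i * nsq ((U *m cvec_of d w) i 0))%:E)%E)).
  by apply: eq_itI => w _; rewrite sumEFin.
rewrite (@EG_bigsum _ _ _ _ _ (fun i (w : Om R) => (c i * nsq ((U *m cvec_of d w) i 0))%:E)); last 2 first.
- move=> i; apply/measurable_EFinP; apply: measurable_funM => //; apply/measurable_EFinP; exact: mN.
- by move=> i w; rewrite lee_fin mulr_ge0 ?nsq_ge0.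
apply: eq_bigr => i _; rewrite EG_Zr //; last by move=> w; exact: nsq_ge0.
rewrite (_ : EG _ _ = 1%:E) ?mule1 //.
have ha : row i U *m ctr (row i U) = 1%:M.
  apply/matrixP => a b; rewrite !ord1.
  have /matrixP/(_ i i) := u1; rewrite !mxE !eqxx => <-.
  by apply: eq_bigr => k _; rewrite !ctrE !mxE.
rewrite -(EG_row ha); apply: eq_itI => v _; congr (nsq _)%:E.
by rewrite !mxE; apply: eq_bigr => k _; rewrite !mxE.
Qed.

Lemma EG_Lop d N m (X : 'M[C]_(d, m)) u : 0 <= u ->
  EG (2 * (d * N)) (fun v => ((fac (eigs (gram X + gram (mat (cvec_of (d * N) v))))).[u])%:E) =
  ((Lop N (fac (eigs (gram X)))).[u])%:E.
Proof.
move=> u0; elim: N m X => [|N IH] m X.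
  have f0 : 0 <= (fac (eigs (gram X))).[u].
    by apply: nneg_horner => //; apply: prod_nneg => j; exact: eigs_gram_ge0.
  rewrite -[RHS](EG_cst (2 * (d * 0))) //; apply: eq_itI => v _.
  by rewrite (_ : gram (mat _) = 0) ?addr0 //; apply/matrixP => i j; rewrite !mxE big_ord0.
(* The absolute value makes [h] nonnegative on all matrices, as [EG_peel] requires, and changes
   nothing on Gram matrices. *)
pose h A := (`|(fac (eigs (gram X + A))).[u]|)%:E.
have hE p (Y : 'M[C]_(d, p)) : h (gram Y) = ((fac (eigs (gram (row_mx X Y)))).[u])%:E.
  rewrite /h -gram_row ger0_norm //.
  by apply: nneg_horner => //; apply: prod_nneg => j; exact: eigs_gram_ge0.
transitivity (EG (2 * (d * N.+1)) (fun v => h (gram (mat (cvec_of (d * N.+1) v))))).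
  by apply: eq_itI => v _; rewrite hE gram_row.
rewrite EG_peel.
- rewrite -EG_Lop_step //; apply: eq_itI => w _.
  rewrite -gram_row -IH; apply: eq_itI => v _.
  by rewrite -gram_row hE !gram_row addrA.
- by move=> A; rewrite lee_fin.
- rewrite /meas_C /h; apply/measurable_EFinP; apply: measurableT_comp => //; apply/measurable_EFinP.
  apply: measurable_fac.
    by move=> v; rewrite -!gram_row; exact: hermitian_gram.
  apply: measCxDmx => [i j|]; first exact: measCx_cst.
  apply: measCxDmx; apply: measCx_gram => i j.
    by under eq_fun do rewrite mxE; exact: measCx_cvec.
  by under eq_fun do rewrite mxE mxE; exact: measCx_cvec.
Qed.

Lemma eigs0 d (i : 'I_d) : eigs (0 : 'M[C]_d) i = 0.
Proof.
have e0 : gram (0 : 'M[C]_(d, 1)) = 0 by rewrite /gram mul0mx.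
by rewrite -{1}e0 eigs_gram mulmx0 /rn big1 // => j _; rewrite mxE /nsq /= expr0n addr0.
Qed.

Lemma expR_Fln d (u : R) (g : 'cV[C]_(d * d)) : 0 < u ->
  expR (Fpsi (fun x => ln (x + u)) g) = (fac (eigs (gram (mat g)))).[u].
Proof.
move=> u0; rewrite /Fpsi /spf expR_sum fac_horner; apply: eq_bigr => i _.
by rewrite lnK ?posrE addrC //; have := eigs_gram_ge0 (mat g) i; rewrite -/(gram _); lra.
Qed.

Lemma EG_det d (u : R) : 0 < u ->
  EG (2 * (d * d)) (fun v => (expR (Fpsi (fun x => ln (x + u)) (cvec_of (d * d) v)))%:E) =
  ((Lop d 'X^d).[u])%:E.
Proof.
move=> u0; have e0 : gram (0 : 'M[C]_(d, 1)) = 0 by rewrite /gram mul0mx.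
have := @EG_Lop d d 1 0 u (ltW u0); rewrite e0.
rewrite (_ : fac (eigs 0) = 'X^d); last first.
  by rewrite /fac (eq_bigr (fun=> 'X)) ?prodr_const ?card_ord // => i _; rewrite eigs0 addr0.
by move=> <-; apply: eq_itI => v _; rewrite add0r expR_Fln.
Qed.

Lemma EG_fro n : EG (2 * n) (fun v => (fro (cvec_of n v))%:E) = (n%:R : R)%:E.
Proof.
transitivity (EG (2 * n) (fun v : seq R => (\sum_(i < n) (nsq (cvec_of n v i 0 : C))%:E)%E)).
  by apply: eq_itI => v _; rewrite sumEFin fro_col.
have mN i : measurable_fun setT (fun w : Om R => (nsq (cvec_of n w i 0 : C))%:E).
  apply/measurable_EFinP; have [h1 h2] := @measCx_cvec n i 0.
  by rewrite /nsq; apply: measurable_funD; apply: measurable_funX.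
rewrite EG_bigsum => [|//|i v]; last by rewrite lee_fin nsq_ge0.
rewrite (eq_bigr (fun=> 1%:E)) => [|i _].
  by rewrite sumEFin sumr_const card_ord.
have ha : (delta_mx 0 i : 'M[C]_(1, n)) *m ctr (delta_mx 0 i) = 1%:M.
  apply/matrixP => a b; rewrite !ord1 mul_ctr_diag (_ : rn _ _ = 1) ?mxE //.
  rewrite /rn (bigD1 i) //= big1 => [|k ki]; rewrite mxE ?(negbTE ki) ?eqxx /nsq /=.
    by rewrite expr1n expr0n !addr0.
  by rewrite expr0n addr0.
rewrite -(EG_row ha); apply: eq_itI => v _; congr (nsq _)%:E.
by rewrite -rowE [RHS]mxE.
Qed.

End DetMean.

(** * Derivatives of functions of one real variable *)

Section Calculus.
Context {R : realType}.

Definition isd (f : R -> R) (x l : R) := is_derive (x : R^o) (1 : R^o) (f : R^o -> R^o) (l : R^o).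

Lemma isd_eq f x l l' : isd f x l -> l = l' -> isd f x l'.
Proof. by move=> h <-. Qed.

Lemma isdC c x : isd (fun=> c) x 0.
Proof. exact: is_derive_cst. Qed.

Lemma isdI x : isd id x 1.
Proof. exact: is_derive_id. Qed.

Lemma isdD f g x a b : isd f x a -> isd g x b -> isd (fun y => f y + g y) x (a + b).
Proof. by move=> h1 h2; exact: is_deriveD. Qed.

Lemma isdB f g x a b : isd f x a -> isd g x b -> isd (fun y => f y - g y) x (a - b).
Proof. by move=> h1 h2; exact: is_deriveB. Qed.

Lemma isdM f g x a b : isd f x a -> isd g x b -> isd (fun y => f y * g y) x (a * g x + f x * b).
Proof.
move=> h1 h2; have h := @is_deriveM R R^o f g x 1 a b h1 h2.
by apply: (isd_eq h); rewrite /GRing.scale /=; ring.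
Qed.

Lemma isdV f x a : isd f x a -> f x != 0 -> isd (fun y => (f y)^-1) x (- a / f x ^+ 2).
Proof.
move=> h1 fx; have h := @is_deriveV R f x a 1 fx h1.
by apply: (isd_eq h); rewrite /GRing.scale /=; ring.
Qed.

Lemma isd_comp f g x a b : isd g x b -> isd f (g x) a -> isd (fun y => f (g y)) x (a * b).
Proof. by move=> h1 h2; exact: (is_derive1_comp h2 h1). Qed.

Lemma isd_ln f x a : isd f x a -> 0 < f x -> isd (fun y => ln (f y)) x (a / f x).
Proof.
move=> h1 fx; have h := isd_comp h1 (is_derive1_ln fx).
by apply: (isd_eq h); rewrite mulrC.
Qed.

Lemma isd_poly (p : {poly R}) f x a : isd f x a -> isd (fun y => p.[f y]) x (p^`().[f x] * a).
Proof. by move=> h1; exact: (isd_comp h1 (is_derive_poly p (f x))). Qed.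

Lemma isd_mono f df (a b : R) : a <= b -> (forall x, a <= x <= b -> isd f x (df x)) ->
  (forall x, a <= x <= b -> 0 <= df x) -> f a <= f b.
Proof.
rewrite le_eqVlt => /orP[/eqP -> //|ab] hd h0.
have h1 (x : R) : x \in `]a, b[ -> is_derive (x : R^o) (1 : R^o) (f : R^o -> R^o) (df x : R^o).
  by rewrite in_itv /= => /andP[x1 x2]; apply: hd; rewrite !ltW.
have h2 : {within `[a, b], continuous f}.
  by apply: derivable_within_continuous => x xab; have [] := hd x xab.
have [c] := MVT ab h1 h2; rewrite in_itv /= => /andP[c1 c2] e.
by rewrite -subr_ge0 e mulr_ge0 ?h0 ?(ltW c1) ?(ltW c2) // subr_ge0 ltW.
Qed.

End Calculus.

(** * Logarithmic asymptotics of the mean determinant *)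

Section Laguerre.
Context {R : realType}.
Variable d : nat.
Hypothesis d_gt0 : (0 < d)%N.

(** This is d! times the Laguerre polynomial L_d evaluated at minus the variable. *)
Definition Dp : {poly R} := Lop d 'X^d.
Let Ep : {poly R} := Lop d.-1 'X^d.

Lemma Lop_deriv N (p : {poly R}) : (Lop N p)^`() = Lop N p^`().
Proof. by elim: N => [|N IH] //=; rewrite derivD IH. Qed.

(** The commutator of (1 + D)^N with multiplication by the variable is N (1 + D)^(N-1). *)
Lemma LopX N (p : {poly R}) : Lop N ('X * p) = 'X * Lop N p + Lop N.-1 p *+ N.
Proof.
elim: N => [|N IH]; first by rewrite mulr0n addr0.
rewrite [LHS]/= IH derivD derivM derivX mul1r derivMn /= -/(Lop N p).
case: N IH => [|N] IH /=; first by rewrite !mulr0n mulr1n; ring.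
rewrite -/(Lop N p) -/(Lop N.+1 p); move: (Lop N p) => P; rewrite !derivD !mulrS; ring.
Qed.

Lemma LopMn N (p : {poly R}) k : Lop N (p *+ k) = Lop N p *+ k.
Proof. by elim: k => [|k IH]; rewrite ?mulr0n ?Lop0 // !mulrS LopD IH. Qed.

Lemma size_Xderiv (p : {poly R}) : (size ('X * p^`())%R <= size p)%N.
Proof.
apply/leq_sizeP => j hj; rewrite coefXM; case: j hj => [|j] hj //=.
by rewrite coef_deriv nth_default // mul0rn.
Qed.

Lemma derivXnE : ('X : {poly R}) * ('X^d)^`() = 'X^d *+ d.
Proof. by rewrite derivXn mulrnAr -exprS prednK. Qed.

Lemma DpE : Dp = Ep + Ep^`(). Proof. by rewrite /Dp -{1}(prednK d_gt0). Qed.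

(** Apply (1 + D)^d to X D X^d = d X^d and commute; a further derivation gives the Laguerre equation
    [Dp_ode]. *)
Lemma XdDp : 'X * Dp^`() = Ep *+ d.
Proof.
have := congr1 (Lop d) derivXnE; rewrite LopX -!Lop_deriv LopMn -/Dp -/Ep {2}DpE => h.
by apply: (addIr (Ep^`() *+ d)); rewrite h mulrnDl.
Qed.

Lemma Dp_ode : 'X * Dp^`()^`() + Dp^`() = Dp *+ d - 'X * Dp^`().
Proof.
have := congr1 (@deriv R) XdDp; rewrite derivM derivX mul1r derivMn => h.
by rewrite addrC h XdDp DpE mulrnDl addrAC subrr add0r.
Qed.

Lemma nnegXn k : nnegp ('X^k : {poly R}).
Proof. by move=> i; rewrite coefXn; case: eqP. Qed.

Lemma Dp_nneg : nnegp Dp. Proof. by apply: Lop_nneg; exact: nnegXn. Qed.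

Lemma Lop_low N : exists low : {poly R}, [/\ Lop N 'X^d = 'X^d + low, (size low <= d)%N & nnegp low].
Proof.
elim: N => [|N [low [e s n]]].
  by exists 0; split; rewrite ?addr0 ?size_poly0 // => i; rewrite coef0.
exists (low + ('X^d + low)^`()); split.
- by rewrite /= -/(Lop N _) e addrA.
- apply: (leq_trans (size_polyD _ _)); rewrite geq_max s /=.
  apply: (leq_trans (size_poly _ _)).
  have h : (size ('X^d + low)%R <= d.+1)%N.
    by apply: (leq_trans (size_polyD _ _)); rewrite geq_max size_polyXn leqnn /= (leq_trans s).
  by case: (size _) h.
- by apply: nnegpD => //; apply: nnegp_deriv; apply: nnegpD => //; exact: nnegXn.
Qed.

(** The polynomial is monic with nonnegative coefficients; its size at infinity is the value from
    which the barrier is carried down to finite [u]. *)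
Lemma Dp_bounds : exists2 K : R, 0 <= K & forall u, 1 <= u -> u ^+ d <= Dp.[u] <= u ^+ d * (1 + K / u).
Proof.
have [low [e s n]] := Lop_low d.
exists (\sum_(i < d) low`_i); first exact: sumr_ge0.
move=> u u1; have u0 : 0 < u by lra.
rewrite /Dp e hornerD hornerXn; apply/andP; split; first by rewrite lerDl nneg_horner // ltW.
rewrite mulrDr mulr1 lerD2l (horner_coef_wide _ s) mulrCA mulr_suml; apply: ler_sum => i _.
rewrite ler_wpM2l // ler_pdivlMr // -exprSr ler_weXn2l //.
Qed.

Lemma Dp_gt0 u : 0 < u -> 0 < Dp.[u].
Proof.
move=> u0; have [low [e s n]] := Lop_low d.
by rewrite /Dp e hornerD hornerXn ltr_wpDr ?exprn_gt0 // nneg_horner // ltW.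
Qed.

Lemma Xderiv_sum (p : {poly R}) u : u * p^`().[u] = \sum_(i < size p) i%:R * (p`_i * u ^+ i).
Proof.
have -> : u * p^`().[u] = ('X * p^`()).[u] by rewrite hornerM hornerX.
have s := size_Xderiv p.
rewrite (horner_coef_wide _ s); apply: eq_bigr => i _; rewrite coefXM coef_deriv.
case: (nat_of_ord i) => [|k] /=; first by rewrite !mul0r.
by rewrite mulr_natl mulrnAl.
Qed.

(** Cauchy-Schwarz for the weights p_i u^i: the three expressions are the total mass and the first
    and second moments of the index i. *)
Lemma deriv_cauchy (p : {poly R}) u : nnegp p -> 0 <= u -> 0 < p.[u] ->
  (u * p^`().[u]) ^+ 2 <= u * (p^`().[u] + u * p^`()^`().[u]) * p.[u].
Proof.
move=> np u0 p0; set A := p.[u]; set Bq := u * _.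
have hC : u * (p^`().[u] + u * p^`()^`().[u]) = \sum_(i < size p) i%:R ^+ 2 * (p`_i * u ^+ i).
  have -> : u * (p^`().[u] + u * p^`()^`().[u]) = u * ('X * p^`())^`().[u].
    by rewrite derivM derivX mul1r hornerD hornerM hornerX.
  rewrite Xderiv_sum.
  have s := size_Xderiv p.
  pose f i := i%:R * (('X * p^`())`_i * u ^+ i).
  rewrite [LHS](big_ord_widen _ f s) big_mkcond /=.
  apply: eq_bigr => i _; case: ltnP => h; rewrite /f.
    rewrite coefXM coef_deriv; case: (nat_of_ord i) => [|k] /=; first by rewrite expr2 !mul0r.
    by rewrite expr2 -[p`_k.+1 *+ _]mulr_natl; ring.
  have : ('X * p^`())`_i = 0 by rewrite nth_default.
  rewrite coefXM coef_deriv; case: (nat_of_ord i) => [|k] /=; first by move=> _; rewrite expr2 !mul0r.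
  by move=> /eqP; rewrite mulrn_eq0 /= => /eqP ->; rewrite !mul0r mulr0.
rewrite hC.
have hA : A = \sum_(i < size p) p`_i * u ^+ i by exact: horner_coef.
have hB : Bq = \sum_(i < size p) i%:R * (p`_i * u ^+ i) by exact: Xderiv_sum.
have : 0 <= \sum_(i < size p) (p`_i * u ^+ i) * (i%:R * A - Bq) ^+ 2.
  by apply: sumr_ge0 => i _; rewrite mulr_ge0 ?sqr_ge0 // mulr_ge0 ?exprn_ge0.
have -> : \sum_(i < size p) (p`_i * u ^+ i) * (i%:R * A - Bq) ^+ 2 =
   A ^+ 2 * (\sum_(i < size p) i%:R ^+ 2 * (p`_i * u ^+ i)) - 2 * A * Bq * Bq + Bq ^+ 2 * A.
  transitivity (\sum_(i < size p) (A ^+ 2 * (i%:R ^+ 2 * (p`_i * u ^+ i)) - 2 * A * Bq * (i%:R * (p`_i * u ^+ i)) + Bq ^+ 2 * (p`_i * u ^+ i))).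
    by apply: eq_bigr => i _; ring.
  by rewrite big_split sumrB /= -!mulr_sumr -hA -hB.
move: (\sum_(i < _) _) => S h; rewrite -(ler_pM2l p0) -/A.
by move: h; rewrite !expr2; lra.
Qed.

Let d0 : (0 : R) < d%:R. Proof. by rewrite ltr0n. Qed.
Let r u : R := u * Dp^`().[u] / Dp.[u].

Lemma r_le u : 0 < u -> r u <= d%:R.
Proof.
move=> u0; rewrite /r ler_pdivrMr ?Dp_gt0 //.
have -> : u * Dp^`().[u] = d%:R * Ep.[u].
  by have := congr1 (horner^~ u) XdDp; rewrite hornerM hornerX hornerMn mulr_natl.
rewrite ler_pM2l // DpE hornerD lerDl nneg_horner ?ltW //.
by apply: nnegp_deriv; apply: Lop_nneg; exact: nnegXn.
Qed.

(** The differential equation expresses the second moment through the first, so Cauchy-Schwarz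
    becomes a quadratic inequality for the logarithmic derivative [r]. *)
Lemma r_quad u : 0 < u -> r u ^+ 2 / u + r u <= d%:R.
Proof.
move=> u0; have D0 := Dp_gt0 u0.
have := deriv_cauchy Dp_nneg (ltW u0) D0.
have hode : Dp^`().[u] + u * Dp^`()^`().[u] = d%:R * Dp.[u] - u * Dp^`().[u].
  have := congr1 (horner^~ u) Dp_ode; rewrite !(hornerD, hornerN, hornerM, hornerX, hornerMn) => h.
  by rewrite addrC h mulr_natl.
rewrite hode /r => h.
rewrite -(ler_pM2l (mulr_gt0 u0 (exprn_gt0 2 D0))).
rewrite (_ : _ * (_ / u + _) = (u * Dp^`().[u]) ^+ 2 + u * (u * Dp^`().[u]) * Dp.[u]); last first.
  by field; rewrite !gt_eqF.
by move: h; rewrite expr2 [Dp.[u] ^+ 2]expr2; lra.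
Qed.

(** The parameter q makes d q the positive root of r^2 / u + r = d, namely at u = [Uq q].
    Correspondingly [Tq] is the integral of (d q / u) du, normalised to behave like d ln u at
    infinity: the candidate for ln Dp (u). *)
Definition Uq (q : R) : R := d%:R * q ^+ 2 / (1 - q).
Definition Tq (q : R) : R := d%:R * (ln d%:R - ln (1 - q) - (1 - q)).
Definition dUq (q : R) : R := d%:R * q * (2 - q) / (1 - q) ^+ 2.

Lemma isd_Uq q : q < 1 -> isd Uq q (dUq q).
Proof.
move=> q1; have h : 1 - q != 0 by rewrite gt_eqF // subr_gt0.
apply: isd_eq; first apply: isdM.
- by apply: isdM; [exact: isdC | apply: (isd_eq (isdM (isdI q) (isdI q)))].
- by apply: (@isdV _ (fun y => 1 - y) _ _ _ h); apply: isdB; [exact: isdC | exact: isdI].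
by rewrite /dUq /=; field.
Qed.

Lemma isd_Tq q : q < 1 -> isd Tq q (d%:R * (2 - q) / (1 - q)).
Proof.
move=> q1; have h : 0 < 1 - q by rewrite subr_gt0.
have hl : isd (fun q => 1 - q) q (0 - 1) by apply: isdB; [exact: isdC | exact: isdI].
apply: isd_eq.
  apply: isdM; first exact: isdC.
  by apply: isdB; [apply: isdB; [exact: isdC | exact: (isd_ln hl h)] | exact: hl].
by rewrite /=; field; rewrite gt_eqF.
Qed.

Lemma Uq_gt0 q : 0 < q < 1 -> 0 < Uq q.
Proof. by move=> /andP[q0 q1]; rewrite /Uq divr_gt0 ?mulr_gt0 ?exprn_gt0 // subr_gt0. Qed.

Lemma dUq_ge0 q : 0 <= q < 1 -> 0 <= dUq q.
Proof.
by move=> /andP[q0 q1]; rewrite /dUq divr_ge0 ?sqr_ge0 // mulr_ge0 ?mulr_ge0 //; lra.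
Qed.

Lemma dU_div q : 0 < q < 1 -> dUq q / Uq q * (d%:R * q) = d%:R * (2 - q) / (1 - q).
Proof. by move=> /andP[q0 q1]; rewrite /dUq /Uq; field; rewrite !gt_eqF ?subr_gt0 //. Qed.

Lemma r_le_q q : 0 < q < 1 -> r (Uq q) <= d%:R * q.
Proof.
move=> hq; have U0 := Uq_gt0 hq; have := r_quad U0; move: hq => /andP[q0 q1].
have q1' : 0 < 1 - q by rewrite subr_gt0.
move=> h; rewrite leNgt; apply/negP => hr.
have dq0 : 0 < d%:R * q by rewrite mulr_gt0.
have h2 : (d%:R * q) ^+ 2 / Uq q <= r (Uq q) ^+ 2 / Uq q.
  by rewrite ler_pM2r ?invr_gt0 // lerXn2r ?nnegrE ?ltW // (lt_trans dq0).
have h3 : (d%:R * q) ^+ 2 / Uq q = d%:R * (1 - q).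
  by rewrite /Uq; field; rewrite !gt_eqF.
by move: h h2; rewrite h3; lra.
Qed.

Definition gq q := ln Dp.[Uq q] - Tq q.
(** The barrier. The bound r <= d q makes [gq] nonincreasing; adding Dp' / Dp - d / u reverses this,
    since by the differential equation the new derivative is a positive multiple of d (1 - q) - r^2
    / u + (d - r) / u. Their behaviour at infinity then gives 0 <= [gq] <= d / u. *)
Definition Phiq q := gq q + Dp^`().[Uq q] / Dp.[Uq q] - d%:R / Uq q.

Lemma isd_gq q : 0 < q < 1 -> isd gq q (dUq q / Uq q * (r (Uq q) - d%:R * q)).
Proof.
move=> hq; have U0 := Uq_gt0 hq; have D0 := Dp_gt0 U0; have /andP[q0 q1] := hq.
apply: isd_eq.
  apply: isdB; last exact: (isd_Tq q1).
  exact: (@isd_ln _ (fun y => Dp.[Uq y]) _ _ (isd_poly Dp (isd_Uq q1)) D0).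
by rewrite -dU_div // /r; field; rewrite !gt_eqF.
Qed.

Lemma isd_Phiq q : 0 < q < 1 -> isd Phiq q (dUq q / Uq q *
  (d%:R * (1 - q) - r (Uq q) ^+ 2 / Uq q + (d%:R - r (Uq q)) / Uq q)).
Proof.
move=> hq; have U0 := Uq_gt0 hq; have D0 := Dp_gt0 U0; have /andP[q0 q1] := hq.
have hode : Uq q * Dp^`()^`().[Uq q] = d%:R * Dp.[Uq q] - Uq q * Dp^`().[Uq q] - Dp^`().[Uq q].
  have := congr1 (horner^~ (Uq q)) Dp_ode; rewrite !(hornerD, hornerN, hornerM, hornerX, hornerMn) => h.
  by rewrite mulr_natl -h addrK.
have Dn : Dp.[Uq q] != 0 by rewrite gt_eqF.
have Un : Uq q != 0 by rewrite gt_eqF.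
apply: isd_eq.
  apply: isdB.
    apply: isdD; first exact: (isd_gq hq).
    apply: isdM; first exact: (isd_poly Dp^`() (isd_Uq q1)).
    exact: (@isdV _ (fun y => Dp.[Uq y]) _ _ (isd_poly Dp (isd_Uq q1)) Dn).
  by apply: isdM; [exact: isdC | exact: (@isdV _ Uq _ _ (isd_Uq q1) Un)].
rewrite (_ : Dp^`()^`().[Uq q] = (d%:R * Dp.[Uq q] - Uq q * Dp^`().[Uq q] - Dp^`().[Uq q]) / Uq q); last first.
  by rewrite -hode mulrC mulKf.
by rewrite /r; field; rewrite Dn Un.
Qed.

Lemma gq_nincr p q : 0 < p -> p <= q -> q < 1 -> gq q <= gq p.
Proof.
move=> p0 pq q1; rewrite -lerN2.
apply: (@isd_mono R (fun x => - gq x) (fun x => 0 - dUq x / Uq x * (r (Uq x) - d%:R * x))) => // x /andP[x1 x2].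
  have hx : 0 < x < 1 by apply/andP; split; lra.
  by have := isdB (isdC 0 x) (isd_gq hx); under [X in isd X]eq_fun do rewrite sub0r.
have hx : 0 < x < 1 by apply/andP; split; lra.
rewrite sub0r -mulrN mulr_ge0 ?oppr_ge0 ?subr_le0 ?r_le_q // divr_ge0 //; last exact/ltW/Uq_gt0.
by apply: dUq_ge0; lra.
Qed.

Lemma Phiq_ndecr p q : 0 < p -> p <= q -> q < 1 -> Phiq p <= Phiq q.
Proof.
move=> p0 pq q1.
apply: (isd_mono pq) => x /andP[x1 x2]; have hx : 0 < x < 1 by apply/andP; split; lra.
  exact: (isd_Phiq hx).
have U0 := Uq_gt0 hx.
apply: mulr_ge0; first by apply: divr_ge0; [apply: dUq_ge0; apply/andP; split; lra | exact: ltW].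
have rq := r_le_q hx; have rd := r_le U0.
have r0 : 0 <= r (Uq x).
  rewrite /r divr_ge0 ?(ltW (Dp_gt0 U0)) // mulr_ge0 ?(ltW U0) // nneg_horner ?(ltW U0) //.
  by apply: nnegp_deriv; exact: Dp_nneg.
have h1 : 0 <= (d%:R - r (Uq x)) / Uq x by rewrite divr_ge0 ?(ltW U0) // subr_ge0.
have h2 : r (Uq x) ^+ 2 / Uq x <= (d%:R * x) ^+ 2 / Uq x.
  by rewrite ler_pM2r ?invr_gt0 // lerXn2r ?nnegrE // (le_trans r0).
have h3 : (d%:R * x) ^+ 2 / Uq x = d%:R * (1 - x).
  by rewrite /Uq; field; rewrite !gt_eqF //; lra.
by rewrite h3 in h2; lra.
Qed.

Lemma ln_le_sub1 (x : R) : 0 < x -> ln x <= x - 1.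
Proof. by move=> x0; rewrite -ler_expR lnK ?posrE //; have := expR_ge1Dx (x - 1); lra. Qed.

Lemma ln_ge1V (x : R) : 0 < x -> 1 - x^-1 <= ln x.
Proof.
move=> x0; have := @ln_le_sub1 x^-1; rewrite invr_gt0 lnV ?posrE // => /(_ x0); lra.
Qed.

Lemma lnU_Tq q : 0 < q < 1 -> d%:R * ln (Uq q) - Tq q = d%:R * (2 * ln q + (1 - q)).
Proof.
move=> /andP[q0 q1]; have h : 0 < 1 - q by rewrite subr_gt0.
rewrite /Uq lnM ?posrE ?invr_gt0 ?mulr_gt0 ?exprn_gt0 // lnM ?posrE ?exprn_gt0 // lnV ?posrE //.
by rewrite expr2 lnM ?posrE // /Tq; ring.
Qed.

(** Stands for the limit q -> 1, that is u -> infinity: a point beyond [q] where an error c (1 - p)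
    is at most [e]. *)
Lemma near1 (q e c : R) : q < 1 -> 0 < e -> 0 <= c ->
  exists p, [/\ q <= p, p < 1, 1 - p <= 4^-1 & c * (1 - p) <= e].
Proof.
move=> q1 e0 c0; pose w := Num.min (1 - q) (Num.min 4^-1 (e / (c + 1))).
have c1 : 0 < c + 1 by lra.
have w0 : 0 < w by rewrite !lt_min subr_gt0 q1 divr_gt0 // andbT; lra.
have w1 : w <= 1 - q by rewrite ge_min lexx.
have w2 : w <= 4^-1 by rewrite /w minCA ge_min lexx.
have w3 : w <= e / (c + 1) by rewrite /w minA ge_min lexx orbT.
exists (1 - w); split; try lra.
rewrite (_ : 1 - (1 - w) = w); last by ring.
by move: w3; rewrite ler_pdivlMr //; nra.
Qed.

Lemma Uq_inv p : 0 <= 1 - p -> 1 - p <= 4^-1 -> (Uq p)^-1 <= 4 * (1 - p).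
Proof.
move=> p1 p4; have d1 : (1 : R) <= d%:R by rewrite ler1n.
have p0 : 3 / 4 <= p by lra.
rewrite /Uq invf_div ler_pdivrMr; last by rewrite mulr_gt0 // exprn_gt0; lra.
have h : 1 <= 4 * (d%:R * p ^+ 2) by rewrite expr2; nra.
by rewrite -[X in X <= _]mulr1 (_ : 4 * (1 - p) * _ = (1 - p) * (4 * (d%:R * p ^+ 2))) ?ler_wpM2l //; ring.
Qed.

Lemma Uq_ge1 p : p < 1 -> 1 - p <= 4^-1 -> 1 <= Uq p.
Proof.
move=> p1 p4; have h : 0 < 1 - p by lra.
have hp : 0 < p < 1 by apply/andP; split; lra.
have := Uq_inv (ltW h) p4; rewrite -{2}[Uq p]invrK invf_ge1 ?invr_gt0 ?Uq_gt0 // => h2.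
by apply: (le_trans h2); lra.
Qed.

Lemma gq_ge0 q : 0 < q < 1 -> 0 <= gq q.
Proof.
move=> /andP[q0 q1]; apply/ler_addgt0Pr => e e0.
have [p [qp p1 p4 pe]] := near1 q1 e0 (ltac:(rewrite mulr_ge0 // ltW // ) : 0 <= 4 * (d%:R : R)).
have p0 : 0 < p by lra.
have hp : 0 < p < 1 by rewrite p0.
have h1 := gq_nincr q0 qp p1.
have [K K0 hK] := Dp_bounds; have /andP[h2 _] := hK _ (Uq_ge1 p1 p4).
have U0 := Uq_gt0 hp.
have h3 : d%:R * ln (Uq p) <= ln Dp.[Uq p].
  by rewrite mulr_natl -lnXn // ler_ln ?posrE ?exprn_gt0 ?Dp_gt0.
have h4 := lnU_Tq hp.
have h5 := ln_ge1V p0.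
have h6 : p^-1 <= 1 + 2 * (1 - p).
  by rewrite -[p^-1]mul1r ler_pdivrMr //; nra.
have h7 : - (4 * (1 - p)) <= 2 * ln p + (1 - p) by lra.
have h8 : d%:R * - (4 * (1 - p)) <= d%:R * (2 * ln p + (1 - p)) by rewrite ler_pM2l.
by move: h1; rewrite {1}/gq; lra.
Qed.

Lemma gq_le q : 0 < q < 1 -> gq q <= d%:R / Uq q.
Proof.
move=> hq; have /andP[q0 q1] := hq.
have [K K0 hK] := Dp_bounds.
have P0 : Phiq q <= 0.
  apply/ler_addgt0Pr => e e0; rewrite add0r.
  have [p [qp p1 p4 pe]] := near1 q1 e0 (ltac:(rewrite addr_ge0 // ?mulr_ge0 // ltW) : 0 <= d%:R + 4 * K).
  have p0 : 0 < p by lra.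
  have hp : 0 < p < 1 by rewrite p0.
  have h1 := Phiq_ndecr q0 qp p1.
  have /andP[_ h2] := hK _ (Uq_ge1 p1 p4).
  have U0 := Uq_gt0 hp; have D0 := Dp_gt0 U0.
  have rd := r_le U0.
  have h3 : Dp^`().[Uq p] / Dp.[Uq p] <= d%:R / Uq p.
    by rewrite ler_pdivlMr // mulrC mulrA.
  have KU : 0 <= K / Uq p by rewrite divr_ge0 // ltW.
  have h4 : ln Dp.[Uq p] <= d%:R * ln (Uq p) + K / Uq p.
    apply: (@le_trans _ _ (ln (Uq p ^+ d * (1 + K / Uq p)))).
      by rewrite ler_ln ?posrE // mulr_gt0 ?exprn_gt0 //; lra.
    rewrite lnM ?posrE ?exprn_gt0 //; last by lra.
    rewrite lnXn // mulr_natl lerD2l; apply: (le_trans (ln_le_sub1 _)); last by lra.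
    by lra.
  have h5 := lnU_Tq hp.
  have h6 := ln_le_sub1 p0.
  have h7 : d%:R * (2 * ln p + (1 - p)) <= d%:R * (1 - p) by rewrite ler_pM2l //; lra.
  have h8 : K / Uq p <= K * (4 * (1 - p)) by rewrite ler_wpM2l // Uq_inv //; lra.
  apply: (le_trans h1); rewrite /Phiq /gq; lra.
have U0 := Uq_gt0 hq.
have h : 0 <= Dp^`().[Uq q] / Dp.[Uq q].
  by rewrite divr_ge0 ?(ltW (Dp_gt0 U0)) // nneg_horner ?(ltW U0) //; apply: nnegp_deriv; exact: Dp_nneg.
by move: P0; rewrite /Phiq; lra.
Qed.

(** The integral of [Tq] with respect to [Uq] in closed form, vanishing at q = 0; it replaces the
    sum of ln Dp (j) over j. *)
Definition Theta q := Uq q * Tq q - Uq q * (d%:R * q) - d%:R ^+ 2 * (q ^+ 2 / 2 + q + ln (1 - q)).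

Lemma isd_Theta q : q < 1 -> isd Theta q (dUq q * Tq q).
Proof.
move=> q1; have h : 0 < 1 - q by rewrite subr_gt0.
have hl : isd (fun q => 1 - q) q (0 - 1) by apply: isdB; [exact: isdC | exact: isdI].
have h2 : isd (fun q => q ^+ 2 / 2) q ((1 * q + q * 1) * 2^-1 + q ^+ 2 * 0).
  by apply: isdM; [apply: (isd_eq (isdM (isdI q) (isdI q))) | exact: isdC].
apply: isd_eq.
  apply: isdB; last first.
    apply: isdM; first exact: isdC.
    by apply: isdD; [apply: isdD; [exact: h2 | exact: isdI] | exact: (isd_ln hl h)].
  apply: isdB; first exact: (isdM (isd_Uq q1) (isd_Tq q1)).
  by apply: isdM; [exact: isd_Uq | apply: isdM; [exact: isdC | exact: isdI]].
by rewrite /dUq /Uq /=; field; rewrite gt_eqF.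
Qed.

Lemma Tq_mono q p : 0 <= q -> q <= p -> p < 1 -> Tq q <= Tq p.
Proof.
move=> q0 qp p1.
apply: (isd_mono qp) => x /andP[x1 x2]; first by apply: isd_Tq; lra.
by apply: divr_ge0; [apply: mulr_ge0 => //|]; lra.
Qed.

Lemma Theta_lo q p : 0 <= q -> q <= p -> p < 1 -> Tq q * (Uq p - Uq q) <= Theta p - Theta q.
Proof.
move=> q0 qp p1.
have := @isd_mono R (fun x => Theta x - Tq q * Uq x) (fun x => dUq x * Tq x - (0 * Uq x + Tq q * dUq x)) _ _ qp.
move=> H; have {H} : Theta q - Tq q * Uq q <= Theta p - Tq q * Uq p; last by lra.
apply: H => x /andP[x1 x2]; have xl : x < 1 by lra.
  by apply: isdB; [exact: isd_Theta | apply: isdM; [exact: isdC | exact: isd_Uq]].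
have h : 0 <= dUq x by apply: dUq_ge0; apply/andP; split; lra.
have h2 := Tq_mono q0 x1 xl.
by have : 0 <= dUq x * (Tq x - Tq q) by [rewrite mulr_ge0 // subr_ge0|]; lra.
Qed.

Lemma Theta_hi q p : 0 <= q -> q <= p -> p < 1 -> Theta p - Theta q <= Tq p * (Uq p - Uq q).
Proof.
move=> q0 qp p1.
have := @isd_mono R (fun x => Tq p * Uq x - Theta x) (fun x => (0 * Uq x + Tq p * dUq x) - dUq x * Tq x) _ _ qp.
move=> H; have {H} : Tq p * Uq q - Theta q <= Tq p * Uq p - Theta p; last by lra.
apply: H => x /andP[x1 x2]; have xl : x < 1 by lra.
  by apply: isdB; [apply: isdM; [exact: isdC | exact: isd_Uq] | exact: isd_Theta].
have h : 0 <= dUq x by apply: dUq_ge0; apply/andP; split; lra.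
have h2 : Tq x <= Tq p by apply: Tq_mono => //; lra.
by have : 0 <= dUq x * (Tq p - Tq x) by [rewrite mulr_ge0 // subr_ge0|]; lra.
Qed.

(** The nonnegative root of d q^2 = j (1 - q), so the inverse of [Uq] on j >= 0. *)
Definition rootq (j : R) : R := (Num.sqrt (j ^+ 2 + 4 * d%:R * j) - j) / (2 * d%:R).

Lemma rootqP j : 0 <= j -> [/\ 0 <= rootq j, rootq j < 1 & d%:R * rootq j ^+ 2 = j * (1 - rootq j)].
Proof.
move=> j0; set y := Num.sqrt (j ^+ 2 + 4 * d%:R * j).
have a0 : 0 <= j ^+ 2 + 4 * d%:R * j by rewrite addr_ge0 ?sqr_ge0 // !mulr_ge0 // ltW.
have y0 : 0 <= y by exact: sqrtr_ge0.
have y2 : y ^+ 2 = j ^+ 2 + 4 * d%:R * j by exact: sqr_sqrtr.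
have jy : j <= y.
  by rewrite -(@ler_pXn2r _ 2) ?nnegrE // y2 lerDl !mulr_ge0 // ltW.
have yd : y < j + 2 * d%:R.
  rewrite -(@ltr_pXn2r _ 2) ?nnegrE //; last by have := d0; lra.
  by rewrite y2; have := exprn_gt0 2 d0; rewrite !expr2; nra.
have dd : 0 < 2 * d%:R :> R by have := d0; lra.
split.
- by rewrite /rootq -/y divr_ge0 ?subr_ge0 // ltW.
- by rewrite /rootq -/y ltr_pdivrMr //; lra.
- apply: (@mulfI _ (4 * d%:R)); first by rewrite gt_eqF //; have := d0; lra.
  have -> : 4 * d%:R * (d%:R * rootq j ^+ 2) = (y - j) ^+ 2 by rewrite /rootq -/y; field; rewrite gt_eqF.
  have -> : 4 * d%:R * (j * (1 - rootq j)) = 2 * j * (2 * d%:R - (y - j)) by rewrite /rootq -/y; field; rewrite gt_eqF.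
  by rewrite sqrrB y2; ring.
Qed.

Lemma Uq_rootq j : 0 <= j -> Uq (rootq j) = j.
Proof.
move=> j0; have [q0 q1 e] := rootqP j0.
by rewrite /Uq e mulfK // gt_eqF // subr_gt0.
Qed.

Lemma rootq0 : rootq 0 = 0.
Proof. by rewrite /rootq expr0n mulr0 addr0 sqrtr0 subr0 mul0r. Qed.

Lemma rootq_gt0 j : 0 < j -> 0 < rootq j.
Proof.
move=> j0; have [q0 q1 e] := rootqP (ltW j0); rewrite lt_neqAle q0 andbT; apply/eqP => h.
by move: e; rewrite -h expr0n mulr0 subr0 mulr1 => h2; move: j0; rewrite -h2 ltxx.
Qed.

Lemma rootq_le i j : 0 <= i -> i <= j -> rootq i <= rootq j.
Proof.
move=> i0 ij; have j0 : 0 <= j by lra.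
have [p0 p1 ep] := rootqP i0; have [q0 q1 eq] := rootqP j0.
rewrite leNgt; apply/negP => h.
have h2 : d%:R * rootq j ^+ 2 < d%:R * rootq i ^+ 2.
  by rewrite ltr_pM2l // ltrXn2r.
have h3 : i * (1 - rootq i) <= j * (1 - rootq j).
  by apply: ler_pM => //; rewrite ?subr_ge0 ?lerD2l ?lerN2 ltW.
by move: h2; rewrite ep eq ltNge h3.
Qed.

(** Comparison of sum and integral for an increasing function: the error is at most the total
    increase of [Tq]. *)
Lemma sum_Tq N : Theta (rootq N%:R) <= \sum_(1 <= j < N.+1) Tq (rootq j%:R)
   <= Theta (rootq N%:R) + Tq (rootq N%:R) - Tq 0.
Proof.
have U0 : Uq 0 = 0 by rewrite /Uq expr0n mulr0 mul0r.
have T0 : Theta 0 = 0 by rewrite /Theta U0 expr0n /= [X in ln X](_ : _ = 1) ?ln1; ring.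
elim: N => [|N IH].
  by rewrite big_geq // rootq0 T0 add0r subrr lexx.
rewrite big_nat_recr //=; move: IH => /andP[h1 h2].
have n0 : 0 <= N%:R :> R by [].
have n1 : N%:R <= N.+1%:R :> R by rewrite ler_nat.
have [p0 p1 _] := rootqP n0; have [q0 q1 _] := rootqP (le_trans n0 n1).
have hl := Theta_lo p0 (rootq_le n0 n1) q1; have hh := Theta_hi p0 (rootq_le n0 n1) q1.
rewrite !Uq_rootq // -natr1 addrAC subrr add0r mulr1 in hl hh.
rewrite -natr1 in hl hh *; apply/andP; split; lra.
Qed.

End Laguerre.

(** * The mean of the spectral sum of [psi1] *)

Section LogDet.
Context {R : realType}.
Local Notation C := (R[i]).
Local Notation "a %:CR" := (Complex a 0) (at level 2, format "a %:CR").
Variable d : nat.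
Hypothesis d2 : (2 <= d)%N.
Let d_gt0 : (0 < d)%N. Proof. exact: ltnW. Qed.
Let d0 : (0 : R) < d%:R. Proof. by rewrite ltr0n. Qed.
Let dR2 : (2 : R) <= d%:R. Proof. by rewrite ler_nat. Qed.
(** The cut-off of the sums over j. The squared eigenvalues sum to at most about d^4, so divided by
    N they cost O(d), negligible against d^2, while ln N = 3 ln d keeps the harmonic sum of order ln
    d. *)
Let N := (d ^ 3)%N.
Let NE : (N%:R : R) = d%:R ^+ 3. Proof. by rewrite /N natrX. Qed.
Let N0 : (0 : R) < N%:R. Proof. by rewrite NE exprn_gt0. Qed.

Lemma rootN_props : let q : R := rootq d N%:R in
  [/\ 3 / 4 <= q, q < 1, d%:R ^+ 2 * (1 - q) = q ^+ 2 & d%:R ^+ 2 * (1 - q) <= 1].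
Proof.
move=> q; have [q0 q1 e] := rootqP d_gt0 (ltW N0); rewrite -/q NE in q0 q1 e.
have e2 : d%:R ^+ 2 * (1 - q) = q ^+ 2.
  apply: (@mulfI _ (d%:R : R)); first by rewrite gt_eqF.
  by rewrite e; ring.
have h1 : d%:R ^+ 2 * (1 - q) <= 1 by rewrite e2 expr_le1 // ltW.
have d4 : 4 <= d%:R ^+ 2 :> R by rewrite expr2; have := dR2; nra.
have h2 : 4 * (1 - q) <= d%:R ^+ 2 * (1 - q) by rewrite ler_wpM2r // subr_ge0 ltW.
by split => //; lra.
Qed.

(** At N = d^3 the root equation reads d^2 (1 - q) = q^2. The terms of order d^4 leave d^2 (- d^2 ln
    q), which lies between d^2 q^2 and d^2 q, hence within O(1) of d^2. *)
Lemma Theta_N :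
  `|Theta d (rootq d N%:R : R) - (N%:R * d%:R * (ln N%:R - 1) + d%:R ^+ 2 / 2 + d%:R ^+ 2 * ln N%:R - d%:R ^+ 2 * ln d%:R)| <= 6.
Proof.
set q : R := rootq d N%:R; have [q34 q1 e1 e2] := rootN_props; rewrite -/q in q34 q1 e1 e2.
have q0 : 0 < q by lra.
have e0 : 0 < 1 - q by rewrite subr_gt0.
have UE : Uq d q = N%:R by rewrite /q (Uq_rootq d_gt0 (ltW N0)).
have lne : ln (1 - q) = ln d%:R - ln N%:R + 2 * ln q.
  have -> : 1 - q = d%:R * q ^+ 2 / N%:R.
    by rewrite NE -e1; field; rewrite gt_eqF.
  have q2 : 0 < q ^+ 2 by exact: exprn_gt0.
  have dq : 0 < d%:R * q ^+ 2 by exact: mulr_gt0.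
  rewrite (lnM dq) ?posrE ?invr_gt0 // (lnM d0 q2) lnV ?posrE // lnXn // mulr2n; ring.
have h1 := ln_le_sub1 q0; have h2 := ln_ge1V q0.
set L := ln q in lne h1 h2.
have h3 : 1 - q^-1 = - ((1 - q) / q) by field; rewrite gt_eqF.
rewrite h3 in h2.
pose D2 : R := d%:R ^+ 2; pose y := D2 * (1 - q).
have D20 : 0 < D2 by rewrite exprn_gt0.
have ND : N%:R * d%:R = D2 * D2 by rewrite NE /D2; ring.
have qE : q = 1 - (1 - q) by ring.
have a1 : - (D2 * L) <= y / q.
  by rewrite /y -mulrA -mulrN ler_pM2l //; lra.
have a2 : y <= - (D2 * L) by rewrite /y -[leRHS]mulrN ler_pM2l //; lra.
have yE : y = q ^+ 2 by [].
have a1' : - (D2 * L) <= q by rewrite yE expr2 mulfK ?gt_eqF // in a1.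
have b1 : D2 * (- (D2 * L)) <= D2 * q by rewrite ler_pM2l.
have b2 : D2 * q ^+ 2 <= D2 * (- (D2 * L)) by rewrite ler_pM2l // -yE.
have b3 : D2 * q ^+ 2 = D2 - y * (1 + q) by rewrite /y; ring.
have b4 : D2 * q = D2 - y by rewrite /y; ring.
have y01 : 0 <= y <= 1 by rewrite e2 yE sqr_ge0.
have -> : Theta d q - (N%:R * d%:R * (ln N%:R - 1) + d%:R ^+ 2 / 2 + d%:R ^+ 2 * ln N%:R - d%:R ^+ 2 * ln d%:R)
  = 2 * (D2 * (- (D2 * L)) - D2) + y * (1 - (1 - q) / 2 + 1) + 2 * (- (D2 * L)) - y * 0.
  rewrite /Theta UE /Tq lne -/D2 -/y.
  have -> : N%:R * (d%:R * (ln d%:R - (ln d%:R - ln N%:R + 2 * L) - (1 - q))) =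
    (N%:R * d%:R) * (ln N%:R - 2 * L - 1 + q) by ring.
  by rewrite (mulrA N%:R) ND /y; field.
move: y01 => /andP[y0 y1].
have z : 0 <= y * ((1 - q) / 2) <= 1.
  by apply/andP; split; [apply: mulr_ge0 => //; lra | nra].
move: z => /andP[z0 z1].
have w : y * (1 + q) <= 2 by nra.
have -> : y * (1 - (1 - q) / 2 + 1) = 2 * y - y * ((1 - q) / 2) by ring.
rewrite ler_norml; apply/andP; split; lra.
Qed.

Lemma Tq_N : Tq d (rootq d N%:R) - Tq d 0 <= d%:R * (2 * ln d%:R + 2) :> R.
Proof.
set q := rootq d N%:R; have [q34 q1 e1 e2] := rootN_props; rewrite -/q in q34 q1 e1 e2.
have q0 : 0 < q by lra.
have e0 : 0 < 1 - q by rewrite subr_gt0.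
have lne : - ln (1 - q) = 2 * ln d%:R - 2 * ln q.
  have -> : 1 - q = q ^+ 2 / d%:R ^+ 2 by rewrite -e1; field; rewrite gt_eqF.
  by rewrite lnM ?posrE ?invr_gt0 ?exprn_gt0 // lnV ?posrE ?exprn_gt0 // !lnXn // !mulr2n; ring.
have h2 := ln_ge1V q0.
have h3 : q^-1 <= 4 / 3 by rewrite -[q^-1]mul1r ler_pdivrMr //; lra.
rewrite /Tq [1 - 0]subr0 ln1 -mulrBr ler_pM2l //; lra.
Qed.

Section OneU.
Variable u : R.
Hypothesis u1 : (1 : R) <= u.
Let u0 : 0 < u. Proof. by have := u1; lra. Qed.
Let psi (x : R) := ln (x + u).
Let dpsi (x : R) := (x + u)^-1.

Lemma ln_supergrad : supergrad psi dpsi.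
Proof.
move=> x y x0 y0; rewrite /psi /dpsi.
have := u0 => u0'; have a : 0 < x + u by lra. have b : 0 < y + u by lra.
have := @ln_le_sub1 R ((y + u) / (x + u)); rewrite divr_gt0 // => /(_ isT).
rewrite lnM ?posrE ?invr_gt0 // lnV ?posrE // => h.
have -> : (x + u)^-1 * (y - x) = (y + u) / (x + u) - 1 by field; rewrite gt_eqF.
lra.
Qed.

Lemma ln_dpsi01 x : 0 <= x -> 0 <= dpsi x <= 1.
Proof.
move=> x0; have a : 1 <= x + u by have := u1; lra.
by rewrite /dpsi invr_ge0 invf_le1 ?a ?andbT; lra.
Qed.

Let F := @Fpsi R d psi d.

Lemma Fln_cont : fcontinuous F.
Proof. exact: Fpsi_continuous ln_supergrad ln_dpsi01. Qed.

(** The squared slope times the eigenvalue, x / (x + u)^2, is at most 1 / (4 u) for every x, so the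
    gradient is bounded independently of [g]. *)
Lemma Fln_step : stepF (d%:R / (4 * u)) 0 F.
Proof.
move=> g; have [b [hb hs]] := Fpsi_step ln_supergrad ln_dpsi01 g.
exists b; split; last exact: hs.
rewrite mul0r addr0 hb.
apply: (@le_trans _ _ (\sum_(i < d) (4 * u)^-1)); last by rewrite sumr_const card_ord -[leLHS]mulr_natl.
apply: ler_sum => i _; have := eigs_gram_ge0 (mat g) i; move: (eigs _ i) => x x0.
rewrite /dpsi exprVn mulrC ler_pdivrMr; last by rewrite exprn_gt0 //; have := u0; lra.
rewrite ler_pdivlMl; last by rewrite mulr_gt0.
by have := sqr_ge0 (x - u); rewrite !expr2; lra.
Qed.

Lemma Fln_ge0 g : 0 <= F g.
Proof.
apply: sumr_ge0 => i _; apply: ln_ge0; have := eigs_gram_ge0 (mat g) i; have := u1; lra.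
Qed.

Lemma Fln_le g : F g <= d%:R * ln u + fro g.
Proof.
rewrite -(fro_mat g) -sum_eigs_gram mulr_natl -[X in ln u *+ X]card_ord -sumr_const -big_split /=.
apply: ler_sum => i _; have x0 := eigs_gram_ge0 (mat g) i; move: (eigs _ i) x0 => x x0.
have := ln_supergrad (lexx 0) x0; rewrite /psi /dpsi add0r subr0 => h; apply: (le_trans h).
by rewrite lerD2l -[leRHS]mul1r ler_wpM2r // invf_le1 // u1.
Qed.

(** The upper bound is Jensen's inequality, as exp F is the determinant. The lower one is
    [center_mgf] at lam = 1: it gives 8 d / (4 u) = 2 d / u, plus d / u chosen as [eta]. *)
Lemma Fln_mean : exists m : R, EG (2 * (d * d)) (fun v => (F (cvec_of (d * d) v))%:E) = m%:E /\
  ln (Dp d).[u] - 3 * d%:R / u <= m <= ln (Dp d).[u].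
Proof.
have lu : 0 <= ln u by exact: ln_ge0.
have mfro : measurable_fun setT (fun v : Om R => (fro (cvec_of (d * d) v : 'cV[C]_(d * d)))%:E).
  exact: (@fcont_meas_C R _ _ EFin (@fro_continuous R (d * d)) measurable_EFin_id).
set Y := EG _ _.
have Y0 : (0 <= Y)%E by apply: itI_ge0 => v; rewrite lee_fin Fln_ge0.
have Yf : Y \is a fin_num.
  rewrite ge0_fin_numE //; apply: (@le_lt_trans _ _ (d%:R * ln u + (d * d)%:R)%:E); last by rewrite ltry.
  rewrite EFinD -EG_fro -(@EG_cst R (2 * (d * d)) (d%:R * ln u)) ?mulr_ge0 //.
  rewrite -(@EG_Dr R _ (fun=> d%:R * ln u) (fun v => fro (cvec_of (d * d) v))) //; last 2 first.
  - by move=> v; rewrite mulr_ge0.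
  - by move=> v; exact: fro_ge0.
  by apply: le_EG => v; [exact: Fln_ge0 | exact: Fln_le].
exists (fine Y); have mE : Y = (fine Y)%:E by rewrite fineK.
split => //; move: mE; set m := fine Y => mE.
have DE := @EG_det R d u u0.
have D0 : 0 < (Dp d).[u] by apply: Dp_gt0.
have k00 : 0 <= d%:R / (4 * u) by rewrite divr_ge0 // mulr_ge0 // ltW.
apply/andP; split; last first.
  have := jensen_exp Fln_cont Fln_ge0 mE ler01.
  rewrite mul1r (_ : EG _ _ = ((Dp d).[u])%:E) ?lee_fin; last first.
    by rewrite -DE; apply: eq_itI => v _; rewrite mul1r.
  by rewrite -{1}[(Dp d).[u]]lnK ?posrE // ler_expR.
have e0 : 0 < d%:R / u by rewrite divr_gt0.
have := center_mgf Fln_cont Fln_step k00 (lexx 0) Fln_ge0 mE ler01 e0.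
rewrite mulr0 => /(_ _); rewrite invr_ge0 ler0n => /(_ isT).
rewrite (_ : EG _ _ = (expR (- m) * (Dp d).[u])%:E) ?lee_fin; last first.
  rewrite EFinM -DE -(@EG_Zr _ _ (fun v => expR (F (cvec_of (d * d) v)))) ?expR_ge0 //.
  - by apply: eq_itI => v _; rewrite -expRD; congr (expR _)%:E; ring.
  - exact: (@measurable_expF R _ F Fln_cont id (@measurable_id _ _ _)).
rewrite -{1}[(Dp d).[u]]lnK ?posrE // -expRD ler_expR expr1n.
have -> : 8 * 1 * (d%:R / (4 * u) + 2 * (d * d)%:R * 0) + d%:R / u = 3 * d%:R / u by field; rewrite gt_eqF.
lra.
Qed.

End OneU.

Definition HN : R := \sum_(1 <= j < N.+1) j%:R^-1.
(** Starting the sum at j = 1 avoids the singularity of ln at 0, and division by the harmonic sum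
    [HN] makes the slope at 0 exactly 1, its maximum. *)
Definition psi1 (x : R) : R := HN^-1 * \sum_(1 <= j < N.+1) ln (x + j%:R).
Definition dpsi1 (x : R) : R := HN^-1 * \sum_(1 <= j < N.+1) (x + j%:R)^-1.

Lemma HN_ge1 : 1 <= HN.
Proof.
have N1 : (1 <= N)%N by rewrite expn_gt0 d_gt0.
by rewrite /HN big_nat_recl // invr1 lerDl sumr_ge0.
Qed.

Let H0 : 0 < HN. Proof. by have := HN_ge1; lra. Qed.

Lemma HN_le : HN <= 1 + 3 * ln d%:R.
Proof.
suff h k : \sum_(1 <= j < k.+2) j%:R^-1 <= 1 + ln k.+1%:R :> R.
  have N1 : (1 <= N)%N by rewrite expn_gt0 d_gt0.
  have := h N.-1; rewrite prednK // => h2; apply: (le_trans h2).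
  by rewrite NE lerD2l lnXn // mulr_natl.
elim: k => [|k IH]; first by rewrite big_nat1 invr1 ln1 addr0.
rewrite big_nat_recr //=; apply: (@le_trans _ _ (1 + ln k.+1%:R + k.+2%:R^-1)); first by rewrite lerD2r.
rewrite -addrA lerD2l.
have := @ln_ge1V R (k.+2%:R / k.+1%:R); rewrite divr_gt0 // => /(_ isT).
rewrite lnM ?posrE ?invr_gt0 // lnV ?posrE // invf_div => h.
have : k.+2%:R^-1 = 1 - k.+1%:R / k.+2%:R :> R by rewrite -[k.+2%:R]natr1; field; rewrite gt_eqF // -natr1 ltr0n.
by move=> ->; rewrite -lerBrDl.
Qed.

Lemma psi1_supergrad : supergrad psi1 dpsi1.
Proof.
move=> x y x0 y0; rewrite /psi1 /dpsi1 -mulrA -mulrDr ler_pM2l ?invr_gt0 //.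
rewrite mulr_suml -big_split /=; apply: ler_sum_nat => j /andP[j1 _].
by apply: ln_supergrad => //; rewrite ler1n.
Qed.

Lemma dpsi1_01 x : 0 <= x -> 0 <= dpsi1 x <= 1.
Proof.
move=> x0; have hj j : (1 <= j)%N -> 0 < j%:R :> R by rewrite ltr0n.
apply/andP; split.
  rewrite /dpsi1 mulr_ge0 ?invr_ge0 ?(ltW H0) // big_nat_cond sumr_ge0 // => j /andP[/andP[/hj j1 _] _].
  by rewrite invr_ge0; lra.
rewrite /dpsi1 mulrC ler_pdivrMr // mul1r; apply: ler_sum_nat => j /andP[/hj j1 _].
by rewrite lef_pV2 ?posrE; lra.
Qed.

Lemma Fpsi1E g : @Fpsi R d psi1 d g = HN^-1 * \sum_(1 <= j < N.+1) @Fpsi R d (fun x => ln (x + j%:R)) d g.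
Proof. by rewrite /Fpsi /spf exchange_big /= mulr_sumr. Qed.

(** The individual errors O(d / j) add up to O(d [HN]), the comparison with the integral costs
    [Tq_N] and the closed form [Theta_N] a constant; all are absorbed in 27 d ln d by ln d >= 1/2
    and d >= 2. *)
Lemma Fpsi1_mean : exists m : R,
  EG (2 * (d * d)) (fun v => (@Fpsi R d psi1 d (cvec_of (d * d) v))%:E) = m%:E /\
  `|HN * m - (N%:R * d%:R * (ln N%:R - 1) + d%:R ^+ 2 / 2 + d%:R ^+ 2 * ln N%:R - d%:R ^+ 2 * ln d%:R)|
   <= 27 * d%:R * ln d%:R.
Proof.
have hj j : (1 <= j)%N -> 1 <= j%:R :> R by rewrite ler1n.
have [mf hmf] : {mf : nat -> R & forall j, (1 <= j)%N ->
   EG (2 * (d * d)) (fun v => (@Fpsi R d (fun x => ln (x + j%:R)) d (cvec_of (d * d) v))%:E) = (mf j)%:E /\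
   Tq d (rootq d j%:R) - 3 * d%:R / j%:R <= mf j <= Tq d (rootq d j%:R) + d%:R / j%:R}.
  apply: (@choice _ _ (fun j m => (1 <= j)%N ->
   EG (2 * (d * d)) (fun v => (@Fpsi R d (fun x => ln (x + j%:R)) d (cvec_of (d * d) v))%:E) = m%:E /\
   Tq d (rootq d j%:R) - 3 * d%:R / j%:R <= m <= Tq d (rootq d j%:R) + d%:R / j%:R)) => j.
  case: (posnP j) => [->|j1]; first by exists 0.
  have [m [mE /andP[m1 m2]]] := Fln_mean (hj _ j1); exists m => _; split => //.
  have j0 : (0 : R) < j%:R by rewrite ltr0n.
  have hq : 0 < rootq d (j%:R : R) < 1.
    by have [_ q1 _] := rootqP d_gt0 (ltW j0); rewrite rootq_gt0 // q1.
  have := gq_ge0 d_gt0 hq; have := gq_le d_gt0 hq.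
  rewrite /gq Uq_rootq //.
  by move=> h1 h2; apply/andP; split; lra.
exists (HN^-1 * \sum_(1 <= j < N.+1) mf j); split.
  (* The index is shifted so that ln (x + u) has u >= 1 for every index, since [EG_bigsum] asks for
     measurability and sign at all of them. *)
  have mj j : measurable_fun setT (fun v : Om R => (@Fpsi R d (fun x => ln (x + j.+1%:R)) d (cvec_of (d * d) v))%:E).
    exact: (@fcont_meas_C R _ _ EFin (Fln_cont (hj j.+1 isT)) measurable_EFin_id).
  transitivity (EG (2 * (d * d)) (fun v => (HN^-1 * \sum_(0 <= j < N) @Fpsi R d (fun x => ln (x + j.+1%:R)) d (cvec_of (d * d) v))%:E)).
    by apply: eq_itI => v _; rewrite Fpsi1E big_add1.
  rewrite (@EG_Zr _ _ (fun v => \sum_(0 <= j < N) @Fpsi R d (fun x => ln (x + j.+1%:R)) d (cvec_of (d * d) v))) ?invr_ge0 ?(ltW H0) //; last 2 first.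
  - apply/measurable_EFinP; apply: measurable_sum => j; apply/measurable_EFinP; exact: mj.
  - by move=> v; apply: sumr_ge0 => j _; exact: (Fln_ge0 (hj j.+1 isT)).
  rewrite EFinM; congr (_ * _)%E.
  transitivity (EG (2 * (d * d)) (fun v => (\sum_(0 <= j < N) (@Fpsi R d (fun x => ln (x + j.+1%:R)) d (cvec_of (d * d) v))%:E)%E)).
    by apply: eq_itI => v _; rewrite sumEFin.
  rewrite (@EG_bigsum _ _ _ _ _ (fun j (v : Om R) => (@Fpsi R d (fun x => ln (x + j.+1%:R)) d (cvec_of (d * d) v))%:E)) //; last first.
    by move=> j v; rewrite lee_fin; exact: (Fln_ge0 (hj j.+1 isT)).
  rewrite big_add1 -sumEFin; apply: eq_bigr => j _.
  by have [-> _] := hmf j.+1 isT.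
rewrite mulrA mulfV ?gt_eqF // mul1r.
have /andP[s1 s2] := sum_Tq (R := R) d_gt0 N.
have TN := Theta_N; have TT := Tq_N.
have HH := HN_le.
set X := (N%:R * _ * _ + _ + _ - _) in TN *.
have u1 : \sum_(1 <= j < N.+1) mf j <= \sum_(1 <= j < N.+1) Tq d (rootq d j%:R) + d%:R * HN.
  rewrite /HN mulr_sumr -big_split /=; apply: ler_sum_nat => j /andP[j1 _].
  by have [_ /andP[]] := hmf j j1.
have u2 : \sum_(1 <= j < N.+1) Tq d (rootq d j%:R) - 3 * d%:R * HN <= \sum_(1 <= j < N.+1) mf j.
  rewrite /HN mulr_sumr -sumrB; apply: ler_sum_nat => j /andP[j1 _].
  by have [_ /andP[]] := hmf j j1.
have dH : d%:R * HN <= d%:R * (1 + 3 * ln d%:R) by rewrite ler_pM2l.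
have l2 : 2^-1 <= ln d%:R :> R.
  apply: (@le_trans _ _ (ln 2)); last by rewrite ler_ln ?posrE.
  by have h2 : (0 : R) < 2 by []; have := ln_ge1V h2; lra.
have dl : d%:R * 2^-1 <= d%:R * ln d%:R :> R by rewrite ler_pM2l.
move: TN; rewrite !ler_norml => /andP[t1 t2].
have dR2' := dR2.
have -> : 27 * d%:R * ln d%:R = 27 * (d%:R * ln d%:R) :> R by ring.
have E1 : d%:R * (1 + 3 * ln d%:R) = d%:R + 3 * (d%:R * ln d%:R) :> R by ring.
have E2 : d%:R * (2 * ln d%:R + 2) = 2 * (d%:R * ln d%:R) + 2 * d%:R :> R by ring.
rewrite E1 in dH; rewrite E2 in TT.
by apply/andP; split; lra.
Qed.

End LogDet.

(** * The entropy of a normalised vector in terms of its norm and [psi1] *)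

Section Entropy.
Context {R : realType}.
Local Notation C := (R[i]).
Local Notation "a %:CR" := (Complex a 0) (at level 2, format "a %:CR").
Local Notation re := complex.Re.
Local Notation im := complex.Im.

Lemma ln2_gt0 : 0 < ln (2 : R).
Proof. by apply: ln_gt0; lra. Qed.

Lemma ln2_ge : 2^-1 <= ln (2 : R).
Proof. by have h2 : (0 : R) < 2 by []; have := ln_ge1V h2; lra. Qed.

Definition ent d (g : 'cV[C]_(d * d)) : R := vN_entropy (ptrace2 (Defs.proj g)).

Lemma entE d (g : 'cV[C]_(d * d)) : ent g = - (Fpsi (fun x => x * ln x) g) / ln 2.
Proof.
rewrite /ent ptrace2_proj /vN_entropy /Fpsi /spf mulNr mulr_suml; congr (- _).
by apply: eq_bigr => i _; rewrite /log2 mulrA.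
Qed.

Lemma Fpsi_scale d psi (g : 'cV[C]_(d * d)) (a : R) :
  Fpsi psi (a%:CR *: g) = Fpsi (fun x => psi (a ^+ 2 * x)) g.
Proof.
rewrite /Fpsi matZ ctr_scale -scalemxAl -scalemxAr scalerA -spf_scale; last exact: hermitian_gram.
by congr (spf psi (_ *: _)); apply: complex_ext => /=; ring.
Qed.

(** The lower bound is nonnegativity of the entropy relative to the uniform distribution, termwise
    from ln y >= 1 - 1 / y at y = d x. *)
Lemma xlnx_unit_bounds d (g : 'cV[C]_(d * d)) : (0 < d)%N -> fro g = 1 ->
  - ln d%:R <= Fpsi (fun x => x * ln x) g <= 0.
Proof.
move=> d_gt0; have d0 : (0 : R) < d%:R by rewrite ltr0n.
rewrite -(fro_mat g) -sum_eigs_gram /Fpsi /spf => s1.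
have x0 i : 0 <= eigs (mat g *m ctr (mat g)) i by exact: eigs_gram_ge0.
move: (eigs _) s1 x0 => x s1 x0.
have x1 i : x i <= 1 by rewrite -s1 (bigD1 i) //= lerDl sumr_ge0.
apply/andP; split; last first.
  rewrite -oppr_ge0 -sumrN; apply: sumr_ge0 => i _.
  by rewrite -mulrN mulr_ge0 // oppr_ge0 ln_le0.
apply: (@le_trans _ _ (\sum_i (x i - d%:R^-1 - x i * ln d%:R))).
  rewrite sumrB sumrB -mulr_suml s1 sumr_const card_ord -[d%:R^-1 *+ d]mulr_natr mulVf ?gt_eqF //; lra.
apply: ler_sum => i _; have [->|xn] := eqVneq (x i) 0.
  by rewrite !mul0r sub0r subr0 oppr_le0 invr_ge0 ltW.
have xp : 0 < x i by rewrite lt_neqAle eq_sym xn x0.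
have dx : 0 < d%:R * x i by rewrite mulr_gt0.
have := ln_ge1V dx; rewrite lnM ?posrE // => h.
have := ler_wpM2l (x0 i) h.
have -> : x i * (1 - (d%:R * x i)^-1) = x i - d%:R^-1 by field; rewrite !gt_eqF.
lra.
Qed.

Lemma ent_bounds d (g : 'cV[C]_(d * d)) : (0 < d)%N -> fro g = 1 -> 0 <= ent g <= log2 d%:R.
Proof.
move=> d0 g1; have /andP[h1 h2] := xlnx_unit_bounds d0 g1; have l2 := ln2_gt0.
rewrite entE /log2; apply/andP; split; first by rewrite divr_ge0 ?oppr_ge0 // ltW.
by rewrite ler_pM2r ?invr_gt0 //; lra.
Qed.

Lemma ent_normalized d (g : 'cV[C]_(d * d)) : 0 < fro g ->
  ent ((Num.sqrt (fro g))^-1%:CR *: g) = (ln (fro g) - Fpsi (fun x => x * ln x) g / fro g) / ln 2.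
Proof.
move=> P0; rewrite entE Fpsi_scale exprVn sqr_sqrtr ?ltW //; set P := fro g in P0 *; congr (_ / _).
have s1 : \sum_i eigs (mat g *m ctr (mat g)) i = P by rewrite sum_eigs_gram fro_mat.
have x0 i : 0 <= eigs (mat g *m ctr (mat g)) i by exact: eigs_gram_ge0.
rewrite /Fpsi /spf; move: (eigs _) s1 x0 => x s1 x0.
have -> : \sum_i (P^-1 * x i) * ln (P^-1 * x i) = P^-1 * \sum_i x i * ln (x i) - P^-1 * P * ln P.
  have -> : P^-1 * P * ln P = \sum_i P^-1 * x i * ln P by rewrite -mulr_suml -mulr_sumr s1.
  rewrite mulr_sumr -sumrB; apply: eq_bigr => i _.
  have [->|xn] := eqVneq (x i) 0; first by rewrite !(mulr0, mul0r) subrr.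
  have xp : 0 < x i by rewrite lt_neqAle eq_sym xn x0.
  by rewrite lnM ?posrE ?invr_gt0 // lnV ?posrE //; ring.
by rewrite mulVf ?gt_eqF // mul1r; ring.
Qed.

Definition xl (y : R) : R := y * ln y - y.

(** Since [xl] is an antiderivative of ln, this compares ln (y + 1) with the integral of ln over the
    unit interval ending at y + 1. *)
Lemma xl_step (y : R) : 0 <= y -> 0 <= ln (y + 1) - (xl (y + 1) - xl y) <= (y + 1)^-1.
Proof.
move=> y0; have y1 : 0 < y + 1 by lra.
rewrite /xl.
have -> : ln (y + 1) - ((y + 1) * ln (y + 1) - (y + 1) - (y * ln y - y)) = 1 - y * (ln (y + 1) - ln y) by ring.
have [->|yn] := eqVneq y 0; first by rewrite mul0r subr0 add0r invr1 lexx ler01.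
have yp : 0 < y by rewrite lt_neqAle eq_sym yn.
have q0 : 0 < (y + 1) / y by rewrite divr_gt0.
have lq : ln ((y + 1) / y) = ln (y + 1) - ln y by rewrite lnM ?posrE ?invr_gt0 // lnV ?posrE.
have h1 := ln_le_sub1 q0; have h2 := ln_ge1V q0; rewrite lq in h1 h2.
have := ler_wpM2l y0 h1; have := ler_wpM2l y0 h2.
have -> : y * (1 - ((y + 1) / y)^-1) = 1 - (y + 1)^-1 by field; rewrite !gt_eqF.
have -> : y * ((y + 1) / y - 1) = 1 by field; rewrite gt_eqF.
move=> e1 e2; apply/andP; split; lra.
Qed.

Lemma sum_ln_xl (x : R) N : 0 <= x ->
  0 <= \sum_(1 <= j < N.+1) ln (x + j%:R) - (xl (x + N%:R) - xl x) <= \sum_(1 <= j < N.+1) j%:R^-1.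
Proof.
move=> x0; elim: N => [|N IH]; first by rewrite !big_geq // addr0 !subrr lexx.
rewrite [\sum_(1 <= j < N.+2) ln _]big_nat_recr //= [\sum_(1 <= j < N.+2) _^-1]big_nat_recr //=; set S1 := \sum_(1 <= j < N.+1) _ in IH *; set S2 := \sum_(1 <= j < N.+1) _ in IH *.
have n0 : 0 <= N%:R :> R by [].
have := @xl_step (x + N%:R); rewrite addr_ge0 // => /(_ isT); rewrite -addrA natr1 => /andP[h1 h2].
have h3 : (x + N.+1%:R)^-1 <= N.+1%:R^-1 by rewrite lef_pV2 ?posrE ?ltr_wpDl // lerDr.
move: IH => /andP[h4 h5]; clearbody S1 S2.
move: (ln (x + N.+1%:R)) (xl (x + N.+1%:R)) (xl (x + N%:R)) ((x + N.+1%:R)^-1) (N.+1%:R^-1) h1 h2 h3 h4 h5.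
by move=> a b c e f h1 h2 h3 h4 h5; apply/andP; split; lra.
Qed.

Section Translate.
Variable d : nat.
Hypothesis d2 : (2 <= d)%N.
Let N := (d ^ 3)%N.
Let d_gt0 : (0 < d)%N. Proof. exact: ltnW. Qed.
Let d0 : (0 : R) < d%:R. Proof. by rewrite ltr0n. Qed.
Let NE : (N%:R : R) = d%:R ^+ 3. Proof. by rewrite /N natrX. Qed.
Let N0 : (0 : R) < N%:R. Proof. by rewrite NE exprn_gt0. Qed.

(** The sum of ln (x + j) over j <= N is xl (x + N) - xl x up to a harmonic error, which is solved
    for x ln x = xl x + x. Splitting ln (x + N) into ln N and a remainder gives [z] = (x + N) ln (1
    + x / N), nearly x. *)
Lemma xlnx_psi1 (x : R) : 0 <= x -> exists z e : R,
  [/\ x <= z <= x + x ^+ 2 / N%:R, 0 <= e <= HN d &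
   x * ln x = (x + N%:R) * ln N%:R + z - N%:R - HN d * psi1 d x + e].
Proof.
move=> x0; have := sum_ln_xl N x0; rewrite -/(HN d) => /andP[h1 h2].
have H0 : 0 < HN d :> R by have := HN_ge1 (R := R) d2; lra.
have HP : HN d * psi1 d x = \sum_(1 <= j < N.+1) ln (x + j%:R) by rewrite /psi1 mulrA mulfV ?mul1r ?gt_eqF.
have xN : 0 < x + N%:R by have := N0; lra.
exists ((x + N%:R) * (ln (x + N%:R) - ln N%:R)), (HN d * psi1 d x - (xl (x + N%:R) - xl x)).
split; last by rewrite /xl; ring.
  have q0 : 0 < (x + N%:R) / N%:R by rewrite divr_gt0.
  have lq : ln ((x + N%:R) / N%:R) = ln (x + N%:R) - ln N%:R by rewrite lnM ?posrE ?invr_gt0 // lnV ?posrE.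
  have e1 := ln_le_sub1 q0; have e2 := ln_ge1V q0; rewrite lq in e1 e2.
  have := ler_wpM2l (ltW xN) e1; have := ler_wpM2l (ltW xN) e2.
  have -> : (x + N%:R) * (1 - ((x + N%:R) / N%:R)^-1) = x by field; rewrite !gt_eqF.
  have -> : (x + N%:R) * ((x + N%:R) / N%:R - 1) = x + x ^+ 2 / N%:R by field; rewrite gt_eqF.
  by move=> -> ->.
by rewrite HP h1.
Qed.

Lemma Fxlnx (g : 'cV[C]_(d * d)) : exists z e : R,
  [/\ fro g <= z <= fro g + fro g ^+ 2 / N%:R, 0 <= e <= d%:R * HN d &
   Fpsi (fun x => x * ln x) g = (fro g + d%:R * N%:R) * ln N%:R + z - d%:R * N%:R - HN d * Fpsi (psi1 d) g + e].
Proof.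
have s1 : \sum_i eigs (mat g *m ctr (mat g)) i = fro g by rewrite sum_eigs_gram fro_mat.
have x0 i : 0 <= eigs (mat g *m ctr (mat g)) i by exact: eigs_gram_ge0.
rewrite /Fpsi /spf; move: (eigs _) s1 x0 => x s1 x0.
have [ze hze] : {ze : 'I_d -> R * R & forall i, [/\ x i <= (ze i).1 <= x i + x i ^+ 2 / N%:R, 0 <= (ze i).2 <= HN d &
   x i * ln (x i) = (x i + N%:R) * ln N%:R + (ze i).1 - N%:R - HN d * psi1 d (x i) + (ze i).2]}.
  apply: (@choice _ _ (fun i (p : R * R) => [/\ x i <= p.1 <= x i + x i ^+ 2 / N%:R, 0 <= p.2 <= HN d &
   x i * ln (x i) = (x i + N%:R) * ln N%:R + p.1 - N%:R - HN d * psi1 d (x i) + p.2])) => i.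
  by have [z [e h]] := xlnx_psi1 (x0 i); exists (z, e).
exists (\sum_i (ze i).1), (\sum_i (ze i).2); split.
- apply/andP; split; first by rewrite -s1; apply: ler_sum => i _; have [/andP[]] := hze i.
  apply: (@le_trans _ _ (\sum_i (x i + x i ^+ 2 / N%:R))).
    by apply: ler_sum => i _; have [/andP[]] := hze i.
  rewrite big_split /= s1 lerD2l -mulr_suml ler_pM2r ?invr_gt0 // -s1.
  rewrite [leRHS]expr2 mulr_suml; apply: ler_sum => i _; rewrite expr2 ler_wpM2l // (bigD1 i) //= lerDl.
  exact: sumr_ge0.
- apply/andP; split; first by apply: sumr_ge0 => i _; have [_ /andP[]] := hze i.
  rewrite mulr_natl -[X in _ *+ X]card_ord -sumr_const; apply: ler_sum => i _; by have [_ /andP[]] := hze i.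
- rewrite (eq_bigr (fun i => x i * ln N%:R + N%:R * ln N%:R + (ze i).1 - N%:R - HN d * psi1 d (x i) + (ze i).2)); last first.
    by move=> i _; have [_ _ ->] := hze i; ring.
  rewrite !big_split /= !sumrN -mulr_suml s1 -mulr_sumr !sumr_const card_ord.
  by rewrite -[ln N%:R *+ d]mulr_natl -[N%:R *+ d]mulr_natl -[\sum_i HN d * _]mulr_sumr; move: (HN d) (N%:R) (ln _) => hh nn ll; ring.
Qed.

(** With kap <= 1/10, the squared norm P is within d^2 / 2 of d^2, so the identity can be multiplied
    by P. The errors that remain are of order d^2 kap ln d, where ln d is the factor [HN] on the
    deviation of [psi1], and d ln d. *)
Lemma entropy_close (g : 'cV[C]_(d * d)) (m kap : R) : 0 < kap -> kap <= 10^-1 ->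
  `|HN d * m - (N%:R * d%:R * (ln N%:R - 1) + d%:R ^+ 2 / 2 + d%:R ^+ 2 * ln N%:R - d%:R ^+ 2 * ln d%:R)|
   <= 27 * d%:R * ln d%:R ->
  `|fro g - d%:R ^+ 2| <= 5 * d%:R ^+ 2 * kap ->
  `|Fpsi (psi1 d) g - m| <= 5 * d%:R ^+ 2 * kap ->
  0 < fro g /\ `|(ln (fro g) - Fpsi (fun x => x * ln x) g / fro g) - (ln d%:R - 2^-1)|
     <= 160 * kap * ln d%:R + 80 * ln d%:R / d%:R.
Proof.
move=> k0 k1 hm hP hF.
have l2 : 2^-1 <= ln d%:R :> R.
  by apply: (le_trans ln2_ge); rewrite ler_ln ?posrE // ler_nat.
have dd : (2 : R) <= d%:R by rewrite ler_nat.
pose D2 : R := d%:R ^+ 2; have D20 : 0 < D2 by rewrite exprn_gt0.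
set P := fro g in hP *.
have Dk : D2 * kap <= D2 / 10 by rewrite ler_pM2l.
have Dk0 : 0 < D2 * kap by rewrite mulr_gt0.
rewrite -/D2 in hP hF hm.
have {hP} /andP[P1' P2'] : - (5 * (D2 * kap)) <= P - D2 <= 5 * (D2 * kap) by rewrite -ler_norml mulrA.
have Plo : D2 / 2 <= P by lra.
have Phi : P <= 3 / 2 * D2 by lra.
have P0 : 0 < P by lra.
split => //.
have [z [e [/andP[z1 z2] /andP[e1 e2] ->]]] := Fxlnx g; rewrite -/P in z1 z2 *.
set L := ln d%:R in l2 hm *.
have LN : ln N%:R = 3 * L by rewrite NE lnXn // mulr_natl.
rewrite LN in hm *.
have HH : HN d <= 1 + 3 * L :> R by exact: HN_le.
have H1 : 1 <= HN d :> R by exact: HN_ge1.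
set H := HN d in hm HH H1 e2 *; set FF := Fpsi (psi1 d) g in hF *.
pose eps := H * m - (N%:R * d%:R * (3 * L - 1) + D2 / 2 + D2 * (3 * L) - D2 * L).
have he : `|eps| <= 27 * d%:R * L by [].
pose del := FF - m.
have hd : `|del| <= 5 * (D2 * kap) by rewrite mulrA.
have HFF : H * FF = N%:R * d%:R * (3 * L - 1) + D2 / 2 + D2 * (3 * L) - D2 * L + eps + H * del.
  by rewrite /eps /del; ring.
pose zeta := z - P.
have hz : 0 <= zeta <= 4 * d%:R.
  apply/andP; split; first by rewrite /zeta subr_ge0.
  apply: (@le_trans _ _ (P ^+ 2 / N%:R)); first by rewrite /zeta; lra.
  rewrite ler_pdivrMr // (_ : 4 * d%:R * N%:R = (2 * D2) ^+ 2); last by rewrite NE /D2; ring.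
  by rewrite lerXn2r ?nnegrE //; lra.
pose pi' := P / D2.
have pi1 : 2^-1 <= pi' by rewrite /pi' ler_pdivlMr //; lra.
have lnP : ln P = 2 * L + ln pi'.
  have pp : 0 < pi' by lra.
  rewrite (_ : P = D2 * pi'); last by rewrite /pi' mulrC divfK // gt_eqF.
  by rewrite lnM ?posrE // /D2 lnXn // mulr_natl.
have lpi : `|ln pi'| <= 10 * kap.
  have pp : 0 < pi' by lra.
  have a1 := ln_le_sub1 pp; have a2 := ln_ge1V pp.
  have b1 : pi' - 1 <= 5 * kap.
    rewrite /pi' -(ler_pM2r D20) mulrBl divfK ?gt_eqF // mul1r; lra.
  have b2 : 1 - pi' <= 5 * kap.
    rewrite /pi' -(ler_pM2r D20) mulrBl divfK ?gt_eqF // mul1r; lra.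
  have b3 : pi'^-1 - 1 <= 10 * kap.
    have -> : pi'^-1 - 1 = (1 - pi') / pi' by field; rewrite gt_eqF.
    by rewrite ler_pdivrMr //; nra.
  by rewrite ler_norml; apply/andP; split; lra.
(* The terms in d N cancel exactly, and the other main terms combine into P - D2 times a factor
   O(L). The constant 1/2 of the limit comes from D2 / 2 in the mean of [psi1]. *)
have key : P * (ln P - ((P + d%:R * N%:R) * (3 * L) + z - d%:R * N%:R - H * FF + e) / P - (L - 2^-1)) =
   (P - D2) * (L - 3 * L - 2^-1) + P * ln pi' - zeta + eps + H * del - e.
  rewrite HFF lnP /zeta; field; rewrite gt_eqF //.
have Pne : P != 0 by rewrite gt_eqF.
set Y := (_ - _ - (L - 2^-1)) in key *.
have bP : `|P * Y| <= 5 * (D2 * kap) * (2 * L + 2^-1) + 3 / 2 * D2 * (10 * kap) + 4 * d%:R + 27 * d%:R * L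
    + (1 + 3 * L) * (5 * (D2 * kap)) + d%:R * (1 + 3 * L).
  rewrite key.
  have n1 : `|(P - D2) * (L - 3 * L - 2^-1)| <= 5 * (D2 * kap) * (2 * L + 2^-1).
    rewrite normrM ler_pM // ?ler_norml ?P1' ?P2' //; apply/andP; split; lra.
  have n2 : `|P * ln pi'| <= 3 / 2 * D2 * (10 * kap) by rewrite normrM ler_pM // gtr0_norm.
  have n3 : `|zeta| <= 4 * d%:R by move: hz => /andP[w1 w2]; rewrite ger0_norm.
  have n5 : `|H * del| <= (1 + 3 * L) * (5 * (D2 * kap)) by rewrite normrM ler_pM // ger0_norm //; lra.
  have n6 : `|e| <= d%:R * (1 + 3 * L).
    by rewrite ger0_norm //; apply: (le_trans e2); rewrite ler_pM2l.
  move: n1 n2 n3 he n5 n6; rewrite !ler_norml.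
  move=> /andP[? ?] /andP[? ?] /andP[? ?] /andP[? ?] /andP[? ?] /andP[? ?]; apply/andP; split; lra.
have bY : D2 / 2 * `|Y| <= `|P * Y| by rewrite normrM (gtr0_norm P0) ler_wpM2r.
have dL : d%:R <= 2 * (d%:R * L) by nra.
have kL : D2 * kap <= 2 * (D2 * kap * L) by nra.
have c1 : `|P * Y| <= D2 / 2 * (160 * kap * L + 80 * L / d%:R).
  apply: (le_trans bP).
  have -> : D2 / 2 * (160 * kap * L + 80 * L / d%:R) = 80 * (D2 * kap * L) + 40 * (d%:R * L).
    by rewrite /D2; field; rewrite gt_eqF.
  have -> : 5 * (D2 * kap) * (2 * L + 2^-1) + 3 / 2 * D2 * (10 * kap) + 4 * d%:R + 27 * d%:R * L
    + (1 + 3 * L) * (5 * (D2 * kap)) + d%:R * (1 + 3 * L) =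
    25 * (D2 * kap * L) + (5 / 2 + 20) * (D2 * kap) + 5 * d%:R + 30 * (d%:R * L) by field.
  lra.
have D22 : 0 < D2 / 2 by lra.
by rewrite -(ler_pM2l D22); apply: le_trans c1.
Qed.

End Translate.

End Entropy.

Import HBNNSimple.

(** * From Gaussian expectations to the cone measure on the sphere *)

Section Cone.
Context {R : realType}.
Local Notation mu := (@lebesgue_measure R).
Local Notation ep := (@exponential_pdf R 1).

Definition rho2 k (v : seq R) : R := \sum_(i < k) (nth 0 v i) ^+ 2.

Lemma rho2_ge0 k v : 0 <= rho2 k v.
Proof. by apply: sumr_ge0 => i _; exact: sqr_ge0. Qed.

Lemma euclid_rho2 k v : size v = k -> euclid_norm v = Num.sqrt (rho2 k v).
Proof. by move=> <-; rewrite /euclid_norm /rho2 (big_nth 0) big_mkord. Qed.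

Lemma rho2_scale k r v : size v = k -> rho2 k (map (fun x => r * x) v) = r ^+ 2 * rho2 k v.
Proof.
move=> sv; rewrite /rho2 mulr_sumr; apply: eq_bigr => i _.
by rewrite (nth_map 0) ?sv // exprMn.
Qed.

Lemma measurable_rho2 k : measurable_fun setT (fun v : Om R => rho2 k v : measurableTypeR R).
Proof. by apply: measurable_sum => i; apply: measurable_funX; exact: measurable_nth. Qed.

Lemma rho2_cons k x v : rho2 k.+1 (x :: v) = x ^+ 2 + rho2 k v.
Proof. by rewrite /rho2 big_ord_recl. Qed.

Definition gcst k : R := (Num.sqrt pi)^-1 ^+ k.

Lemma gcst_gt0 k : 0 < gcst k.
Proof. by rewrite exprn_gt0 // invr_gt0 sqrtr_gt0 pi_gt0. Qed.

Lemma EG_density k (f : Om R -> \bar R) : measurable_fun setT f -> (forall v, (0 <= f v)%E) ->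
  EG k f = itI mu k (fun v => (f v * (gcst k * expR (- rho2 k v))%:E)%E).
Proof.
rewrite /EG; elim: k f => [|k IH] f mf f0 /=.
  by rewrite /gcst /rho2 big_ord0 oppr0 expR0 expr0 mulr1 mule1.
have mfx x : measurable_fun setT (fun v : Om R => f (x :: v)).
  by apply: (measurableT_comp mf); exact: measurable_consO.
have md : measurable_fun setT (fun v : Om R => ((gcst k * expR (- rho2 k v))%:E : \bar R)).
  apply/measurable_EFinP; apply: measurable_funM => //; apply: measurableT_comp => //.
  by apply: measurable_funN; exact: measurable_rho2.
have d0 (v : seq R) : (0 <= (gcst k * expR (- rho2 k v))%:E)%E.
  by rewrite lee_fin mulr_ge0 ?expR_ge0 // ltW // gcst_gt0.
rewrite integral_gau //; last 2 first.
- exact: measurable_itI_cons.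
- by move=> x; exact: itI_ge0.
apply: eq_integral => x _; rewrite IH // muleC -itI_Z //; last 3 first.
- exact: emeasurable_funM.
- by move=> v; rewrite mule_ge0.
- by rewrite lee_fin ltW // gpdf_gt0.
apply: eq_itI => v _; rewrite muleCA; congr (_ * _)%E; rewrite -EFinM rho2_cons /gpdf /gcst opprD expRD [_^-1 ^+ k.+1]exprS.
by congr EFin; ring.
Qed.

(** Writes the Gaussian weight as a mixture of indicators of balls of squared radius t, with t of
    exponential law. *)
Lemma expR_layer rho : 0 <= rho ->
  (\int[mu]_t (ep t * (if rho <= t then 1 else 0))%:E)%E = (expR (- rho))%:E.
Proof.
move=> r0.
have mE : measurable_fun [set: measurableTypeR R] (fun t : measurableTypeR R => (ep t)%:E).
  by apply/measurable_EFinP; exact: measurable_exponential_pdf.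
have m1 : measurable_fun [set: measurableTypeR R] (fun t : measurableTypeR R => (ep t * (if rho <= t then 1 else 0))%:E).
  apply/measurable_EFinP; apply: measurable_funM; first exact: measurable_exponential_pdf.
  by apply: measurable_fun_ifT => //; apply: measurable_fun_ler.
have p0 t : 0 <= ep t * (if rho <= t then 1 else 0) by rewrite mulr_ge0 ?exponential_pdf_ge0 //; case: ifP.
rewrite -(integral_translate rho m1) => [|t]; last by rewrite lee_fin.
transitivity (\int[mu]_t ((expR (- rho))%:E * (ep t)%:E))%E; last first.
  rewrite ge0_integralZl //.
  - by rewrite integral_exponential_pdf // mule1.
  - by move=> t _; rewrite lee_fin exponential_pdf_ge0.
apply: eq_integral => t _; rewrite -EFinM; congr EFin.
rewrite lerDr; case: (lerP 0 t) => t0.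
  rewrite !exponential_pdfE //; last by rewrite addr_ge0.
  by rewrite mulr1 !mul1r -expRD; congr expR; ring.
by rewrite [ep t]lt0_exponential_pdf // !mulr0.
Qed.

Definition vol (A : set (seq R)) k t : \bar R := itI mu k (fun v : Om R => (\1_A v * (if rho2 k v <= t then 1 else 0))%:E).

Lemma vol_ge0 A k t : (0 <= vol A k t)%E.
Proof. by apply: itI_ge0 => v; rewrite lee_fin mulr_ge0 //; case: ifP. Qed.

Lemma EG_layer k (A : set (Om R)) : measurable A ->
  EG k (fun v : Om R => (\1_A v)%:E) = ((gcst k)%:E * \int[mu]_t ((ep t)%:E * vol A k t))%E.
Proof.
move=> mA.
have m1 : measurable_fun setT (fun v : Om R => (\1_A v : R)%:E).
  by apply/measurable_EFinP; exact: measurable_indic.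
have i0 v : (0 <= (\1_A v : R)%:E)%E by rewrite lee_fin.
rewrite EG_density //.
pose f (z : measurableTypeR R * Om R) : \bar R := (ep z.1 * (\1_A z.2 * (if rho2 k z.2 <= z.1 then 1 else 0)))%:E.
have mf : measurable_fun setT f.
  apply/measurable_EFinP; apply: measurable_funM.
    by apply: measurableT_comp; [exact: measurable_exponential_pdf | exact: measurable_fst].
  apply: measurable_funM.
    by apply: measurableT_comp; [exact: measurable_indic | exact: measurable_snd].
  apply: measurable_fun_ifT => //; apply: measurable_fun_ler; last exact: measurable_fst.
  by apply: measurableT_comp; [exact: measurable_rho2 | exact: measurable_snd].
have f0 z : (0 <= f z)%E.
  by rewrite lee_fin !mulr_ge0 ?exponential_pdf_ge0 //; case: ifP.
transitivity (itI mu k (fun v => (gcst k)%:E * \int[mu]_t f (t, v))%E).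
  apply: eq_itI => v _; rewrite EFinM muleCA; congr (_ * _)%E.
  rewrite -expR_layer ?rho2_ge0 // -ge0_integralZl //.
  - by apply: eq_integral => t _; rewrite -EFinM /f /= mulrCA.
  - apply/measurable_EFinP; apply: measurable_funM; first exact: measurable_exponential_pdf.
    by apply: measurable_fun_ifT => //; apply: measurable_fun_ler.
  - by move=> t _; rewrite lee_fin mulr_ge0 ?exponential_pdf_ge0 //; case: ifP.
rewrite itI_Z; last 3 first.
- by apply: (measurable_fun_fubini_tonelli_G (m1 := mu)).
- by move=> v; apply: integral_ge0.
- by rewrite lee_fin ltW // gcst_gt0.
congr (_ * _)%E; rewrite -itI_fubini //; apply: eq_integral => t _.
rewrite /vol -itI_Z //.
- apply/measurable_EFinP; apply: measurable_funM; first exact: measurable_indic.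
  by apply: measurable_fun_ifT => //; apply: measurable_fun_ler => //; exact: measurable_rho2.
- by move=> v; rewrite lee_fin mulr_ge0 //; case: ifP.
- by rewrite lee_fin exponential_pdf_ge0.
Qed.

Lemma integralZ_lower (c : R) (g : R -> \bar R) : 0 < c -> (forall x, (0 <= g x)%E) ->
  (\int[mu]_x (c%:E * g x) <= c%:E * \int[mu]_x g x)%E.
Proof.
move=> c0 g0; rewrite [leLHS]ge0_integralTE //; last by move=> x; rewrite mule_ge0 // lee_fin ltW.
apply: ge_ereal_sup => _ [h hf <-].
have mh : measurable_fun setT (fun x : measurableTypeR R => (h x)%:E) by exact/measurable_EFinP.
have h0 x : (0 <= (h x)%:E)%E by rewrite lee_fin.
have ci : 0 <= c^-1 by rewrite invr_ge0 ltW.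
rewrite -integralT_nnsfun.
have -> : (\int[mu]_x (h x)%:E = c%:E * \int[mu]_x ((c^-1)%:E * (h x)%:E))%E.
  by rewrite ge0_integralZl // muleA -EFinM mulfV ?gt_eqF // mul1e.
rewrite lee_pmul2l //; apply: ge0_le_integral_lower => x; first by rewrite mule_ge0.
have := lee_wpmul2l (ci : (0 <= (c^-1)%:E)%E) (hf x).
by rewrite muleA -[((c^-1)%:E * c%:E)%E]EFinM mulVf ?gt_eqF // mul1e.
Qed.

(** Stated as an inequality, so that no measurability is asked of [f]; scaling by the inverse gives
    the other direction. *)
Lemma itI_scale k r (f : Om R -> \bar R) : 0 < r -> (forall v, (0 <= f v)%E) ->
  (itI mu k f <= (r ^+ k)%:E * itI mu k (fun v : Om R => f (map (fun x => r * x)%R v)))%E.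
Proof.
move=> r0; elim: k f => [|k IH] f f0 /=; first by rewrite expr0 mul1e.
apply: (le_trans (le_integral_scale_lower r0 _)) => [x|]; first exact: itI_ge0.
rewrite exprS EFinM -muleA lee_pmul2l //=.
apply: le_trans (integralZ_lower (exprn_gt0 k r0) _) => [|x]; last exact: itI_ge0.
apply: ge0_le_integral_lower => x; first exact: itI_ge0.
exact: IH.
Qed.

Definition hrad k (t : R) : R := if 0 < t then Num.sqrt t ^+ k else 0.
(** This is Gamma (k / 2 + 1). It multiplies the volumes of both cone and ball and cancels in their
    ratio. *)
Definition Irad k : \bar R := (\int[mu]_t ((ep t)%:E * (hrad k t)%:E))%E.

Lemma hrad_ge0 k t : 0 <= hrad k t.
Proof. by rewrite /hrad; case: ifP => // _; rewrite exprn_ge0 // sqrtr_ge0. Qed.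

Lemma measurable_hrad k : measurable_fun [set: measurableTypeR R] (hrad k : measurableTypeR R -> measurableTypeR R).
Proof.
apply: measurable_fun_ifT => //; first by apply: measurable_fun_ltr.
apply: measurable_funX; apply: continuous_measurable_fun; exact: sqrt_continuous.
Qed.

Lemma measurable_ephrad k : measurable_fun [set: measurableTypeR R] (fun t : measurableTypeR R => ((ep t)%:E * (hrad k t)%:E)%E).
Proof.
apply: emeasurable_funM; apply/measurable_EFinP; [exact: measurable_exponential_pdf | exact: measurable_hrad].
Qed.

Lemma ephrad_ge0 k t : (0 <= (ep t)%:E * (hrad k t)%:E)%E.
Proof. by rewrite mule_ge0 // lee_fin ?exponential_pdf_ge0 ?hrad_ge0. Qed.

(** [S] has to contain the cone over [A] cut by the unit ball, while [A] itself is an arbitrary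
    measurable set. Each layer of squared radius t is rescaled to the unit ball, which produces the
    factor [hrad]. *)
Lemma EG_cone_le k (A : set (Om R)) (S : set (seq R)) : measurable A ->
  (forall v, A v -> size v = k -> 0 < rho2 k v) ->
  (forall v r, 0 < r -> size v = k -> A (map (fun x => r * x) v) -> rho2 k v <= 1 -> S v) ->
  (EG k (fun v : Om R => (\1_A v)%:E) <= (gcst k)%:E * (lebesgue_k k S * Irad k))%E.
Proof.
move=> mA A0 AS; rewrite EG_layer // lee_pmul2l //; last by rewrite lte_fin gcst_gt0.
have L0 : (0 <= lebesgue_k k S)%E by apply: itI_ge0 => v; rewrite lee_fin.
rewrite /Irad -ge0_integralZl //; last 2 first.
- exact: measurable_ephrad.
- by move=> t _; exact: ephrad_ge0.
apply: ge0_le_integral_lower => t.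
  by rewrite mule_ge0 ?vol_ge0 // lee_fin exponential_pdf_ge0.
rewrite muleCA lee_wpmul2l ?lee_fin ?exponential_pdf_ge0 //.
rewrite /hrad; case: ifP => t0; last first.
  rewrite mule0 /vol (@eq_itI _ _ _ _ (fun=> 0%E)).
    by rewrite (_ : itI _ _ _ = 0%E) //; elim: (k) => //= l ->; exact: integral0.
  move=> v sv; rewrite indicE; case: (boolP (v \in A)) => [/set_mem Av|_]; last by rewrite mul0r.
  have := A0 v Av sv; case: ifP => //; rewrite ?mulr0 // => h1 h2.
  by move: t0; rewrite (lt_le_trans h2 h1).
have r0 : 0 < Num.sqrt t by rewrite sqrtr_gt0.
apply: (le_trans (itI_scale k r0 _)) => [v|]; first by rewrite lee_fin mulr_ge0 //; case: ifP.
rewrite muleC lee_wpmul2r ?lee_fin ?exprn_ge0 ?sqrtr_ge0 //.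
apply: le_itI => v; first by rewrite lee_fin mulr_ge0 //; case: ifP.
move=> sv; rewrite lee_fin rho2_scale // sqr_sqrtr ?(ltW t0) // !indicE.
case: (boolP (_ \in A)) => [/set_mem Av|_]; last by rewrite mul0r.
case: ifP => h; last by rewrite mulr0.
have h1 : rho2 k v <= 1 by move: h; rewrite -{2}[t]mulr1 ler_pM2l.
by rewrite (mem_set (AS v _ r0 sv Av h1)) mulr1.
Qed.

(** One half of the identity that normalises the ball volume, from scaling by the inverse radius;
    the other half is [bu] in [cone_lower], from [EG_cone_le]. *)
Lemma ball_le k : ((gcst k)%:E * (lebesgue_k k (@unit_ball R) * Irad k) <= 1)%E.
Proof.
have <- : EG k (fun v : Om R => (\1_[set: Om R] v : R)%:E) = 1%E.
  by rewrite -(@EG_cst R k 1) //; apply: eq_itI => v _; rewrite indicT.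
rewrite EG_layer // lee_pmul2l //; last by rewrite lte_fin gcst_gt0.
have L0 : (0 <= lebesgue_k k (@unit_ball R))%E by apply: itI_ge0 => v; rewrite lee_fin.
rewrite /Irad -ge0_integralZl //; last 2 first.
- exact: measurable_ephrad.
- by move=> t _; exact: ephrad_ge0.
apply: ge0_le_integral_lower => t; first by rewrite mule_ge0 // ephrad_ge0.
rewrite muleCA lee_wpmul2l ?lee_fin ?exponential_pdf_ge0 //.
rewrite /hrad; case: ifP => t0; last by rewrite mule0 vol_ge0.
have r0 : 0 < Num.sqrt t by rewrite sqrtr_gt0.
have ri : 0 < (Num.sqrt t)^-1 by rewrite invr_gt0.
have := @itI_scale k _ (fun v : Om R => (\1_(@unit_ball R) v)%:E) ri.
move=> /(_ _) h; have {}h := h (fun v => ltac:(by rewrite lee_fin)).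
apply: (@le_trans _ _ ((Num.sqrt t ^+ k)%:E * (((Num.sqrt t)^-1 ^+ k)%:E * vol setT k t))%E); last first.
  by rewrite muleA -EFinM -exprMn mulfV ?gt_eqF // expr1n mul1e.
rewrite muleC lee_wpmul2l ?lee_fin ?exprn_ge0 ?sqrtr_ge0 //.
apply: (le_trans h); rewrite lee_wpmul2l ?lee_fin ?exprn_ge0 ?(ltW ri) //.
apply: le_itI => v; first by rewrite lee_fin.
move=> sv; rewrite lee_fin indicT mul1r indicE.
case: (boolP (_ \in _)) => [/set_mem|_]; last by case: ifP.
rewrite /unit_ball /= (@euclid_rho2 k) ?size_map // rho2_scale // => h1.
have h2 : (Num.sqrt t)^-1 ^+ 2 * rho2 k v <= 1.
  rewrite -[leLHS]sqr_sqrtr; last by rewrite mulr_ge0 ?sqr_ge0 ?rho2_ge0.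
  by rewrite expr_le1 // sqrtr_ge0.
move: h2; rewrite exprVn sqr_sqrtr ?(ltW t0) // ler_pdivrMl // mulr1 => ->.
by [].
Qed.

(** A measurable null set that contains the origin; outside it the norm is positive and the vector
    can be normalised. *)
Lemma EG_hyperplane k : EG k.+1 (fun v : Om R => (\1_[set v : Om R | nth 0 v 0 = 0] v : R)%:E) = 0%E.
Proof.
rewrite /EG /=.
transitivity (\int[@gau R]_x (\1_[set (0 : R)] x)%:E)%E.
  apply: eq_integral => x _; transitivity (EG k (fun _ : seq R => (indic [set (0 : R)] x : R)%:E)); last by rewrite EG_cst.
  apply: eq_itI => v _.
  by rewrite !indicE; congr (_%:R)%:E; apply/idP/idP => /set_mem h; apply/mem_set.
rewrite integral_gau; last 2 first.
- by apply/measurable_EFinP; exact: measurable_indic.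
- by move=> x; rewrite lee_fin.
apply/eqP; rewrite eq_le; apply/andP; split; last first.
  by apply: integral_ge0 => x _; rewrite mule_ge0 // lee_fin ?(ltW (gpdf_gt0 _)).
apply: (@le_trans _ _ (\int[mu]_x ((gpdf 0)%:E * (\1_[set (0:R)] x)%:E))%E).
  apply: ge0_le_integral_lower => x; first by rewrite mule_ge0 // lee_fin ?(ltW (gpdf_gt0 _)).
  rewrite muleC indicE; case: (boolP (x \in _)) => [/set_mem ->|_] //.
  by rewrite !mule0.
rewrite ge0_integralZl //.
- have h := lebesgue_measure_set1 (0 : R).
  by rewrite integral_indic // setIT [X in (_ * X)%E](_ : _ = 0%E) ?mule0 //; exact: h.
- by apply/measurable_EFinP; exact: measurable_indic.
- by rewrite lee_fin ltW // gpdf_gt0.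
Qed.

Lemma cone_lower K (E : 'cV[R[i]]_K -> Prop) (W : Om R -> \bar R) (del : R) : (0 < K)%N ->
  measurable_fun setT W -> (forall v, (0 <= W v)%E) -> (EG (2 * K) W <= del%:E)%E -> del <= 1 ->
  (forall v, size v = (2 * K)%N -> (W v < 1)%E -> 0 < euclid_norm v ->
     E (cvec_of K (map (fun x => x / euclid_norm v) v))) ->
  ((1 - del)%:E <= unif_sphere_prob E)%E.
Proof.
move=> K0 mW W0 EW del1 hE.
have [k kE] : exists k, (2 * K)%N = k.+1 by exists (2 * K).-1; rewrite prednK // muln_gt0.
pose Z : set (Om R) := [set v | nth 0 v 0 = 0].
have mZ : measurable Z.
  have := @measurable_nth R 0 measurableT _ (measurable_set1 (0 : R)).
  by rewrite setTI.
have mWl : measurable [set v : Om R | (W v < 1)%E].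
  by have := emeasurable_fun_infty_o measurableT mW 1%E; rewrite setTI.
pose A := [set v : Om R | (W v < 1)%E] `\` Z.
have mA : measurable A by exact: measurableD.
have mI (B : set (Om R)) : measurable B -> measurable_fun setT (fun v : Om R => (\1_B v : R)%:E).
  by move=> mB; apply/measurable_EFinP; exact: measurable_indic.
have rho_pos v : ~ Z v -> 0 < rho2 (2 * K) v.
  move=> Zv; rewrite kE /rho2 big_ord_recl ltr_wpDr ?sumr_ge0 // => [i _|]; first exact: sqr_ge0.
  by rewrite lt_neqAle sqr_ge0 andbT eq_sym sqrf_eq0; apply/eqP.
have i1 (B : set (Om R)) (v : Om R) : B v -> (\1_B v : R) = 1 by move=> Bv; rewrite indicE mem_set.
have mA' := mI _ mA; have mZ' := mI _ mZ.
have mWZ : measurable_fun setT (fun v : Om R => W v + (\1_Z v : R)%:E)%E by exact: emeasurable_funD.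
have iA (v : Om R) : (0 <= (\1_A v : R)%:E)%E by rewrite lee_fin.
have iZ (v : Om R) : (0 <= (\1_Z v : R)%:E)%E by rewrite lee_fin.
have iWZ (v : Om R) : (0 <= W v + (\1_Z v : R)%:E)%E by rewrite adde_ge0.
have eZ : EG (2 * K) (fun v : Om R => (\1_Z v : R)%:E) = 0%E by rewrite kE; exact: EG_hyperplane.
have gA : ((1 - del)%:E <= EG (2 * K) (fun v : Om R => (\1_A v)%:E))%E.
  (* Markov's inequality in additive form: pointwise, 1 is at most the indicator of [A] plus [W]
     plus the indicator of [Z]. *)
  have h : (1 <= EG (2 * K) (fun v : Om R => (\1_A v)%:E) + (EG (2 * K) W + EG (2 * K) (fun v : Om R => (\1_Z v)%:E)))%E.
    rewrite /EG -itI_D // -itI_D //.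
    rewrite -(@EG_cst R (2 * K) 1) //; apply: le_itI => v; rewrite ?lee_fin // => _.
    case: (pselect (Z v)) => Zv.
      by rewrite (i1 Z v Zv) addeA leeDr // adde_ge0 // lee_fin.
    case: (pselect (W v < 1)%E) => Wv.
      have Av : A v by [].
      by rewrite (i1 A v Av) leeDl // adde_ge0 // lee_fin.
    have W1 : (1 <= W v)%E by rewrite leNgt; apply/negP.
    rewrite addeCA; apply: (le_trans W1); rewrite leeDl // adde_ge0 // lee_fin.
  move: h; rewrite eZ adde0 => h.
  rewrite EFinB leeBlDr //; apply: (le_trans h); rewrite leeD2l //.
have up := EG_cone_le mA (fun v Av sv => rho_pos v Av.2) (S := sphere_cone E).
have {}up := le_trans gA (up _).
have bl := ball_le (2 * K).
(* The complement of [Z] has full Gaussian measure, and its cone cut by radius 1 lies in the unit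
   ball. *)
have bu : (1 <= (gcst (2 * K))%:E * (lebesgue_k (2 * K) (@unit_ball R) * Irad (2 * K)))%E.
  have mZc : measurable (~` Z) by exact: measurableC.
  have := EG_cone_le mZc (fun v Zv sv => rho_pos v Zv) (S := @unit_ball R) (k := (2 * K)%N).
  move=> h; apply: le_trans (h _); last first.
    by move=> v r r0 sv _ h1; rewrite /unit_ball /= (euclid_rho2 sv) -sqrtr1 ler_wsqrtr.
  have := @EG_cst R (2 * K) 1 ler01; rewrite /EG => <-.
  have mZc' := mI _ mZc.
  have iZc (v : Om R) : (0 <= (\1_(~` Z) v : R)%:E)%E by rewrite lee_fin.
  rewrite -[leRHS]adde0 -[in leRHS]eZ /EG -itI_D //.
  apply: le_itI => v; rewrite ?lee_fin // => _; case: (pselect (Z v)) => Zv.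
    by rewrite (i1 Z v Zv) lerDr; exact: (iZc v).
  by rewrite (i1 (~` Z) v Zv) lerDl; exact: (iZ v).
have {}up : ((1 - del)%:E <= (gcst (2 * K))%:E * (lebesgue_k (2 * K) (sphere_cone E) * Irad (2 * K)))%E.
  apply: up => v r r0 sv [/= Wv Zv] h1.
  have ev := euclid_rho2 sv.
  have srv : size (map (fun x => r * x) v) = (2 * K)%N by rewrite size_map.
  have e2 : euclid_norm (map (fun x => r * x) v) = r * euclid_norm v.
    by rewrite (euclid_rho2 srv) rho2_scale // sqrtrM ?sqr_ge0 // sqrtr_sqr gtr0_norm // ev.
  have p0 : 0 < euclid_norm (map (fun x => r * x) v).
    by rewrite (euclid_rho2 srv) sqrtr_gt0 rho_pos.
  have p1 : 0 < euclid_norm v by move: p0; rewrite e2 pmulr_rgt0.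
  split; first by rewrite p1 ev -sqrtr1 ler_wsqrtr.
  have := hE _ srv Wv p0; congr E; congr cvec_of; rewrite -map_comp; apply: eq_map => x /=.
  by rewrite e2; field; rewrite !gt_eqF.
set a := lebesgue_k _ (sphere_cone E) in up *; set b := lebesgue_k _ _ in bl bu.
have a0 : (0 <= a)%E by apply: itI_ge0 => v; rewrite lee_fin.
have b0 : (0 <= b)%E by apply: itI_ge0 => v; rewrite lee_fin.
have I0 : (0 <= Irad (2 * K))%E by apply: integral_ge0 => t _; exact: ephrad_ge0.
have g0 := gcst_gt0 (2 * K).
rewrite /unif_sphere_prob -/a -/b.
clear - up bl bu a0 b0 I0 g0 del1.
(* By [bl] and [bu] the product of [g], the ball volume and the radial integral is 1, which rules
   out infinite or zero factors and lets the [fine] in the definition be inverted; an infinite cone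
   volume makes the claim trivial. *)
move: (Irad _) (gcst _) a b up bl bu a0 b0 I0 g0 => I g a b.
case: b => [b||] //; case: I => [I||] //.
- move=> up bl bu a0; rewrite !lee_fin => b0 I0 g0; rewrite -!EFinM !lee_fin in bl bu.
  have gI : 0 < g * (b * I) by lra.
  have bp : 0 < b by rewrite lt_neqAle b0 andbT; apply/eqP => h; move: gI; rewrite -h mul0r mulr0 ltxx.
  case: a up a0 => [a||] // up a0 /=.
    move: up; rewrite -!EFinM !lee_fin => up.
    rewrite ler_pdivlMr //.
    have E1 : g * (b * I) = 1 by apply/eqP; rewrite eq_le bl bu.
    have h2 : (1 - del) * b <= g * (a * I) * b by rewrite ler_wpM2r.
    have E2 : g * (a * I) * b = a * (g * (b * I)) by ring.
    by apply: (le_trans h2); rewrite E2 E1 mulr1.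
  by rewrite gt0_mulye ?leey // lte_fin invr_gt0.
- move=> up bl bu a0 b0 I0 g0; exfalso.
  have [b00|bn] := eqVneq b 0; first by move: bu; rewrite b00 mul0e mule0 lee_fin ler10.
  have bp : 0 < b by rewrite lt_neqAle eq_sym bn -lee_fin.
  by move: bl; rewrite gt0_muley ?lte_fin // gt0_muley ?lte_fin.
- move=> up bl bu a0 b0 I0 g0; exfalso.
  have [b00|bn] := eqVneq I 0; first by move: bu; rewrite b00 mule0 mule0 lee_fin ler10.
  have bp : 0 < I by rewrite lt_neqAle eq_sym bn -lee_fin.
  by move: bl; rewrite gt0_mulye ?lte_fin // gt0_muley ?lte_fin.
- move=> up bl bu a0 b0 I0 g0; exfalso.
  by move: bl; rewrite mulyy gt0_muley ?lte_fin.
Qed.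

End Cone.

(** * Entanglement of formation and the choice of constants *)

Section Formation.
Context {R : realType}.
Local Notation C := (R[i]).
Local Notation "a %:CR" := (Complex a 0) (at level 2, format "a %:CR").
Local Notation re := complex.Re.
Local Notation im := complex.Im.

Definition nz n (z : 'cV[C]_n) : 'cV[C]_n := (Num.sqrt (fro z))^-1%:CR *: z.

Lemma fro_nz n (z : 'cV[C]_n) : 0 < fro z -> fro (nz z) = 1.
Proof. by move=> z0; rewrite /nz fro_scaleR exprVn sqr_sqrtr ?ltW // mulVf // gt_eqF. Qed.

Lemma nz_scale n (z : 'cV[C]_n) (a : R) : 0 < a -> nz (a%:CR *: z) = nz z.
Proof.
move=> a0; rewrite /nz fro_scaleR sqrtrM ?sqr_ge0 // sqrtr_sqr gtr0_norm // scalerA; congr (_ *: _).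
have [z0|zn] := eqVneq (Num.sqrt (fro z)) 0.
  by rewrite z0 mulr0 invr0; apply: complex_ext => /=; ring.
by apply: complex_ext => /=; field; rewrite // zn gt_eqF.
Qed.

Lemma nz_unit n (z : 'cV[C]_n) : fro z = 1 -> nz z = z.
Proof. by move=> z1; rewrite /nz z1 sqrtr1 invr1 Complex1E scale1r. Qed.

Lemma ctr_unit n (phi : 'cV[C]_n) : (ctr phi *m phi = 1) <-> (fro phi = 1).
Proof.
split => [h|h].
  rewrite fro_tr mxtrace_mulC h /mxtrace big_ord_recl big_ord0 addr0 mxE eqxx.
  by [].
apply/matrixP => i j; rewrite !ord1 [RHS]mxE eqxx mulr1n mxE.
have := innerxx phi; rewrite h /inner => e; rewrite -[RHS]e; apply: eq_bigr => k _.
by rewrite ctrE mulrC.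
Qed.

Lemma fro_sum_col n s (G : 'M[C]_(n, s)) : \sum_j fro (col j G) = fro G.
Proof.
rewrite /fro /rn exchange_big /=; apply: eq_bigr => i _; rewrite sum_col1.
by apply: eq_bigr => j _; rewrite mxE.
Qed.

Lemma gram_sum_col n s (G : 'M[C]_(n, s)) : G *m ctr G = \sum_j Defs.proj (col j G).
Proof.
apply/matrixP => a b; rewrite mxE summxE; apply: eq_bigr => j _.
by rewrite /Defs.proj [RHS]mxE big_ord_recl big_ord0 addr0 !ctrE !mxE.
Qed.

Lemma proj_scale n (a : R) (z : 'cV[C]_n) : Defs.proj (a%:CR *: z) = (a ^+ 2)%:CR *: Defs.proj z.
Proof.
rewrite /Defs.proj ctr_scale -scalemxAl -scalemxAr scalerA; congr (_ *: _).
by apply: complex_ext => /=; ring.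
Qed.

Lemma tr_proj n (z : 'cV[C]_n) : re (\tr (Defs.proj z)) = fro z.
Proof. by rewrite fro_tr. Qed.

Lemma re_tr_sum n m (p : 'I_m -> R) (phi : 'I_m -> 'cV[C]_n) :
  re (\tr (\sum_(i < m) (p i)%:CR *: Defs.proj (phi i))) = \sum_i p i * fro (phi i).
Proof.
rewrite [\tr _]raddf_sum re_sum; apply: eq_bigr => i _ /=.
by rewrite mxtraceZ re_mul tr_proj /= mul0r subr0.
Qed.

(** A matrix whose transpose kills the columns of [G] also kills the whole decomposition; the trace
    is then a vanishing sum of nonnegative terms, so every vector of positive weight is killed too.
    The transposes are there because [cokermx] and [submx] speak of row spaces. *)
Lemma range_of_decomp n s (G : 'M[C]_(n, s)) m (p : 'I_m -> R) (phi : 'I_m -> 'cV[C]_n) :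
  (forall i, 0 <= p i) -> G *m ctr G = \sum_(i < m) (p i)%:CR *: Defs.proj (phi i) ->
  forall i, 0 < p i -> exists x, phi i = G *m x.
Proof.
move=> p0 e i pi0.
pose K := cokermx G^T.
have GK : K^T *m G = 0.
  by have := mulmx_coker G^T; rewrite -/K => /(congr1 trmx); rewrite trmx_mul trmxK trmx0.
have hs : \sum_(l < m) (p l)%:CR *: ((K^T *m phi l) *m ctr (K^T *m phi l)) = 0.
  transitivity (K^T *m (G *m ctr G) *m ctr K^T); last by rewrite mulmxA GK !mul0mx.
  rewrite e mulmx_sumr mulmx_suml; apply: eq_bigr => l _.
  by rewrite -scalemxAr -scalemxAl /Defs.proj ctr_mul !mulmxA.
have fl : fro (K^T *m phi i) = 0.
  have : re (\tr (\sum_(l < m) (p l)%:CR *: Defs.proj (K^T *m phi l))) = 0.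
    by rewrite /Defs.proj hs mxtrace0.
  rewrite re_tr_sum => /psumr_eq0P h.
  have := h _ i isT => /(_ _) h2.
  have {}h2 : p i * fro (K^T *m phi i) = 0 by apply: h2 => l _; rewrite mulr_ge0 // fro_ge0.
  by move/eqP: h2; rewrite mulf_eq0 gt_eqF //= => /eqP.
have : (phi i)^T *m K = 0.
  by apply: trmx_inj; rewrite trmx_mul trmxK trmx0; exact: fro_eq0.
move=> /eqP; rewrite -submxE => /submxP [D hD].
by exists D^T; apply: trmx_inj; rewrite hD trmx_mul trmxK.
Qed.

(** The normalised columns of [G] form a decomposition. It yields the upper bound and shows that the
    set is nonempty, without which [inf] would be a default value. *)
Lemma EoF_bounds d s (G : 'M[C]_(d * d, s)) (lo hi : R) : (0 < d)%N -> fro G = 1 ->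
  (forall x, 0 < fro (G *m x) -> lo <= ent (nz (G *m x)) <= hi) ->
  lo <= EoF (G *m ctr G) <= hi.
Proof.
move=> d0 G1 h; rewrite /EoF; set Es := [set e | _].
have dd0 : (0 < d * d)%N by rewrite muln_gt0 d0.
have Elo : lbound Es lo.
  move=> e [m [p [phi [p0 phi1 rhoE ->]]]].
  have f1 i : fro (phi i) = 1 by apply/ctr_unit.
  have s1 : \sum_i p i = 1.
    have := re_tr_sum p phi; rewrite -rhoE -fro_tr G1 => ->.
    by apply: eq_bigr => i _; rewrite f1 mulr1.
  rewrite -[lo]mul1r -s1 mulr_suml; apply: ler_sum => i _.
  have [->|pn] := eqVneq (p i) 0; first by rewrite !mul0r.
  have pp : 0 < p i by rewrite lt_neqAle eq_sym pn p0.
  rewrite ler_pM2l //.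
  have [x hx] := range_of_decomp p0 rhoE pp.
  have := h x; rewrite -hx f1 ltr01 nz_unit // => /(_ isT) /andP[h1 _].
  exact: h1.
pose f0 : 'cV[C]_(d * d) := delta_mx (Ordinal dd0) 0.
have ff0 : fro f0 = 1 by exact: (fro_baseV dd0).
pose p (j : 'I_s) := fro (col j G).
(* A zero column has weight 0, but the decomposition still asks for a unit vector there. *)
pose phi (j : 'I_s) := if p j == 0 then f0 else nz (col j G).
have p0 j : 0 <= p j by exact: fro_ge0.
have phi1 j : fro (phi j) = 1.
  rewrite /phi; case: eqP => // /eqP pj; apply: fro_nz.
  by rewrite lt_neqAle eq_sym pj p0.
pose e1 := \sum_j p j * ent (phi j).
have Ee1 : Es e1.
  exists s, p, phi; split => //; first by move=> j; apply/ctr_unit.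
  rewrite gram_sum_col; apply: eq_bigr => j _; rewrite /phi; case: eqP => [pj|/eqP pj].
    rewrite pj (_ : Complex 0 0 = 0) // scale0r (fro_eq0 pj) /Defs.proj mul0mx //.
  have pp : 0 < p j by rewrite lt_neqAle eq_sym pj p0.
  rewrite /nz proj_scale scalerA exprVn sqr_sqrtr; last exact: p0.
  rewrite -/(p j).
  rewrite (_ : (p j)%:CR * _ = 1) ?scale1r //.
  by apply: complex_ext => /=; rewrite ?mulfV //; ring.
apply/andP; split; first by apply: lb_le_inf => //; exists e1.
apply: (@le_trans _ _ e1); first by apply: ge_inf => //; exists lo.
rewrite /e1 -[hi]mul1r -G1 -fro_sum_col mulr_suml; apply: ler_sum => j _; rewrite -/(p j).
have [->|pn] := eqVneq (p j) 0; first by rewrite !mul0r.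
have pp : 0 < p j by rewrite lt_neqAle eq_sym pn p0.
rewrite ler_pM2l // /phi (negbTE pn).
have := h (delta_mx j 0); rewrite -colE -/(p j) => /(_ pp) /andP[_ ->].
by [].
Qed.

Lemma Fpsi_phase d psi : phase_inv (@Fpsi R d psi d).
Proof.
move=> w g w1; rewrite /Fpsi matZ ctr_scale -scalemxAl -scalemxAr scalerA.
rewrite (_ : w * _ = 1) ?scale1r //.
have -> : w * Num.conj w = (nsq w)%:CR.
  by case: (w) => a b; rewrite /nsq; apply: complex_ext => /=; ring.
by rewrite w1.
Qed.

Lemma fro_phase n : phase_inv (@fro R n 1).
Proof. by move=> w g w1; rewrite fro_scaleC w1 mul1r. Qed.

Lemma fro_step d : stepF 0 1 (@fro R (d * d) 1).
Proof.
have sg : supergrad (@id R) (fun=> 1) by move=> x y _ _ /=; lra.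
have h01 (x : R) : 0 <= x -> 0 <= (1 : R) <= 1 by rewrite ler01 lexx.
move=> g; have [b [hb hs]] := Fpsi_step_id sg h01 g.
have fE (z : 'cV[C]_(d * d)) : Fpsi (@id R) z = fro z.
  by rewrite /Fpsi /spf sum_eigs_gram fro_mat.
exists b; split; first by rewrite add0r mul1r.
by move=> g' c s cs; have := hs g' c s cs; rewrite (fE g) (fE (_ + _)).
Qed.

Lemma psi1_step d : (2 <= d)%N -> stepF 0 1 (@Fpsi R d (psi1 d) d).
Proof.
move=> d2 g; have [b [hb hs]] := Fpsi_step_id (psi1_supergrad d2) (dpsi1_01 d2) g.
by exists b; split; [rewrite add0r mul1r | exact: hs].
Qed.

Lemma psi1_ge0 d (g : 'cV[C]_(d * d)) : (2 <= d)%N -> 0 <= Fpsi (psi1 d) g.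
Proof.
move=> d2; rewrite Fpsi1E mulr_ge0 ?invr_ge0 //; first by have := HN_ge1 (R := R) d2; lra.
rewrite big_nat_cond; apply: sumr_ge0 => j /andP[/andP[j1 _] _].
by apply: Fln_ge0; rewrite ler1n.
Qed.

(** Both the normalisation of the state and the length of [x] disappear when the vector is
    normalised, so the Gaussian bound over unit vectors applies. *)
Lemma range_unit n s (v : seq R) (a : R) (x : 'cV[C]_s) : 0 < a ->
  0 < fro ((a%:CR *: mat (cvec_of (n * s) v)) *m x) ->
  exists2 x' : 'cV[C]_s, fro x' = 1 & nz ((a%:CR *: mat (cvec_of (n * s) v)) *m x) = nz (GX n v x').
Proof.
move=> a0 f0.
have x0 : 0 < fro x.
  rewrite lt_neqAle fro_ge0 andbT; apply/eqP => /esym /fro_eq0 xz.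
  by move: f0; rewrite xz mulmx0 fro_col big1 ?ltxx // => i _; rewrite mxE /nsq /= expr0n addr0.
have q0 : 0 < Num.sqrt (fro x) by rewrite sqrtr_gt0.
exists (nz x); first exact: fro_nz.
by rewrite -scalemxAl nz_scale // [nz x]/nz GX_scale nz_scale // invr_gt0.
Qed.

Lemma cvec_scale n (v : seq R) (a : R) : cvec_of n (map (fun x => x / a) v) = a^-1%:CR *: cvec_of n v.
Proof.
apply/matrixP => i j; rewrite !mxE.
have hn k : nth 0 (map (fun x => x / a) v) k = nth 0 v k / a.
  have [kv|kv] := ltnP k (size v); first by rewrite (nth_map 0).
  by rewrite !nth_default ?size_map // mul0r.
by rewrite !hn; apply: complex_ext => /=; ring.
Qed.

Lemma fro_cvec n (v : seq R) : size v = (2 * n)%N -> fro (cvec_of n v) = euclid_norm v ^+ 2.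
Proof.
move=> sv; rewrite (euclid_rho2 sv) sqr_sqrtr ?rho2_ge0 // /rho2 (sum_evod (fun i : 'I_(2 * n) => (nth 0 v i) ^+ 2)).
by rewrite fro_col; apply: eq_bigr => i _; rewrite mxE.
Qed.

Lemma induced_prob_lower d s (T t del : R) (W : Om R -> \bar R) : (0 < d)%N -> (0 < s)%N ->
  measurable_fun setT W -> (forall v, (0 <= W v)%E) -> (EG (2 * (d * d * s)) W <= del%:E)%E -> del <= 1 ->
  (forall v, (W v < 1)%E -> forall x : 'cV[C]_s, fro x = 1 -> 0 < fro (GX (d * d) v x) ->
     `|ent (nz (GX (d * d) v x)) - T| <= t) ->
  ((1 - del)%:E <= induced_state_prob d s (fun rho => (`|EoF rho - T| <= t)%R))%E.
Proof.
move=> d0 s0 mW W0 EW del1 h.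
apply: (cone_lower _ mW W0 EW del1); first by rewrite !muln_gt0 d0 s0.
move=> v sv Wv nv; rewrite ptrace2_proj cvec_scale matZ.
have ni : 0 < (euclid_norm v)^-1 by rewrite invr_gt0.
set G := _ *: _.
have G1 : fro G = 1.
  by rewrite /G fro_scaleR fro_mat fro_cvec // -exprMn mulVf ?gt_eqF // expr1n.
have /andP[h1 h2] : T - t <= EoF (G *m ctr G) <= T + t; last by rewrite ler_norml; apply/andP; split; lra.
apply: EoF_bounds => // x fx.
have [x' x1 e] := range_unit ni fx.
rewrite -/G in e; rewrite e.
have fx' : 0 < fro (GX (d * d) v x').
  have := fro_nz fx; rewrite e /nz fro_scaleR; have := fro_ge0 (GX (d * d) v x').
  rewrite le_eqVlt => /orP[/eqP <-|//]; rewrite mulr0 => /eqP; by rewrite eq_sym oner_eq0.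
by have := h v Wv x' x1 fx'; rewrite ler_norml => /andP[h1 h2]; apply/andP; split; lra.
Qed.

(** The second bound rests on s >= 1: then (d kap)^2 >= 16384 * 8, so d kap exceeds 320 and the
    error ln d / d is absorbed by the one in kap. *)
Lemma numeric_choice (d s : nat) (t l L kap : R) : (1 <= s)%N -> 0 < l -> 0 < L -> (0 < d)%N ->
  kap = t / (320 * l) -> 0 < kap ->
  s%:R <= (320 ^+ 2 * (16384 * 8))^-1 * d%:R ^+ 2 * t ^+ 2 / l ^+ 2 ->
  [/\ 8 * s%:R <= (d * d)%:R * kap ^+ 2 / 16384, L / d%:R <= kap * L / 320 &
      (320 ^+ 2 * (16384 * 2))^-1 * d%:R ^+ 2 * t ^+ 2 / l ^+ 2 = (d * d)%:R * kap ^+ 2 / 16384 / 2].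
Proof.
move=> s1 l0 L0 d0 kE k0 hs.
have dR : (0 : R) < d%:R by rewrite ltr0n.
have sR : (1 : R) <= s%:R by rewrite ler1n.
have l320 : 0 < 320 * l by apply: mulr_gt0 l0; rewrite ltr0n.
have tE : t = kap * (320 * l) by rewrite kE (divfK (lt0r_neq0 l320)).
have e2 (y : R) : y * d%:R ^+ 2 * t ^+ 2 / l ^+ 2 = y * 320 ^+ 2 * (d%:R * kap) ^+ 2.
  by rewrite tE; field; rewrite gt_eqF.
rewrite e2 in hs; rewrite e2 natrM.
have ddk : d%:R * d%:R * kap ^+ 2 = (d%:R * kap) ^+ 2 by ring.
rewrite ddk.
have hs' : s%:R <= (d%:R * kap) ^+ 2 / (16384 * 8).
  have e : (320 ^+ 2 * (16384 * 8))^-1 * 320 ^+ 2 * (d%:R * kap) ^+ 2 = (d%:R * kap) ^+ 2 / (16384 * 8) by field.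
  by rewrite e in hs.
have dk0 : 0 < d%:R * kap by rewrite mulr_gt0.
split; first by clear hs e2; move: hs'; move: ((d%:R * kap) ^+ 2) => y; lra.
  have h : 320 <= d%:R * kap.
    rewrite leNgt; apply/negP => h.
    have : (d%:R * kap) ^+ 2 < (16384 * 8) by clear hs hs' e2; move: dk0 h; move: (d%:R * kap) => y y0 y1; rewrite expr2; nra.
    by clear hs e2; move: hs' sR; move: ((d%:R * kap) ^+ 2) => y; lra.
  rewrite ler_pdivrMr //; clear hs hs' e2.
  have -> : kap * L / 320 * d%:R = L * (d%:R * kap) / 320 by field.
  by rewrite ler_pdivlMr ?ltr0n //; exact: (ler_wpM2l (ltW L0) h).
by field.
Qed.

Lemma log2_ge1 d : (2 <= d)%N -> 1 <= log2 (d%:R : R).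
Proof.
move=> d2; rewrite /log2 ler_pdivlMr ?ln2_gt0 // mul1r ler_ln ?posrE ?ler_nat // ltr0n.
exact: ltnW.
Qed.

(** Entropies lie between 0 and log d, and 1 / (2 ln 2) <= 1 <= log d, so here the deviation never
    exceeds t; the zero function serves as [W]. *)
Lemma prob_large_t d s (t : R) : (2 <= d)%N -> (1 <= s)%N -> log2 d%:R < t ->
  (1 <= induced_state_prob d s (fun rho => (`|EoF rho - (log2 d%:R - 1 / (2 * ln 2))| <= t)%R))%E.
Proof.
move=> d2 s1 lt; have d0 : (0 < d)%N by exact: ltnW.
have l1 := log2_ge1 d2.
have h0 : (EG (2 * (d * d * s)) (fun=> 0%E) <= (0 : R)%:E)%E.
  by rewrite (@EG_cst R _ 0).
have := @induced_prob_lower d s (log2 d%:R - 1 / (2 * ln 2)) t 0 (fun=> 0%E) d0 s1 (measurable_cst _) (fun=> lexx _) h0 ler01.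
rewrite subr0; apply => v _ x x1 fx.
have /andP[e1 e2] := ent_bounds d0 (fro_nz fx).
have l2 := ln2_ge (R := R).
have q : 0 < 1 / (2 * ln (2 : R)) <= 1.
  have l2' : 0 < 2 * ln (2 : R) by lra.
  by rewrite divr_gt0 //= ler_pdivrMr //; lra.
move: q => /andP[q1 q2]; rewrite ler_norml; apply/andP; split; lra.
Qed.

(** Half of the exponent pays for the prefactor: exp 4 >= 2^4 > 12. *)
Lemma expR_absorb (X : R) : 8 <= X -> 12 * expR (- X) <= expR (- (X / 2)).
Proof.
move=> X8; have -> : - X = - (X / 2) - X / 2 by field.
rewrite expRD mulrCA ler_piMr ?expR_ge0 // expRN ler_pdivrMr ?expR_gt0 // mul1r.
have e1 : 2 <= expR 1 :> R by have := @expR_ge1Dx R 1; lra.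
have e4 : expR 1 ^+ 4 <= expR (X / 2) by rewrite -expRM_natl mulr1 ler_expR; lra.
apply: le_trans e4; apply: (@le_trans _ _ (2 ^+ 4)); first by rewrite !exprS expr0; lra.
by rewrite lerXn2r ?nnegrE ?expR_ge0.
Qed.

(** The entropy of a normalised vector depends on its squared norm and, up to small errors, on the
    sum of [psi1]. Each gets its own chaining functional of mean at most 6 exp (- X), and the two
    are added. *)
Lemma prob_small_t d s (t kap X : R) : (2 <= d)%N -> (1 <= s)%N -> 0 < kap -> kap <= 10^-1 ->
  X = (d * d)%:R * kap ^+ 2 / 16384 -> 8 * s%:R <= X ->
  160 * kap * ln d%:R + 80 * ln d%:R / d%:R <= t * ln 2 ->
  ((1 - expR (- (X / 2)))%:E <=
    induced_state_prob d s (fun rho => (`|EoF rho - (log2 d%:R - 1 / (2 * ln 2))| <= t)%R))%E.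
Proof.
move=> d2 s1 k0 k10 XE hX ht; have d0 : (0 < d)%N by exact: ltnW.
have n0 : (0 < d * d)%N by rewrite muln_gt0 d0.
have X8 : 8 <= X by apply: le_trans hX; rewrite ler_peMr // ler1n.
have k1 : kap <= 1 by apply: le_trans k10 _; rewrite invf_le1 // ler1n.
have [m [mE hm]] := Fpsi1_mean (R := R) d2.
have cF : fcontinuous (@Fpsi R d (psi1 d) d) := Fpsi_continuous (psi1_supergrad d2) (dpsi1_01 d2).
have mE2 := @EG_fro R (d * d).
pose W1 := Wch (@Fpsi R d (psi1 d) d) m kap s1.
pose W2 := Wch (@fro R (d * d) 1) (d * d)%:R kap s1.
have mW1 : measurable_fun setT W1 by exact: measurable_Wch.
have mW2 : measurable_fun setT W2 by apply: measurable_Wch; exact: fro_continuous.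
have W10 v : (0 <= W1 v)%E by exact: Wch_ge0.
have W20 v : (0 <= W2 v)%E by exact: Wch_ge0.
have E1 : (EG (2 * (d * d * s)) W1 <= (6 * expR (- X))%:E)%E.
  exact: (EG_Wch cF (psi1_step d2) (@Fpsi_phase d _) (fun g => psi1_ge0 g d2) n0 s1 mE k0 k1 XE hX).
have E2 : (EG (2 * (d * d * s)) W2 <= (6 * expR (- X))%:E)%E.
  exact: (EG_Wch (@fro_continuous R _) (@fro_step d) (@fro_phase _) (fun g => fro_ge0 g) n0 s1 mE2 k0 k1 XE hX).
have EW : (EG (2 * (d * d * s)) (fun v => W1 v + W2 v)%E <= (12 * expR (- X))%:E)%E.
  rewrite /EG itI_D //; apply: (le_trans (leeD E1 E2)).
  by rewrite -EFinD lee_fin -mulrDl -natrD.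
have ab := expR_absorb X8.
have e1 : expR (- (X / 2)) <= 1 by rewrite -[leRHS]expR0 ler_expR oppr_le0 divr_ge0 // (le_trans _ X8).
apply: (@le_trans _ _ (1 - 12 * expR (- X))%:E); first by rewrite lee_fin lerD2l lerN2.
apply: (induced_prob_lower d0 s1 _ _ EW).
- exact: emeasurable_funD.
- by move=> v; rewrite adde_ge0.
- exact: le_trans ab e1.
move=> v Wv x x1 fx.
have Wv1 : (W1 v < 1)%E by apply: le_lt_trans Wv; rewrite leeDl.
have Wv2 : (W2 v < 1)%E by apply: le_lt_trans Wv; rewrite leeDr.
have h1 := Wch_lt1 cF n0 k0 Wv1 x1; have h2 := Wch_lt1 (@fro_continuous R _) n0 k0 Wv2 x1.
have ddE : (d * d)%:R = d%:R ^+ 2 :> R by rewrite natrM.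
rewrite ddE in h1 h2.
have [_ hS] := entropy_close d2 k0 k10 hm h2 h1.
have l2 := ln2_gt0 (R := R).
rewrite ent_normalized // (_ : _ - _ = ((ln (fro (GX (d * d) v x)) - Fpsi (fun y => y * ln y) (GX (d * d) v x) / fro (GX (d * d) v x)) - (ln d%:R - 2^-1)) / ln 2); last first.
  by rewrite /log2; field; rewrite !gt_eqF.
rewrite normrM normfV (gtr0_norm l2) ler_pdivrMr //.
exact: le_trans hS ht.
Qed.

End Formation.

Theorem theorem1 (R : realType) :
  exists c C : R, 0 < c /\ 0 < C /\
  forall (d : nat) (t : R) (s : nat),
    (2 <= d)%N -> 0 < t -> (1 <= s)%N ->
    s%:R <= C * d%:R ^+ 2 * t ^+ 2 / log2 d%:R ^+ 2 ->
    (induced_state_prob d s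
       (fun rho => (`| EoF rho - (log2 d%:R - 1 / (2 * ln 2)) | <= t)%R)
     >= (1 - expR (- (c * d%:R ^+ 2 * t ^+ 2 / log2 d%:R ^+ 2)))%R%:E)%E.
Proof.
(* With kap = t / (320 log d) and X = d^2 kap^2 / 16384, the factor 8 expresses 8 s <= X and the
   factor 2 the exponent X / 2 left by [expR_absorb]. *)
exists (320 ^+ 2 * (16384 * 2))^-1, (320 ^+ 2 * (16384 * 8))^-1.
split; first by rewrite invr_gt0; lra.
split; first by rewrite invr_gt0; lra.
move=> d t s d2 t0 s1 hs.
have l1 := log2_ge1 (R := R) d2; set l := log2 d%:R in l1 hs *.
have [tl|tl] := ltP l t.
  apply: le_trans (prob_large_t d2 s1 tl).
  by rewrite lee_fin gerBl expR_ge0.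
have l0 : 0 < l by exact: lt_le_trans l1.
have d0 : (0 < d)%N by exact: ltnW.
have L0 : 0 < ln d%:R :> R.
  by have h := ln2_gt0 (R := R); rewrite -(pmulr_lgt0 _ (_ : 0 < (ln 2)^-1)) ?invr_gt0.
pose kap := t / (320 * l).
have l320 : 0 < 320 * l by apply: mulr_gt0 l0; rewrite ltr0n.
have k0 : 0 < kap by rewrite divr_gt0.
have k10 : kap <= 10^-1 by rewrite /kap ler_pdivrMr //; lra.
have [h1 h2 h3] := numeric_choice s1 l0 L0 d0 (erefl _ : kap = t / (320 * l)) k0 hs.
rewrite h3; apply: (prob_small_t d2 s1 k0 k10 _ h1); first by [].
have kL : kap * ln d%:R = t * ln 2 / 320.
  rewrite /kap /l /log2; field; rewrite !gt_eqF //; exact: ln2_gt0.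
rewrite -(mulrA 80) -(mulrA 160) kL.
have T0 : 0 < t * ln 2 by rewrite mulr_gt0 // ln2_gt0.
rewrite kL in h2; clear h1 h3 hs; lra.
Qed.
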